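(* Let $n\ge1$, let $\lambda\in\mathbb{R}$, and let $X:M\rightarrow\mathbb{R}^{n+1}$ be a connected $n$-dimensional compact $\lambda$-hypersurface in the Euclidean space $\mathbb{R}^{n+1}$, with mean curvature $H$. If $$\left(H-\frac{\lambda}{2}\right)^2\le n+\frac{\lambda^2}{4}$$ everywhere on $M$, then $\left(H-\frac{\lambda}{2}\right)^2\equiv n+\frac{\lambda^2}{4}$ on $M$, and $M$ is isometric to the sphere $S^n(r)$ for some radius $r>0$.
   Context: Let $X:M\to\mathbb{R}^{n+1}$ be a smooth immersed $n$-dimensional hypersurface (without boundary) with unit normal vector field $N$. $M$ carries the metric induced by $X$; ''isometric'' refers to this induced metric. The second fundamental form has components $h_{ij}=-\langle dN(e_i),e_j\rangle$ in a local orthonormal frame $e_1,\dots,e_n$ of $M$. The mean curvature is $H=\sum_i h_{ii}$ (not normalized, so that $\Delta X=HN$). The immersion is called a $\lambda$-hypersurface, for a real constant $\lambda$, if $\langle X,N\rangle+H=\lambda$ everywhere on $M$. (For example, $S^n(r)$ centered at the origin with inward normal is a $\lambda$-hypersurface with $\lambda=\frac nr-r$.) $S^n(r)$ denotes the round $n$-dimensional sphere of radius $r$. *)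

(* Defs.v *)
From HB Require Import structures.
From mathcomp Require Import all_boot all_order all_algebra.
From mathcomp Require Import all_classical all_reals all_analysis.

Set Implicit Arguments.
Unset Strict Implicit.
Unset Printing Implicit Defensive.

Import Order.TTheory GRing.Theory Num.Theory.
Import numFieldNormedType.Exports.

Local Open Scope classical_set_scope.
Local Open Scope ring_scope.

(* The norm that the library puts on ['rV[R]_n] is the sup norm; it is used
   here for the topology only. *)
Definition dot (R : realType) n (u v : 'rV[R]_n) : R := (u *m v^T) 0 0.

(* Only meaningful for open U: f is a total function whose values off U are
   irrelevant. *)
Fixpoint Ck_on (R : realType) n m (k : nat) (U : set 'rV[R]_n)
    (f : 'rV[R]_n -> 'rV[R]_m) : Prop :=
  (forall x, U x -> {for x, continuous f}) /\
  if k is k'.+1 then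
    forall i : 'I_n, (forall x, U x -> derivable f x (delta_mx 0 i)) /\
                     Ck_on k' U (fun x => 'D_(delta_mx 0 i) f x)
  else True.

Definition smooth_on (R : realType) n m (U : set 'rV[R]_n)
    (f : 'rV[R]_n -> 'rV[R]_m) : Prop := forall k, Ck_on k U f.

(* [chart_map] and [chart_inv] are total functions, meaningful only on
   [chart_dom] and on its image respectively. *)
Record chart (R : realType) (n : nat) (M : topologicalType) := Chart {
  chart_dom : set M;
  chart_map : M -> 'rV[R]_n;
  chart_inv : 'rV[R]_n -> M;
  chart_dom_open : open chart_dom;
  chart_cod_open : open (chart_map @` chart_dom);
  chart_mapK : forall p, chart_dom p -> chart_inv (chart_map p) = p;
  chart_map_cont : {within chart_dom, continuous chart_map};
  chart_inv_cont : {within chart_map @` chart_dom, continuous chart_inv} }.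

Definition chart_cod (R : realType) n (M : topologicalType)
  (c : chart R n M) : set 'rV[R]_n := chart_map c @` chart_dom c.

(* The atlas is not required to be maximal. *)
Record manifold (R : realType) (n : nat) := Manifold {
  carrier :> topologicalType;
  atlas : set (chart R n carrier);
  manifold_hausdorff : hausdorff_space carrier;
  manifold_second_countable : @second_countable carrier;
  atlas_cover : forall p : carrier, exists2 c, atlas c & chart_dom c p;
  atlas_smooth : forall c d, atlas c -> atlas d ->
    smooth_on (chart_map c @` (chart_dom c `&` chart_dom d))
              (chart_map d \o chart_inv c) }.

Section Hypersurface.
Variables (R : realType) (n : nat) (M : manifold R n).

Definition smooth_map m (f : M -> 'rV[R]_m) : Prop :=
  forall c, atlas c -> smooth_on (chart_cod c) (f \o chart_inv c).

(* Tangent vectors at p are represented by their coordinates in a chart c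
   around p; [diff_at c f p v] is df_p(v). *)
Definition diff_at m (c : chart R n M) (f : M -> 'rV[R]_m) (p : M)
    (v : 'rV[R]_n) : 'rV[R]_m :=
  'D_v (f \o chart_inv c) (chart_map c p).

Definition immersion m (X : M -> 'rV[R]_m) : Prop :=
  smooth_map X /\
  forall c p, atlas c -> chart_dom c p ->
    forall v, diff_at c X p v = 0 -> v = 0.

Definition unit_normal (X N : M -> 'rV[R]_n.+1) : Prop :=
  [/\ smooth_map N,
      forall p, dot (N p) (N p) = 1 &
      forall c p, atlas c -> chart_dom c p ->
        forall v, dot (N p) (diff_at c X p v) = 0].

Definition induced_metric m (X : M -> 'rV[R]_m) (c : chart R n M) (p : M)
    (u v : 'rV[R]_n) : R :=
  dot (diff_at c X p u) (diff_at c X p v).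

Definition orthonormal_frame m (X : M -> 'rV[R]_m) (c : chart R n M) (p : M)
    (e : 'I_n -> 'rV[R]_n) : Prop :=
  forall i j, induced_metric X c p (e i) (e j) = (i == j)%:R.

(* h(u, v) = - <dN(u), v>, the tangent vector v being identified with dX(v). *)
Definition second_fundamental_form (X N : M -> 'rV[R]_n.+1)
    (c : chart R n M) (p : M) (u v : 'rV[R]_n) : R :=
  - dot (diff_at c N p u) (diff_at c X p v).

(* The trace of h in an orthonormal frame at p. Such a frame exists when X is
   an immersion, and the trace depends neither on it nor on the chart, so the
   set below is then a singleton and the default value 0 is not used. *)
Definition mean_curvature (X N : M -> 'rV[R]_n.+1) (p : M) : R :=
  xget 0 [set H : R | exists c (e : 'I_n -> 'rV[R]_n),
    [/\ atlas c, chart_dom c p, orthonormal_frame X c p e &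
        H = \sum_i second_fundamental_form X N c p (e i) (e i)]].

Definition lambda_hypersurface (lambda : R) (X N : M -> 'rV[R]_n.+1) : Prop :=
  [/\ immersion X, unit_normal X N &
      forall p, dot (X p) (N p) + mean_curvature X N p = lambda].

(* Smoothness of a map defined on a subset S of a Euclidean space: in charts of
   M, it extends locally to a smooth map on an open set. For S an embedded
   submanifold this is smoothness for the submanifold structure. *)
Definition smooth_on_subset m (S : set 'rV[R]_m) (G : 'rV[R]_m -> M) : Prop :=
  forall y c, S y -> atlas c -> chart_dom c (G y) ->
    exists (W : set 'rV[R]_m) (g : 'rV[R]_m -> 'rV[R]_n),
      [/\ open W, W y, smooth_on W g &
          forall z, W z -> S z -> chart_dom c (G z) /\ g z = chart_map c (G z)].

Definition sphere (r : R) : set 'rV[R]_n.+1 := [set y | dot y y = r ^+ 2].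

(* F is a diffeomorphism of M, with the metric induced by X, onto the embedded
   submanifold S^n(r) of R^(n+1) (inverse G) that preserves the metrics. As
   S^n(r) carries the Euclidean inner product, the pullback of its metric by F
   is the metric induced by F viewed as a map into R^(n+1). *)
Definition isometric_to_sphere m (X : M -> 'rV[R]_m) (r : R) : Prop :=
  exists (F : M -> 'rV[R]_n.+1) (G : 'rV[R]_n.+1 -> M),
    [/\ smooth_map F /\ smooth_on_subset (sphere r) G,
        forall p, sphere r (F p),
        forall p, G (F p) = p,
        forall y, sphere r y -> F (G y) = y &
        forall c p, atlas c -> chart_dom c p ->
          forall u v, induced_metric F c p u v = induced_metric X c p u v].

End Hypersurface.

(* Main.v *)
(* By the lambda-equation, n + H<X,N> = n + lambda^2/4 - (H - lambda/2)^2, so the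
   hypothesis says that |X|^2/2, whose Laplacian is n + H<X,N>, is subharmonic.
   It attains its maximum on the compact M, so by the strong maximum principle it
   is constant; hence n + H<X,N> = 0 and X is a local isometry into a round
   sphere. The maximum principle is Hopf's barrier argument, carried out with
   second derivatives along an orthonormal frame instead of a Laplacian.

   It remains to see that M is a round sphere. For n >= 2 the inverse
   stereographic projections lift through X, which makes X bijective. For n = 1
   a lift of t |-> x0 exp(it) is a covering of M by the line with period
   2 pi k, so that X = Q o F with F an embedding onto the circle of radius k r
   and Q z = x0 (z / (k r))^k. *)
Require Import Defs.
From HB Require Import structures.
From mathcomp Require Import all_boot all_order all_algebra.
From mathcomp Require Import all_classical all_reals all_analysis.
From mathcomp Require Import ring lra.
Import Order.TTheory GRing.Theory Num.Theory.
Import numFieldNormedType.Exports.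
Local Open Scope classical_set_scope.
Local Open Scope ring_scope.
Set Implicit Arguments.
Unset Strict Implicit.
Unset Printing Implicit Defensive.

(** * Smooth functions *)

(** The maximum of the barrier is tested along straight lines of a chart, where second derivatives
    of X have uncontrolled tangential parts. The first-order condition at the maximum makes a
    combination of X and X - Q normal to M; pairing with it keeps only the normal part, whose trace
    is H. This takes the place of covariant differentiation. The assumed inequality also bounds |H|,
    and this bound fixes the steepness of the barrier.

    Local inverses of X come from the inverse function theorem in R^(n+1), applied to the cone (s,
    x) -> (1 + s) f(x) over a chart expression f of X. It yields both the local sections over the
    sphere, smooth in ambient coordinates, and injectivity along rays, which the maximum principle
    uses.

    As X is only immersed, M is a priori a compact covering of the sphere. For n >= 2 the lift of
    the inverse stereographic projection extends over the missing pole because the far region of a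
    hyperplane of dimension n is connected. On a line this region has two ends: the curve may wind k
    times, and M is then a circle of radius k r, not r. *)

Section PointwiseContinuity.
Variables (R : realType) (T : topologicalType).
Implicit Types (W : normedModType R).

Lemma contC W (a : W) (x : T) : {for x, continuous (fun=> a)}.
Proof. exact: cst_continuous. Qed.

Lemma contD W (f g : T -> W) x : {for x, continuous f} ->
  {for x, continuous g} -> {for x, continuous (fun y => f y + g y)}.
Proof. by move=> cf cg; exact: (cvgD cf cg). Qed.

Lemma contN W (f : T -> W) x : {for x, continuous f} ->
  {for x, continuous (fun y => - f y)}.
Proof. by move=> cf; exact: (cvgN cf). Qed.

Lemma contB W (f g : T -> W) x : {for x, continuous f} ->
  {for x, continuous g} -> {for x, continuous (fun y => f y - g y)}.
Proof. by move=> cf cg; exact: (cvgB cf cg). Qed.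

Lemma cont_norm W (f : T -> W) x : {for x, continuous f} ->
  {for x, continuous (fun y => `|f y|)}.
Proof. by move=> cf; exact: (cvg_norm cf). Qed.

Lemma cont_rnorm n (f : T -> 'rV[R]_n) x : {for x, continuous f} ->
  {for x, continuous (fun y => `|f y|)}.
Proof. exact: (@cont_norm 'rV[R]_n). Qed.

Lemma contM (f g : T -> R) x : {for x, continuous f} ->
  {for x, continuous g} -> {for x, continuous (fun y => f y * g y)}.
Proof. by move=> cf cg; exact: (cvgM cf cg). Qed.

Lemma contV (f : T -> R) x : f x != 0 -> {for x, continuous f} ->
  {for x, continuous (fun y => (f y)^-1)}.
Proof. by move=> f0 cf; exact: (cvgV f0 cf). Qed.

Lemma contZ W (f : T -> R) (g : T -> W) x : {for x, continuous f} ->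
  {for x, continuous g} -> {for x, continuous (fun y => f y *: g y)}.
Proof. by move=> cf cg; exact: (cvgZ cf cg). Qed.

Lemma cont_sum W (I : Type) (r : seq I) (P : pred I) (F : I -> T -> W) x :
  (forall i, P i -> {for x, continuous (F i)}) ->
  {for x, continuous (fun y => \sum_(i <- r | P i) F i y)}.
Proof.
move=> cF; exact: (@cvg_big W _ _ 0 P (@add_continuous W) _ (nbhs x) r F _ _ cF).
Qed.

Lemma cont_comp (U V : topologicalType) (f : T -> U) (g : U -> V) x :
  {for x, continuous f} -> {for f x, continuous g} ->
  {for x, continuous (fun y => g (f y))}.
Proof. by move=> cf cg; exact: (continuous_comp cf cg). Qed.

Lemma contP W (f : T -> W) x : {for x, continuous f} <->
  forall e : R, 0 < e -> \forall y \near x, `|f x - f y| < e.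
Proof.
split=> [cf e e0|H]; first exact: ((cvgrPdist_lt _ _).1 cf _ e0).
by apply/cvgrPdist_lt => e e0; exact: H.
Qed.

Lemma near_lt (f : T -> R) x c : {for x, continuous f} -> f x < c ->
  \forall y \near x, f y < c.
Proof.
move=> cf fc; apply: (cf [set t | t < c]).
by apply: open_nbhs_nbhs; split=> //; exact: open_lt.
Qed.

Lemma near_gt (f : T -> R) x c : {for x, continuous f} -> c < f x ->
  \forall y \near x, c < f y.
Proof.
move=> cf fc; apply: (cf [set t | c < t]).
by apply: open_nbhs_nbhs; split=> //; exact: open_gt.
Qed.

Lemma open_lt_cont (f : T -> R) c : continuous f -> open [set x | f x < c].
Proof.
by move=> cf; rewrite openE => x fx; exact: (near_lt (cf x) fx).
Qed.

Lemma closed_le_cont (f : T -> R) c : continuous f -> closed [set x | f x <= c].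
Proof.
move=> cf; rewrite (_ : [set x | _] = ~` [set x | c < f x]).
  by apply: open_closedC; rewrite openE => x fx; exact: (near_gt (cf x) fx).
by apply/seteqP; split=> x /=; rewrite real_leNgt ?num_real//; move=> /negP.
Qed.

End PointwiseContinuity.

Lemma derive_line (R : realType) (V W : normedModType R) (f : V -> W) x v t :
  derivable f (x + t *: v) v ->
  is_derive t (1 : R) (fun s : R => f (x + s *: v)) ('D_v f (x + t *: v)).
Proof.
have E : (fun h => h^-1 *: (((fun s : R => f (x + s *: v)) \o shift t) (h *: 1)
   - f (x + t *: v))) =
  (fun h => h^-1 *: ((f \o shift (x + t *: v)) (h *: v) - f (x + t *: v))).
  apply/funext => h /=; congr (_ *: (f _ - _)).
  by rewrite [h *: 1]mulr1 scalerDl addrCA.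
by move=> df; split; rewrite /derivable /derive E.
Qed.

Lemma MVT_line (R : realType) (V : normedModType R) (f : V -> R) x v (c : R) :
  (forall t, `|t| <= `|c| -> derivable f (x + t *: v) v) ->
  exists2 t, `|t| <= `|c| & f (x + c *: v) - f x = c * 'D_v f (x + t *: v).
Proof.
move=> df; pose g := fun s : R => f (x + s *: v).
have dg t : `|t| <= `|c| -> is_derive t (1 : R) g ('D_v f (x + t *: v)).
  by move=> /df; exact: derive_line.
have key (a b : R) : a <= b -> (forall t, a <= t <= b -> `|t| <= `|c|) ->
    exists2 t, `|t| <= `|c| & g b - g a = 'D_v f (x + t *: v) * (b - a).
  move=> ab abc.
  have [||t + tE] := @MVT_segment R g (fun t => 'D_v f (x + t *: v)) a b ab.
  - by move=> t /itvP tab; apply: dg; apply: abc; rewrite !tab.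
  - apply: derivable_within_continuous => t /itvP tab.
    by apply: ex_derive; apply: dg; apply: abc; rewrite !tab.
  - by move=> /itvP tab; exists t => //; apply: abc; rewrite !tab.
have g0 : g 0 = f x by rewrite /g scale0r addr0.
have [c0|c0] := leP 0 c.
  have [|t tc] := key 0 c c0.
    by move=> t /andP[t0 tc]; rewrite !ger0_norm.
  by rewrite g0 subr0 => E; exists t => //; rewrite -/(g c) E mulrC.
have [|t tc] := key c 0 (ltW c0).
  by move=> t /andP[t0 tc]; rewrite !ler0_norm// ?lerN2// ltW.
rewrite g0 sub0r => E; exists t => //.
by rewrite -/(g c) -opprB E; ring.
Qed.

Lemma differentiable_eps (R : realType) (V W : normedModType R) (f : V -> W)
    (L : {linear V -> W}) x : continuous L ->
  (forall e, 0 < e -> \forall h \near (0 : V),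
    `|f (h + x) - f x - L h| <= e * `|h|) ->
  differentiable f x /\ 'd f x = L :> (V -> W).
Proof.
move=> cL H.
have E : f \o shift x = cst (f x) + L +o_ (0 : V) id.
  apply/eqaddoP => e e0; near=> h.
  have -> : (f \o shift x - (cst (f x) + L : V -> W)) h =
            f (h + x) - f x - L h by rewrite !fctE /= opprD addrA.
  by near: h; apply: H.
have E2 := diff_unique cL E.
split => //; apply/diff_locallyP; split; first by rewrite E2.
by rewrite E2.
Unshelve. all: by end_near.
Qed.

Lemma norm_coord (R : realType) n (v : 'rV[R]_n) i : `|v 0 i| <= `|v|.
Proof.
rewrite [leRHS]/Num.Def.normr /= mx_normrE.
exact: (le_bigmax _ (fun j : 'I_1 * 'I_n => `|v j.1 j.2|) (0, i)).
Qed.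

Lemma norm_row_le (R : realType) n (v : 'rV[R]_n) c :
  0 <= c -> (forall i, `|v 0 i| <= c) -> `|v| <= c.
Proof.
move=> c0 H; rewrite [leLHS]/Num.Def.normr /= mx_normrE; apply: bigmax_le => //.
by move=> [i j] _ /=; rewrite (ord1 i).
Qed.

Lemma cont_coordP (R : realType) (T : topologicalType) n (f : T -> 'rV[R]_n) x :
  {for x, continuous f} <-> forall j, {for x, continuous (fun y => f y 0 j)}.
Proof.
split=> [cf j|cf].
  exact: (continuous_comp cf (@coord_continuous _ _ _ _ _ _)).
apply/cvgrPdist_le => e e0; near=> y.
apply: norm_row_le; first exact: ltW.
move=> j; rewrite !mxE; move: j; near: y; apply: filter_forall => j.
exact: ((cvgrPdist_le _ _).1 (cf j)).
Unshelve. all: by end_near.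
Qed.

Lemma continuous_linear_row (R : realType) n (W : normedModType R)
  (L : {linear 'rV[R]_n -> W}) : continuous L.
Proof.
have LE : L = (fun v => \sum_i v 0 i *: L (delta_mx 0 i)) :> (_ -> _).
  apply/funext => v; rewrite {1}[v]row_sum_delta linear_sum.
  by apply: eq_bigr => i _; rewrite linearZ.
rewrite LE => x; apply: cont_sum => i _.
by apply: contZ; [exact: coord_continuous|exact: contC].
Qed.

(* The increment is split along the coordinate axes, one coordinate at a time. *)
Lemma C1_differentiable_real (R : realType) n (f : 'rV[R]_n -> R)
    (x : 'rV[R]_n) :
  (forall i, \forall y \near x, derivable f y (delta_mx 0 i)) ->
  (forall i, {for x, continuous (fun y => 'D_(delta_mx 0 i) f y)}) ->
  differentiable f x.
Proof.
move=> df cdf.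
pose J := \col_i 'D_(delta_mx 0 i) f x : 'cV[R]_n.
pose L := fun h : 'rV[R]_n => (h *m J) 0 0.
have Llin : linear L by move=> a u v; rewrite /L mulmxDl -scalemxAl !mxE.
pose LM := GRing.isLinear.Build _ _ _ _ L Llin.
pose LL : {linear 'rV[R]_n -> R} := HB.pack L LM.
suff [] : differentiable f x /\ 'd f x = LL :> (_ -> _) by [].
apply: differentiable_eps; first exact: continuous_linear_row.
move=> e e0.
(* Each of the n coordinate steps may cost [e1] times the norm of [h]; dividing by [n.+1] keeps [e1]
   positive when n = 0. *)
pose e1 := e / n.+1%:R.
have e10 : 0 < e1 by rewrite divr_gt0.
have : \forall y \near x, forall i, derivable f y (delta_mx 0 i) /\
   `|'D_(delta_mx 0 i) f x - 'D_(delta_mx 0 i) f y| <= e1.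
  apply: (@filter_forall _ _ (fun i y => derivable f y (delta_mx 0 i) /\
      `|'D_(delta_mx 0 i) f x - 'D_(delta_mx 0 i) f y| <= e1) _ (nbhs_filter x)) => i.
    apply: filterI; first exact: df.
  exact: ((cvgrPdist_le _ _).1 (cdf i)).
move=> /nbhs_ballP[d /= d0 Hd].
apply/nbhs_ballP; exists d => //= h.
rewrite -ball_normE /= sub0r normrN => hd.
pose p (k : nat) : 'rV[R]_n := \row_i (if (i < k)%N then h 0 i else 0).
have p0 : p 0%N = 0 by apply/rowP => i; rewrite !mxE.
have pn : p n = h by apply/rowP => i; rewrite !mxE ltn_ord.
have pS (k : 'I_n) : p k.+1 = p k + h 0 k *: delta_mx 0 k.
  apply/rowP => i; rewrite !mxE eqxx /= ltnS leq_eqVlt.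
  have [->|ik] := eqVneq i k; first by rewrite ltnn eqxx mulr1 add0r.
  by rewrite (negbTE (ik : (i : nat) != k)) mulr0 addr0.
have step (k : 'I_n) :
    `|f (p k.+1 + x) - f (p k + x) - h 0 k * 'D_(delta_mx 0 k) f x| <= e1 * `|h|.
  (* In the sup norm every point of the staircase from 0 to [h] stays within the norm of [h], hence
     in the ball where the estimates hold. *)
  have near_t t : `|t| <= `|h 0 k| ->
    ball x d (p k + x + t *: delta_mx 0 k).
    move=> th; rewrite -ball_normE /= opprD addrA [p k + x]addrC opprD addrA.
    rewrite subrr sub0r -opprD normrN (le_lt_trans _ hd)//.
    apply: norm_row_le => // i; rewrite !mxE eqxx /=.
    have [->|ik] := eqVneq i k.
      by rewrite ltnn mulr1 add0r (le_trans th)// norm_coord.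
    by rewrite mulr0 addr0; case: ifP => _; rewrite ?normr0// norm_coord.
  have [|t th E] := @MVT_line R _ f (p k + x) (delta_mx 0 k) (h 0 k).
    by move=> t /near_t/Hd/(_ k)[].
  have -> : p k.+1 + x = p k + x + h 0 k *: delta_mx 0 k.
    by rewrite pS addrAC.
  rewrite E -mulrBr normrM mulrC distrC ler_pM ?norm_coord//.
  by have [] := Hd _ (near_t _ th) k.
have -> : f (h + x) - f x - LL h =
  \sum_(k < n) (f (p k.+1 + x) - f (p k + x) - h 0 k * 'D_(delta_mx 0 k) f x).
  rewrite sumrB; congr (_ - _).
    rewrite -(big_mkord xpredT (fun k => f (p k.+1 + x) - f (p k + x))).
    by rewrite (telescope_sumr (fun k => f (p k + x))) // p0 pn add0r.
  by rewrite /= /L mxE; apply: eq_bigr => k _; rewrite mxE.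
apply: (le_trans (ler_norm_sum _ _ _)).
apply: (@le_trans _ _ (\sum_(k < n) e1 * `|h|)); first exact: ler_sum.
rewrite sumr_const card_ord -mulr_natr mulrAC ler_wpM2r//.
by rewrite /e1 mulrAC ler_pdivrMr// ler_wpM2l// ?ltW// ltr_nat.
Qed.

(* [Ck_on] with values in a normed module: [Ck_on] itself does not cover real-valued
   functions. *)
Fixpoint Ck (R : realType) n (W : normedModType R) (k : nat)
    (U : set 'rV[R]_n) (f : 'rV[R]_n -> W) : Prop :=
  (forall x, U x -> {for x, continuous f}) /\
  if k is k'.+1 then
    forall i : 'I_n, (forall x, U x -> derivable f x (delta_mx 0 i)) /\
                     Ck k' U (fun x => 'D_(delta_mx 0 i) f x)
  else True.

Definition smooth (R : realType) n (W : normedModType R) (U : set 'rV[R]_n)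
  (f : 'rV[R]_n -> W) := forall k, Ck k U f.

Lemma Ck_onE (R : realType) n m k (U : set 'rV[R]_n) (f : 'rV[R]_n -> 'rV[R]_m) :
  Ck_on k U f <-> Ck k U f.
Proof.
elim: k f => [//|k IH] f; split=> -[cf df]; split=> // i; have [df1 df2] := df i;
  by split=> //; apply/IH.
Qed.

Lemma smooth_onE (R : realType) n m (U : set 'rV[R]_n) (f : 'rV[R]_n -> 'rV[R]_m) :
  smooth_on U f <-> smooth U f.
Proof. by split=> H k; apply/Ck_onE. Qed.

Lemma continuous_eq_near (T U : topologicalType) (f g : T -> U) x :
  (\near x, f x = g x) -> {for x, continuous f} -> {for x, continuous g}.
Proof.
move=> fgx cf; change (g @ x --> g x); rewrite -(nbhs_singleton fgx).
by apply: cvg_trans cf; apply: near_eq_cvg; apply: filterS fgx => y ->.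
Qed.

Section CkTheory.
Variables (R : realType) (n : nat).
Implicit Types (W : normedModType R) (U : set 'rV[R]_n).

Lemma Ck_cont W k U (f : 'rV[R]_n -> W) x :
  Ck k U f -> U x -> {for x, continuous f}.
Proof. by case: k => [|k] [cf _]; exact: cf. Qed.

(** [Ck] only asks for properties of a total function at the points of the set, so it can be checked
    point by point, each time on any set containing the point. *)
Lemma Ck_local W k U (f : 'rV[R]_n -> W) :
  (forall x, U x -> exists2 V, V x & Ck k V f) -> Ck k U f.
Proof.
elim: k f => [|k IH] f H; split=> //.
- by move=> x /H[V Vx /Ck_cont]; apply.
- by move=> x /H[V Vx /Ck_cont]; apply.
- move=> i; split; first by move=> x /H[V Vx [_ /(_ i)[+ _]]]; apply.
  by apply: IH => x /H[V Vx [_ /(_ i)[_ ?]]]; exists V.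
Qed.

Lemma Ck_sub W k U V (f : 'rV[R]_n -> W) : V `<=` U -> Ck k U f -> Ck k V f.
Proof. by move=> VU H; apply: Ck_local => x /VU Ux; exists U. Qed.

Lemma CkW W k U (f : 'rV[R]_n -> W) : Ck k.+1 U f -> Ck k U f.
Proof.
elim: k f => [|k IH] f [cf df]; first by split.
by split=> // i; have [? ?] := df i; split => //; exact: IH.
Qed.

Lemma Ck_eq_near W k U (f g : 'rV[R]_n -> W) :
  (forall x, U x -> \near x, f x = g x) -> Ck k U f -> Ck k U g.
Proof.
elim: k f g => [|k IH] f g fg [cf df].
  by split=> // x Ux; exact: continuous_eq_near (fg x Ux) (cf x Ux).
split=> [x Ux|i]; first exact: continuous_eq_near (fg x Ux) (cf x Ux).
have [dfi cdf] := df i; split=> [x Ux|].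
  exact: near_eq_derivable (fg x Ux) (dfi x Ux).
(* Agreement near x is also agreement near every point close to x, so the partial derivatives agree
   near x. *)
apply: IH cdf => x /fg; rewrite -[X in X -> _]nbhs_nearE => /nbhs_interior.
by apply: filterS => y; exact: near_eq_derive.
Qed.

Lemma Ck_eq W k U (f g : 'rV[R]_n -> W) : open U ->
  (forall x, U x -> f x = g x) -> Ck k U f -> Ck k U g.
Proof.
move=> oU fg; apply: Ck_eq_near => x Ux.
by apply: filterS fg _; exact: open_nbhs_nbhs.
Qed.

(** Entry point of the inductions below: the partial derivatives are given by a formula that need
    hold only on U. *)
Lemma Ck_is_derive W k U (f : 'rV[R]_n -> W) (g : 'I_n -> 'rV[R]_n -> W) :
  open U -> (forall x, U x -> {for x, continuous f}) ->
  (forall i x, U x -> is_derive x (delta_mx 0 i) f (g i x)) ->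
  (forall i, Ck k U (g i)) -> Ck k.+1 U f.
Proof.
move=> oU cf df cg; split=> // i; split=> [x /(df i)|]; first by case.
by apply: Ck_eq (cg i) => // x /(df i)[_ ->].
Qed.

Lemma Ck_cst W k U (a : W) : Ck k U (fun=> a).
Proof.
elim: k a => [|k IH] a; first by split=> // x _; exact: cst_continuous.
split=> [x _|i]; first exact: cst_continuous.
split=> [x _|]; first exact: derivable_cst.
have -> : (fun x : 'rV[R]_n => 'D_(delta_mx 0 i) (fun _ : 'rV[R]_n => a) x) =
          (fun=> 0).
  by apply/funext => x; rewrite derive_cst.
exact: IH.
Qed.

Lemma is_derive_linear W (L : {linear 'rV[R]_n -> W}) x v :
  is_derive x v L (L v).
Proof.
have dL : differentiable L x by apply: linear_differentiable; exact: continuous_linear_row.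
split; first exact: diff_derivable.
by rewrite deriveE// diff_lin//; exact: continuous_linear_row.
Qed.

Lemma Ck_linear W k U (L : {linear 'rV[R]_n -> W}) : Ck k U L.
Proof.
have cL : Ck 0 U L by split=> // x _; exact: continuous_linear_row.
case: k => // k; split=> [x _|i]; first exact: continuous_linear_row.
split=> [x _|]; first exact: (@ex_derive _ _ _ _ _ _ _ (is_derive_linear L x _)).
have -> : (fun x => 'D_(delta_mx 0 i) L x) = (fun=> L (delta_mx 0 i)).
  by apply/funext => x; exact: (@derive_val _ _ _ _ _ _ _ (is_derive_linear L x _)).
exact: Ck_cst.
Qed.

Lemma CkD W k U (f g : 'rV[R]_n -> W) : open U ->
  Ck k U f -> Ck k U g -> Ck k U (fun x => f x + g x).
Proof.
move=> oU; elim: k f g => [|k IH] f g [cf df] [cg dg].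
  by split=> // x Ux; exact: (cvgD (cf x Ux) (cg x Ux)).
apply: (@Ck_is_derive _ _ _ _
    (fun i x => 'D_(delta_mx 0 i) f x + 'D_(delta_mx 0 i) g x)) => //.
- by move=> x Ux; exact: (cvgD (cf x Ux) (cg x Ux)).
- move=> i x Ux; apply: is_deriveD; apply: derivableP.
    by apply: (df i).1.
  by apply: (dg i).1.
- by move=> i; apply: IH; [exact: (df i).2|exact: (dg i).2].
Qed.

Lemma CkM k U (f g : 'rV[R]_n -> R) : open U ->
  Ck k U f -> Ck k U g -> Ck k U (fun x => f x * g x).
Proof.
move=> oU; elim: k f g => [|k IH] f g cf cg.
  by split=> // x Ux; exact: (cvgM (Ck_cont cf Ux) (Ck_cont cg Ux)).
have [_ df] := cf; have [_ dg] := cg.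
apply: (@Ck_is_derive _ _ _ _
    (fun i x => f x * 'D_(delta_mx 0 i) g x + g x * 'D_(delta_mx 0 i) f x)) => //.
- by move=> x Ux; exact: (cvgM (Ck_cont cf Ux) (Ck_cont cg Ux)).
- move=> i x Ux; apply: is_deriveM; apply: derivableP.
    by apply: (df i).1.
  by apply: (dg i).1.
- move=> i; apply: CkD => //; apply: IH; try exact: CkW.
    exact: (dg i).2.
  exact: (df i).2.
Qed.

Lemma Ck_sum W k U (I : Type) (r : seq I) (P : pred I) (F : I -> 'rV[R]_n -> W) :
  open U -> (forall i, P i -> Ck k U (F i)) ->
  Ck k U (fun x => \sum_(i <- r | P i) F i x).
Proof.
move=> oU cF; elim: r => [|i r IH].
  by rewrite (_ : (fun x => _) = (fun=> 0)); [exact: Ck_cst|apply/funext => x; rewrite big_nil].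
have E : (fun x => \sum_(j <- i :: r | P j) F j x) =
  if P i then fun x => F i x + \sum_(j <- r | P j) F j x else
    fun x => \sum_(j <- r | P j) F j x.
  by apply/funext => x; rewrite big_cons; case: ifP.
by rewrite E; case: ifP => // Pi; apply: CkD => //; exact: cF.
Qed.

Lemma Ck_prod k U (I : Type) (r : seq I) (P : pred I) (F : I -> 'rV[R]_n -> R) :
  open U -> (forall i, P i -> Ck k U (F i)) ->
  Ck k U (fun x => \prod_(i <- r | P i) F i x).
Proof.
move=> oU cF; elim: r => [|i r IH].
  by rewrite (_ : (fun x => _) = (fun=> 1)); [exact: Ck_cst|apply/funext => x; rewrite big_nil].
have E : (fun x => \prod_(j <- i :: r | P j) F j x) =
  if P i then fun x => F i x * \prod_(j <- r | P j) F j x else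
    fun x => \prod_(j <- r | P j) F j x.
  by apply/funext => x; rewrite big_cons; case: ifP.
by rewrite E; case: ifP => // Pi; apply: CkM => //; exact: cF.
Qed.

Lemma CkV k U (f : 'rV[R]_n -> R) : open U -> (forall x, U x -> f x != 0) ->
  Ck k U f -> Ck k U (fun x => (f x)^-1).
Proof.
move=> oU f0; elim: k => [|k IH] cf.
  by split=> // x Ux; exact: (cvgV (f0 _ Ux) (Ck_cont cf Ux)).
have [_ df] := cf.
apply: (@Ck_is_derive _ _ _ _
    (fun i x => - 1 * ((f x)^-1 * (f x)^-1 * 'D_(delta_mx 0 i) f x))) => //.
- by move=> x Ux; exact: (cvgV (f0 _ Ux) (Ck_cont cf Ux)).
- move=> i x Ux; split; first by apply: derivableV; [exact: f0|exact: (df i).1].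
  rewrite (deriveV (f0 _ Ux) ((df i).1 _ Ux)) mulN1r /GRing.scale /=.
  by rewrite -exprVn expr2 mulNr.
- move=> i; have cV := IH (CkW cf).
  by apply: CkM => //; [exact: Ck_cst|apply: CkM; [|exact: CkM|exact: (df i).2]].
Qed.

Lemma Ck_rowP m k U (f : 'rV[R]_n -> 'rV[R]_m) : open U ->
  (forall j, Ck k U (fun x => f x 0 j)) <-> Ck k U f.
Proof.
move=> oU; elim: k f => [|k IH] f; split=> cf.
- by split=> // x Ux; apply/cont_coordP => j; have [+ _] := cf j; apply.
- by move=> j; split=> // x Ux; have [/(_ x Ux)/cont_coordP cfx _] := cf; exact: cfx.
- split=> [x Ux|i].
    by apply/cont_coordP => j; have [+ _] := cf j; apply.
  have df x : U x -> derivable f x (delta_mx 0 i).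
    move=> Ux; apply/derivable_mxP => l j; rewrite (ord1 l).
    by have [_ /(_ i)[+ _]] := cf j; apply.
  split=> //; apply/IH => j.
  have [_ /(_ i)[_ cj]] := cf j.
  by apply: Ck_eq cj => // x Ux; rewrite (derive_mx (df x Ux)) mxE.
- move=> j; have [cf0 df] := cf; split=> [x Ux|i].
    by have /cont_coordP := cf0 x Ux; apply.
  have [dfi cdf] := df i; split=> [x Ux|].
    by have /derivable_mxP := dfi x Ux; apply.
  move/IH : cdf => /(_ j); apply: Ck_eq => // x Ux.
  by rewrite (derive_mx (dfi x Ux)) mxE.
Qed.

Lemma Ck_coord m k U (f : 'rV[R]_n -> 'rV[R]_m) j : open U ->
  Ck k U f -> Ck k U (fun x => f x 0 j).
Proof. by move=> oU /Ck_rowP; exact. Qed.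

Lemma CkN W k U (f : 'rV[R]_n -> W) : open U ->
  Ck k U f -> Ck k U (fun x => - f x).
Proof.
move=> oU; elim: k f => [|k IH] f [cf df].
  by split=> // x Ux; exact: (cvgN (cf x Ux)).
apply: (@Ck_is_derive _ _ _ _ (fun i x => - 'D_(delta_mx 0 i) f x)) => //.
- by move=> x Ux; exact: (cvgN (cf x Ux)).
- by move=> i x Ux; apply: is_deriveN; apply: derivableP; apply: (df i).1.
- by move=> i; apply: IH; exact: (df i).2.
Qed.

Lemma Ck_diff_real U (f : 'rV[R]_n -> R) x : open U -> Ck 1 U f -> U x ->
  differentiable f x.
Proof.
move=> oU [cf df] Ux; apply: C1_differentiable_real => i; have [dfi [cdf _]] := df i.
  by apply: filterS dfi _; exact: open_nbhs_nbhs.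
exact: cdf.
Qed.

Lemma differentiable_rowP m (f : 'rV[R]_n -> 'rV[R]_m) x :
  (forall j, differentiable (fun x => f x 0 j) x) -> differentiable f x.
Proof.
move=> df.
have -> : f = \sum_j (fun x => f x 0 j *: (delta_mx 0 j : 'rV[R]_m)).
  by apply/funext => y; rewrite fct_sumE -row_sum_delta.
by apply: differentiable_sum => j; exact: differentiableZl.
Qed.

Lemma Ck_diff m k U (f : 'rV[R]_n -> 'rV[R]_m) x : open U -> Ck k.+1 U f -> U x ->
  differentiable f x.
Proof.
move=> oU cf Ux; apply: differentiable_rowP => j.
move/Ck_rowP : cf => /(_ oU j) cfj; apply: (Ck_diff_real oU _ Ux).
by elim: k cfj => // k IH /CkW.
Qed.

End CkTheory.

Lemma derive_sum_delta (R : realType) n (W : normedModType R)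
    (f : 'rV[R]_n -> W) x v : differentiable f x ->
  'D_v f x = \sum_i v 0 i *: 'D_(delta_mx 0 i) f x.
Proof.
move=> df; rewrite deriveE// {1}[v]row_sum_delta linear_sum.
by apply: eq_bigr => i _; rewrite linearZ deriveE.
Qed.

Lemma is_derive_comp (R : realType) (U V W : normedModType R)
    (g : V -> W) (f : U -> V) x v :
  differentiable f x -> differentiable g (f x) ->
  is_derive x v (g \o f) ('D_('D_v f x) g (f x)).
Proof.
move=> df dg; have dgf : differentiable (g \o f) x by exact: differentiable_comp.
split; first exact: diff_derivable.
by rewrite deriveE// diff_comp//= -!deriveE.
Qed.

Lemma Ck_comp_real (R : realType) n m k (U : set 'rV[R]_n)
    (V : set 'rV[R]_m) (g : 'rV[R]_m -> R)
    (f : 'rV[R]_n -> 'rV[R]_m) : open U -> open V ->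
  (forall x, U x -> V (f x)) -> Ck k V g -> Ck k U f -> Ck k U (g \o f).
Proof.
move=> oU oV UV; elim: k g => [|k IH] g cg cf.
  split=> // x Ux.
  exact: (continuous_comp (Ck_cont cf Ux) (Ck_cont cg (UV x Ux))).
have df x : U x -> differentiable f x by exact: (Ck_diff oU cf).
have dg x : V x -> differentiable g x.
  by apply: Ck_diff_real => //; elim: {IH cf} k cg => // k IH /CkW.
apply: (@Ck_is_derive _ _ _ _ _ _ (fun i x => \sum_j
   ('D_(delta_mx 0 i) f x) 0 j * ('D_(delta_mx 0 j) g \o f) x)) => //.
- by move=> x Ux; exact: (continuous_comp (Ck_cont cf Ux) (Ck_cont cg (UV x Ux))).
- move=> i x Ux; apply: is_derive_eq.
    by apply: is_derive_comp; [exact: df|exact: dg (UV x Ux)].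
  by rewrite derive_sum_delta//; exact: dg (UV x Ux).
- move=> i; apply: Ck_sum => // j _; apply: CkM => //.
    by have [_ /(_ i)[_ /Ck_rowP]] := cf; apply.
  apply: IH; last exact: CkW.
  by have [_ /(_ j)[]] := cg.
Qed.

Lemma Ck_comp (R : realType) n m p k (U : set 'rV[R]_n)
    (V : set 'rV[R]_m) (g : 'rV[R]_m -> 'rV[R]_p)
    (f : 'rV[R]_n -> 'rV[R]_m) : open U -> open V ->
  (forall x, U x -> V (f x)) -> Ck k V g -> Ck k U f -> Ck k U (g \o f).
Proof.
move=> oU oV UV /Ck_rowP cg cf; apply/Ck_rowP => // j.
exact: (@Ck_comp_real _ _ _ _ U V (fun y => g y 0 j) f oU oV UV (cg oV j) cf).
Qed.

Lemma Ck_det (R : realType) n N k U (A : 'rV[R]_n -> 'M[R]_N) : open U ->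
  (forall i j, Ck k U (fun x => A x i j)) -> Ck k U (fun x => \det (A x)).
Proof.
move=> oU cA; apply: Ck_sum => // s _; apply: CkM => //; first exact: Ck_cst.
by apply: Ck_prod => // i _.
Qed.

(** By Cramer's rule the entries of the inverse are cofactors divided by a nonvanishing
    determinant. *)
Lemma Ck_invmx (R : realType) n N k U (A : 'rV[R]_n -> 'M[R]_N) i j : open U ->
  (forall x, U x -> A x \in unitmx) ->
  (forall i j, Ck k U (fun x => A x i j)) -> Ck k U (fun x => invmx (A x) i j).
Proof.
move=> oU uA cA.
apply: (@Ck_eq _ _ _ _ _ (fun x => (\det (A x))^-1 * cofactor (A x) j i)) => //.
  by move=> x /uA Au; rewrite /invmx Au !mxE.
apply: CkM => //.
  apply: CkV => //; last exact: Ck_det.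
  by move=> x /uA; rewrite unitmxE unitfE.
apply: CkM => //; first exact: Ck_cst.
by apply: Ck_det => // a b; under [fun x => _]funext => x do rewrite !mxE; exact: cA.
Qed.

(** * The inverse function theorem *)

Section InverseFunction.
Variables (R : realType) (N : nat).

(** The transpose of the usual Jacobian: vectors are rows, and matrices act on the right. *)
Definition jac (f : 'rV[R]_N -> 'rV[R]_N) x : 'M[R]_N :=
  \matrix_(i, j) ('D_(delta_mx 0 i) f x) 0 j.

Lemma derive_jac (f : 'rV[R]_N -> 'rV[R]_N) x v :
  differentiable f x -> 'D_v f x = v *m jac f x.
Proof.
move=> df; rewrite derive_sum_delta// mulmx_sum_row; apply: eq_bigr => i _.
by congr (_ *: _); apply/rowP => j; rewrite !mxE.
Qed.

Lemma Ck_jac k U (f : 'rV[R]_N -> 'rV[R]_N) i j : open U ->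
  Ck k.+1 U f -> Ck k U (fun x => jac f x i j).
Proof.
move=> oU [_ /(_ i)[_ /(Ck_coord j oU)]].
by apply: Ck_eq => // x _; rewrite mxE.
Qed.

(** Mean value inequality, one coordinate at a time; the factor N counts the partial derivatives.
    [MVT_line] locates its parameter only in [-1, 1], so the intermediate point may leave the
    segment from y to x: hence the control on a ball of radius 3 r. *)
Lemma lipschitz_of_derive (f : 'rV[R]_N -> 'rV[R]_N) (U : set 'rV[R]_N) x0 r c :
  open U -> Ck 1 U f -> 0 <= c ->
  (forall x, `|x - x0| <= 3 * r -> U x) ->
  (forall x i j, `|x - x0| <= 3 * r -> `|('D_(delta_mx 0 i) f x) 0 j| <= c) ->
  forall x y, `|x - x0| <= r -> `|y - x0| <= r ->
    `|f x - f y| <= (N%:R * c) * `|x - y|.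
Proof.
move=> oU cf c0 BU Bc x y xr yr.
have NcD z : U z -> differentiable f z by exact: (Ck_diff oU cf).
apply: norm_row_le => [|j]; first by rewrite !mulr_ge0.
have ball3 (t : R) : `|t| <= `|1 : R| -> `|y + t *: (x - y) - x0| <= 3 * r.
  rewrite normr1 => t1.
  have -> : y + t *: (x - y) - x0 = (y - x0) + t *: ((x - x0) - (y - x0)).
    by rewrite opprB addrA subrK addrAC.
  apply: (le_trans (ler_normD _ _)); rewrite normrZ.
  apply: (@le_trans _ _ (r + 1 * (r + r))); last by lra.
  apply: lerD => //; apply: ler_pM => //.
  by apply: (le_trans (ler_normB _ _)); exact: lerD.
have dfj z : U z -> differentiable (fun w => f w 0 j) z.
  move=> Uz; move/Ck_rowP : cf => /(_ oU j) cfj.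
  exact: (Ck_diff_real oU cfj).
have [t tt|t /ball3 tB] := @MVT_line R _ (fun w => f w 0 j) y (x - y) 1.
  by apply: diff_derivable; apply: dfj; apply: BU; exact: ball3.
rewrite scale1r [y + (x - y)]addrCA subrr addr0 mul1r !mxE => ->.
rewrite derive_sum_delta; last by apply: dfj; exact: BU.
apply: (le_trans (ler_norm_sum _ _ _)).
apply: (@le_trans _ _ (\sum_(i < N) c * `|x - y|)); last first.
  by rewrite sumr_const card_ord -[X in X <= _]mulr_natl mulrA lexx.
apply: ler_sum => i _; rewrite [_ *: _]/(_ * _) normrM mulrC ler_pM//; last exact: norm_coord.
have := Bc _ i j tB; rewrite derive_mx ?mxE//; apply: diff_derivable.
by apply: NcD; exact: BU.
Qed.

Lemma mulmx_bounded (B : 'M[R]_N) :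
  exists2 C, 0 < C & forall v : 'rV[R]_N, `|v *m B| <= C * `|v|.
Proof.
pose LB : {linear 'rV[R]_N -> 'rV[R]_N} := mulmxr B.
have /linear_boundedP H := continuous_linear_bounded 0 (@continuous_linear_row _ _ _ LB 0).
have [C [C0 HC]] : exists C, 0 < C /\ forall v, `|LB v| <= C * `|v|.
  near (+oo_R : set_system R) => C; exists C.
  by split; [near: C; exact: nbhs_pinfty_gt|near: C].
by exists C.
Unshelve. all: by end_near.
Qed.

(** With k the increment of g, the differential of f gives h = k J + o(|k|), so k = h J^-1 + o(|k|);
    the Lipschitz bound on g turns o(|k|) into o(|h|). *)
Lemma is_derive_inverse (f g : 'rV[R]_N -> 'rV[R]_N) y v :
  differentiable f (g y) -> jac f (g y) \in unitmx -> {for y, continuous g} ->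
  (\near y, f (g y) = y) ->
  (exists C, \forall y' \near y, `|g y' - g y| <= C * `|y' - y|) ->
  is_derive y v g (v *m invmx (jac f (g y))).
Proof.
move=> df Ju cg fg [C gC]; set J := jac f (g y) in Ju *.
have [CB CB0 HCB] := mulmx_bounded (invmx J).
pose C1 := Num.max C 1; have C10 : 0 < C1 by rewrite lt_max ltr01 orbT.
pose L : {linear 'rV[R]_N -> 'rV[R]_N} := mulmxr (invmx J).
suff [dg gL] : differentiable g y /\ 'd g y = L :> (_ -> _).
  by split; [exact: diff_derivable|rewrite deriveE// gL].
apply: differentiable_eps; first exact: continuous_linear_row.
move=> e e0; pose e1 := e / (CB * C1).
have e10 : 0 < e1 by rewrite divr_gt0// mulr_gt0.
have /diff_locally/eqaddoP/(_ e1 e10)/nbhs_ballP[d /= d0 Hd] := df.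
have H1 : \forall h \near (0 : 'rV[R]_N), [/\ f (g (h + y)) = h + y,
    `|g (h + y) - g y| <= C * `|h| & `|g (h + y) - g y| < d].
  have : \forall y' \near y, [/\ f (g y') = y', `|g y' - g y| <= C * `|y' - y|
      & `|g y' - g y| < d].
    move: fg gC ((contP _ _).1 cg d d0); apply: filterS3 => y' ? ? ?.
    by split => //; rewrite distrC.
  move=> /nbhs_ballP[a /= a0 Ha]; apply/nbhs_ballP; exists a => //= h.
  rewrite -ball_normE /= sub0r normrN => ha; have /Ha : ball y a (h + y).
    by rewrite -ball_normE /= opprD addrCA subrr addr0 normrN.
  by rewrite addrK.
apply: filterS H1 => h [fgh gh gd].
set k := g (h + y) - g y in gh gd.
have /Hd : ball (0 : 'rV[R]_N) d k by rewrite -ball_normE /= sub0r normrN.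
have -> : (f \o shift (g y) - (cst (f (g y)) + 'd f (g y) : 'rV[R]_N -> 'rV[R]_N)) k =
    h - k *m J.
  rewrite !fctE /= /k subrK fgh (nbhs_singleton fg) -deriveE// derive_jac// -/J.
  by apply/rowP => i; rewrite !mxE; ring.
move=> kh; have -> : k - L h = - ((h - k *m J) *m invmx J).
  by rewrite mulmxBl mulmxK// opprB.
rewrite normrN (le_trans (HCB _))//.
apply: (@le_trans _ _ (CB * (e1 * `|k|))); first by rewrite ler_wpM2l// ltW.
apply: (@le_trans _ _ (CB * (e1 * (C1 * `|h|)))).
  rewrite !ler_wpM2l ?(ltW CB0) ?(ltW e10)// (le_trans gh)// ler_wpM2r//.
  by rewrite le_max lexx.
have -> : CB * (e1 * (C1 * `|h|)) = (e1 * (CB * C1)) * `|h| by ring.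
by rewrite divfK// gt_eqF// mulr_gt0.
Qed.

Lemma continuous_dist n (x0 : 'rV[R]_n) : continuous (fun x : 'rV[R]_n => `|x - x0|).
Proof. move=> x; have H : {for x, continuous (fun y : 'rV[R]_n => y - x0)}.
  by apply: contB; [exact: cvg_id|exact: contC].
exact: (cont_rnorm H). Qed.

Lemma compact_norm_ball n (x0 : 'rV[R]_n) r : compact [set x : 'rV[R]_n | `|x - x0| <= r].
Proof.
apply: bounded_closed_compact.
  exists (r + `|x0|); split; first exact: num_real.
  move=> M rM x /= xr; apply: le_trans (ltW rM).
  by rewrite -[x in leLHS](subrK x0) (le_trans (ler_normD _ _))// lerD2r.
exact: (closed_le_cont (@continuous_dist _ x0)).
Qed.

Theorem inverse_function (f : 'rV[R]_N -> 'rV[R]_N) (U : set 'rV[R]_N) x0 :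
  open U -> smooth U f -> U x0 -> (forall v, 'D_v f x0 = 0 -> v = 0) ->
  exists V W : set 'rV[R]_N, exists g : 'rV[R]_N -> 'rV[R]_N,
    [/\ open V, V x0 & V `<=` U] /\
    [/\ open W, forall x, V x -> W (f x) /\ g (f x) = x,
        forall y, W y -> V (g y) /\ f (g y) = y & smooth W g].
Proof.
move=> oU sf Ux0 injf.
have df x : U x -> differentiable f x by exact: (Ck_diff oU (sf 1%N)).
have J0u : jac f x0 \in unitmx.
  rewrite -row_free_unit; apply: inj_row_free => v.
  by rewrite -derive_jac//; [exact: injf|exact: df].
pose B := invmx (jac f x0).
pose LB : {linear 'rV[R]_N -> 'rV[R]_N} := mulmxr B.
(* The simplified Newton map: its derivative vanishes at x0, and f x = y exactly when x is fixed by
   [phi x + y *m B]. *)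
pose phi x := x - f x *m B.
have sphi : smooth U phi.
  move=> k; apply: CkD => //; first exact: (Ck_linear k U idfun).
  apply: CkN => //.
  exact: (Ck_comp oU (@openT _) (fun _ _ => I) (Ck_linear k setT LB) (sf k)).
have dphi x i : U x -> 'D_(delta_mx 0 i) phi x =
    delta_mx 0 i - (delta_mx 0 i *m jac f x) *m B.
  move=> Ux; have D1 := is_derive_id x (delta_mx 0 i : 'rV[R]_N).
  have D2 := is_derive_comp (delta_mx 0 i) (df _ Ux)
      (linear_differentiable (f x) (@continuous_linear_row _ _ _ LB)).
  have D3 := @is_deriveB _ _ _ _ _ _ _ _ _ D1 D2.
  have -> := @derive_val _ _ _ _ _ _ _ D3.
  rewrite (@derive_val _ _ _ _ _ _ _ (is_derive_linear LB _ _)) /LB /=.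
  by rewrite derive_jac//; exact: df.
(* After the factor N of [lipschitz_of_derive], this makes phi a contraction of ratio 1/2, also when
   N = 0. *)
pose c : R := (2 * N.+1%:R)^-1.
have c0 : 0 < c by rewrite invr_gt0 mulr_gt0.
have [r r0 Hr] : exists2 r, 0 < r & forall x, `|x - x0| <= 3 * r ->
   [/\ U x, jac f x \in unitmx &
       forall i j, `|('D_(delta_mx 0 i) phi x) 0 j| <= c].
  have : \forall x \near x0, [/\ U x, jac f x \in unitmx &
       forall i j, `|('D_(delta_mx 0 i) phi x) 0 j| <= c].
    have H1 : \forall x \near x0, U x by exact: open_nbhs_nbhs.
    have H2 : \forall x \near x0, jac f x \in unitmx.
      have cdet : Ck 0 U (fun x => \det (jac f x)).
        by apply: Ck_det => // i j; apply: Ck_jac.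
      have cd := Ck_cont cdet Ux0.
      have : \forall x \near x0, \det (jac f x) != 0.
        have d0 : \det (jac f x0) != 0 by move: J0u; rewrite unitmxE unitfE.
        apply: (cd [set y | y != 0]).
        by apply: open_nbhs_nbhs; split=> //; exact: open_neq.
      by apply: filterS => x; rewrite unitmxE unitfE.
    have H3 : \forall x \near x0, forall i : 'I_N, forall j : 'I_N,
        `|('D_(delta_mx 0 i) phi x) 0 j| <= c.
      apply: (@filter_forall _ _ (fun i x => forall j : 'I_N,
        `|('D_(delta_mx 0 i) phi x) 0 j| <= c) _ (nbhs_filter x0)) => i.
      apply: (@filter_forall _ _ (fun j x =>
        `|('D_(delta_mx 0 i) phi x) 0 j| <= c) _ (nbhs_filter x0)) => j.
      have cDi : Ck 0 U (fun x => 'D_(delta_mx 0 i) phi x) := ((sphi 1%N).2 i).2.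
      have [cD _] := Ck_coord j oU cDi.
      have /(_ (nbhs_filter x0)) := (cvgrPdist_le _ _).1 (cD x0 Ux0) c c0.
      apply: filterS => x.
      by rewrite dphi// -mulmxA mulmxV// mulmx1 subrr mxE sub0r normrN.
    by move: H1 H2 H3; apply: filterS3 => x.
  move=> /nbhs_ballP[e /= e0 He]; exists (e / 4); first by rewrite divr_gt0.
  move=> x xe; apply: He; rewrite -ball_normE /= distrC.
  by apply: (le_lt_trans xe); lra.
have HU x : `|x - x0| <= 3 * r -> U x by case/Hr.
have rr3 : r <= 3 * r by lra.
have Hu x : `|x - x0| <= r -> U x /\ jac f x \in unitmx.
  by move=> /le_trans/(_ rr3)/Hr[].
have lip x y : `|x - x0| <= r -> `|y - x0| <= r ->
    `|phi x - phi y| <= 2^-1 * `|x - y|.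
  move=> xr yr.
  have := @lipschitz_of_derive phi U x0 r c oU (sphi 1%N) (ltW c0) HU.
  have Hc x' i j : `|x' - x0| <= 3 * r -> `|('D_(delta_mx 0 i) phi x') 0 j| <= c.
    by move=> /Hr[].
  move=> /(_ Hc x y xr yr) /le_trans; apply; rewrite ler_wpM2r//.
  rewrite /c invfM mulrCA mulrC ler_piMl// ?invr_ge0//.
  by rewrite ler_pdivrMr// mul1r ler_nat.
have bilip x y : `|x - x0| <= r -> `|y - x0| <= r ->
    `|x - y| <= 2 * `|(f x - f y) *m B|.
  move=> xr yr; have := lip _ _ xr yr.
  have -> : phi x - phi y = (x - y) - (f x - f y) *m B.
    rewrite /phi mulmxBl; move: (f x *m B) (f y *m B) => a b.
    by apply/rowP => i; rewrite !mxE; ring.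
  have := lerB_dist (x - y) ((f x - f y) *m B); lra.
have phi0 : phi x0 = x0 - f x0 *m B by [].
have BKu (u w : 'rV[R]_N) : u *m B = w *m B -> u = w.
  by move=> /(congr1 (mulmx^~ (jac f x0))); rewrite !mulmxKV.
(* For y in W the map T below sends the closed ball of radius r into the open one: r / 2 from the
   contraction and r / 2 from this condition. *)
pose W := [set y : 'rV[R]_N | `|(y - f x0) *m B| < r / 2].
have surj y : W y -> exists2 x, `|x - x0| < r & f x = y.
  rewrite /W /= => Wy.
  pose K := [set x : 'rV[R]_N | `|x - x0| <= r].
  pose T x := phi x + y *m B.
  have Tx0 x : T x - x0 = (phi x - phi x0) + (y - f x0) *m B.
    rewrite /T phi0 mulmxBl; move: (phi x) (y *m B) (f x0 *m B) => a b d.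
    by apply/rowP => i; rewrite !mxE; ring.
  have TK x : K x -> `|T x - x0| < r.
    rewrite /K /= => xr; rewrite Tx0.
    apply: (le_lt_trans (ler_normD _ _)).
    have := lip x x0 xr; rewrite subrr normr0 => /(_ (ltW r0)); lra.
  have TKK : {homo T : x / K x >-> K x} by move=> x /TK/ltW.
  have K0 : K !=set0 by exists x0; rewrite /K /= subrr normr0 ltW.
  have cphi x : K x -> {for x, continuous phi}.
    by move=> /Hu[Ux _]; exact: Ck_cont (sphi 0%N) Ux.
  have cT : {within K, continuous (fun x => `|x - T x|)}.
    apply: continuous_in_subspaceT => x /[!inE] Kx.
    have H : {for x, continuous (fun x : 'rV[R]_N => x - T x)}.
      apply: contB; first exact: cvg_id.
      by apply: contD; [exact: cphi|exact: contC].
    exact: (cont_rnorm H).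
  have [p /[!inE] Kp pmin] := EVT_min_rV K0 (@compact_norm_ball _ x0 r) cT.
  (* The fixed point is found by minimizing the displacement |x - T x| on the compact ball. T halves
     the displacement, so its minimum is 0. *)
  have pT : p = T p.
    apply/eqP; rewrite -subr_eq0 -normr_le0.
    have := pmin (T p); rewrite inE => /(_ (TKK _ Kp)).
    have -> : T p - T (T p) = phi p - phi (T p) by rewrite /T opprD addrACA subrr addr0.
    by have := lip _ _ Kp (TKK _ Kp); lra.
  exists p; first by rewrite [p]pT; exact: TK.
  apply: BKu; move: pT; rewrite /T /phi => /eqP.
  by rewrite -addrA -subr_eq0 opprD addrA subrr sub0r oppr_eq0 addrC subr_eq0 => /eqP.
pose V := [set x : 'rV[R]_N | `|x - x0| < r] `&` f @^-1` W.
have VW x : V x -> W (f x) by case.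
have oW : open W.
  have cW : continuous (fun y : 'rV[R]_N => `|(y - f x0) *m B|).
    move=> y; have H : {for y, continuous (fun z : 'rV[R]_N => LB (z - f x0))}.
      apply: (@cont_comp _ _ _ (fun z : 'rV[R]_N => z - f x0) LB).
        by apply: contB; [exact: cvg_id|exact: contC].
      exact: continuous_linear_row.
    exact: (cont_rnorm H).
  exact (@open_lt_cont R 'rV[R]_N _ (r / 2) cW).
have oV : open V.
  rewrite openE => x [/= xr Wx]; rewrite /interior; apply: filterI.
    apply: (@open_nbhs_nbhs _ x [set x : 'rV[R]_N | `|x - x0| < r]); split=> //.
    exact (@open_lt_cont R 'rV[R]_N _ r (@continuous_dist _ x0)).
  have [Ux _] := Hu x (ltW xr).
  by apply: (Ck_cont (sf 0%N) Ux); exact: open_nbhs_nbhs.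
pose g y := xget x0 [set x | `|x - x0| < r /\ f x = y].
have gP y : W y -> `|g y - x0| < r /\ f (g y) = y.
  by move=> /surj[x xr fx]; apply: (@xgetPex _ x0 [set x | `|x - x0| < r /\ f x = y]); exists x.
have Vg y : W y -> V (g y).
  by move=> Wy; have [gr fg] := gP y Wy; split => //; rewrite /preimage /= fg.
have finj x x' : `|x - x0| <= r -> `|x' - x0| <= r -> f x = f x' -> x = x'.
  move=> xr xr' fE; apply/eqP; rewrite -subr_eq0 -normr_le0.
  by have := bilip _ _ xr xr'; rewrite fE subrr mul0mx normr0 mulr0.
have gK x : V x -> g (f x) = x.
  move=> [/= xr Wx]; have [gr fg] := gP _ Wx.
  by apply: finj => //; exact: ltW.
have [CB CB0 HCB] := mulmx_bounded B.
have glip y y' : W y -> W y' -> `|g y - g y'| <= 2 * CB * `|y - y'|.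
  move=> Wy Wy'; have [gr fg] := gP _ Wy; have [gr' fg'] := gP _ Wy'.
  apply: (le_trans (bilip _ _ (ltW gr) (ltW gr'))).
  by rewrite fg fg' -mulrA ler_wpM2l.
have cg y : W y -> {for y, continuous g}.
  move=> Wy; apply/contP => e e0.
  have e1 : 0 < e / (2 * CB) by rewrite divr_gt0// mulr_gt0.
  have : \forall y' \near y, `|y - y'| < e / (2 * CB).
    by apply: ((contP _ _).1 _ _ e1); exact: cvg_id.
  have : \forall y' \near y, W y' by exact: open_nbhs_nbhs.
  apply: filterS2 => y' Wy' ye; apply: (le_lt_trans (glip _ _ Wy Wy')).
  by rewrite -ltr_pdivlMl ?mulr_gt0// mulrC.
have dg y v : W y -> is_derive y v g (v *m invmx (jac f (g y))).
  move=> Wy; have [gr fg] := gP _ Wy; have [Ug Ju] := Hu _ (ltW gr).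
  apply: is_derive_inverse => //; [exact: df|exact: cg| |].
    by apply: filterS (fun y' Wy' => (gP y' Wy').2) _; exact: open_nbhs_nbhs.
  exists (2 * CB).
  by apply: filterS (fun y' Wy' => glip y' y Wy' Wy) _; exact: open_nbhs_nbhs.
(* Bootstrap: the derivative of g is the inverse of the Jacobian of f composed with g, hence as
   regular as g itself. *)
have Cg k : Ck k W g.
  elim: k => [|k IH]; first by split.
  have WU y : W y -> U (g y) by move=> /gP[gr _]; have [] := Hu (g y) (ltW gr).
  have Wu y : W y -> jac f (g y) \in unitmx.
    by move=> /gP[gr _]; have [] := Hu (g y) (ltW gr).
  have HJ a b : Ck k W (fun y => jac f (g y) a b).
    exact (Ck_comp_real oW oU WU (Ck_jac a b oU (sf k.+1)) IH).
  have HI i j := Ck_invmx i j oW Wu HJ.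
  have H i : Ck k W (fun y => (delta_mx 0 i : 'rV[R]_N) *m invmx (jac f (g y))).
    apply/(Ck_rowP _ _ oW) => j; apply: Ck_eq (HI i j); first exact oW.
    by move=> y _; rewrite -rowE mxE.
  exact (Ck_is_derive oW cg (fun i y Wy => dg y _ Wy) H).
exists V, W, g; split; split => //.
- by split; rewrite /preimage /W /= subrr ?mul0mx normr0 ?divr_gt0.
- by move=> x [/= /ltW/Hu[]].
- by move=> x Vx; split; [exact: VW|exact: gK].
- by move=> y Wy; split; [exact: Vg|have [] := gP y Wy].
Qed.

End InverseFunction.

(** * Immersions of constant norm *)

Section RowDerivative.
Variables (R : realType) (V : normedModType R).

Lemma is_derive_rowP m (f : V -> 'rV[R]_m) x v (df : 'rV[R]_m) :
  (forall j, is_derive x v (fun y => f y 0 j) (df 0 j)) <-> is_derive x v f df.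
Proof.
split=> [H|[H <-] j].
  have dfx : derivable f x v.
    by apply/derivable_mxP => i j; rewrite (ord1 i); have [] := H j.
  split=> //; rewrite derive_mx//; apply/rowP => j; rewrite mxE.
  by have [] := H j.
have /derivable_mxP/(_ 0 j) dj := H.
by split=> //; rewrite derive_mx// mxE.
Qed.

Lemma is_derive_near_eq (W : normedModType R) (f g : V -> W) x v df :
  (\near x, f x = g x) -> is_derive x v f df -> is_derive x v g df.
Proof. exact: near_eq_is_derive. Qed.

End RowDerivative.

(** * The Euclidean inner product *)

Section Dot.
Variables (R : realType) (n : nat).
Implicit Types u v w : 'rV[R]_n.

Lemma dotE u v : dot u v = \sum_i u 0 i * v 0 i.
Proof. by rewrite /dot mxE; apply: eq_bigr => i _; rewrite mxE. Qed.

Lemma dotC u v : dot u v = dot v u.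
Proof. by rewrite !dotE; apply: eq_bigr => i _; rewrite mulrC. Qed.

Lemma dotDl u v w : dot (u + v) w = dot u w + dot v w.
Proof. by rewrite /dot mulmxDl mxE. Qed.

Lemma dotDr u v w : dot w (u + v) = dot w u + dot w v.
Proof. by rewrite dotC dotDl !(dotC w). Qed.

Lemma dotZl a u v : dot (a *: u) v = a * dot u v.
Proof. by rewrite /dot -scalemxAl mxE. Qed.

Lemma dotZr a u v : dot u (a *: v) = a * dot u v.
Proof. by rewrite dotC dotZl dotC. Qed.

Lemma dotNl u v : dot (- u) v = - dot u v.
Proof. by rewrite -scaleN1r dotZl mulN1r. Qed.

Lemma dotNr u v : dot u (- v) = - dot u v.
Proof. by rewrite dotC dotNl dotC. Qed.

Lemma dotBl u v w : dot (u - v) w = dot u w - dot v w.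
Proof. by rewrite dotDl dotNl. Qed.

Lemma dotBr u v w : dot w (u - v) = dot w u - dot w v.
Proof. by rewrite dotDr dotNr. Qed.

Lemma dot0l u : dot 0 u = 0.
Proof. by rewrite /dot mul0mx mxE. Qed.

Lemma dot0r u : dot u 0 = 0.
Proof. by rewrite dotC dot0l. Qed.

Lemma dot_suml (I : Type) (r : seq I) (P : pred I) (F : I -> 'rV[R]_n) u :
  dot (\sum_(i <- r | P i) F i) u = \sum_(i <- r | P i) dot (F i) u.
Proof. by rewrite /dot mulmx_suml summxE. Qed.

Lemma dot_ge0 u : 0 <= dot u u.
Proof. by rewrite dotE; apply: sumr_ge0 => i _; rewrite -expr2 sqr_ge0. Qed.

Lemma dot_eq0 u : (dot u u == 0) = (u == 0).
Proof.
apply/eqP/eqP => [|->]; last by rewrite dot0l.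
rewrite dotE => /psumr_eq0P u0; apply/rowP => i; rewrite mxE.
by apply/eqP; rewrite -sqrf_eq0 expr2 u0// => j _; rewrite -expr2 sqr_ge0.
Qed.

Lemma dot_gt0 u : (0 < dot u u) = (u != 0).
Proof. by rewrite lt_def dot_eq0 dot_ge0 andbT. Qed.

Lemma cont_dot (T : topologicalType) (f g : T -> 'rV[R]_n) x :
  {for x, continuous f} -> {for x, continuous g} ->
  {for x, continuous (fun y => dot (f y) (g y))}.
Proof.
move=> /cont_coordP cf /cont_coordP cg.
have -> : (fun y => dot (f y) (g y)) = (fun y => \sum_i f y 0 i * g y 0 i).
  by apply/funext => y; rewrite dotE.
by apply: cont_sum => i _; apply: contM; [exact: cf|exact: cg].
Qed.

Lemma is_derive_dot (V : normedModType R) (f g : V -> 'rV[R]_n) (x e : V) df dg :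
  is_derive x e f df -> is_derive x e g dg ->
  is_derive x e (fun y => dot (f y) (g y)) (dot df (g x) + dot (f x) dg).
Proof.
move=> /is_derive_rowP Df /is_derive_rowP Dg.
have -> : (fun y => dot (f y) (g y)) = \sum_i (fun y => f y 0 i * g y 0 i).
  by apply/funext => y; rewrite dotE fct_sumE.
apply: is_derive_eq.
rewrite !dotE -big_split /=; apply: eq_bigr => i _.
by rewrite /GRing.scale /=; ring.
Qed.

End Dot.

(** * Cones over immersed pieces *)

Section RowCons.
Variables (R : realType) (n : nat).

Definition rtail (z : 'rV[R]_n.+1) : 'rV[R]_n := \row_i z 0 (lift ord0 i).

Definition rcons0 (s : R) (x : 'rV[R]_n) : 'rV[R]_n.+1 :=
  \row_i (if unlift ord0 i is Some j then x 0 j else s).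

Lemma rcons0K s x : rtail (rcons0 s x) = x.
Proof. by apply/rowP => i; rewrite !mxE liftK. Qed.

Lemma rcons0_0 s x : rcons0 s x 0 0 = s.
Proof. by rewrite mxE unlift_none. Qed.

Lemma rconsE (z : 'rV[R]_n.+1) : rcons0 (z 0 0) (rtail z) = z.
Proof. by apply/rowP => i; rewrite !mxE; case: unliftP => [j|] ->; rewrite ?mxE. Qed.

Lemma rcons0_dist s x s' x' : `|rcons0 s x - rcons0 s' x'| <= Num.max `|s - s'| `|x - x'|.
Proof.
apply: norm_row_le => [|i]; first by rewrite le_max normr_ge0.
rewrite !mxE; case: unliftP => [j|] _; rewrite le_max ?lexx// orbC.
by have := norm_coord (x - x') j; rewrite !mxE => ->.
Qed.

Lemma rtail_is_linear : linear rtail.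
Proof. by move=> a u v; apply/rowP => i; rewrite !mxE. Qed.

HB.instance Definition _ := GRing.isLinear.Build R 'rV[R]_n.+1 'rV[R]_n _ rtail rtail_is_linear.

Lemma is_derive_coord m (x v : 'rV[R]_m) i :
  is_derive x v (fun z : 'rV[R]_m => z 0 i) (v 0 i).
Proof. by have /is_derive_rowP := is_derive_id x v; exact. Qed.

End RowCons.

Section Cone.
Variables (R : realType) (n : nat).

(* The cone over an immersed piece f; near a point where f is orthogonal to its
   own tangent space this is a local diffeomorphism. *)
Definition cone (f : 'rV[R]_n -> 'rV[R]_n.+1) (z : 'rV[R]_n.+1) : 'rV[R]_n.+1 :=
  (1 + z 0 0) *: f (rtail z).

Lemma Ck_scale m p k (U : set 'rV[R]_m) (a : 'rV[R]_m -> R) (f : 'rV[R]_m -> 'rV[R]_p) :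
  open U -> Ck k U a -> Ck k U f -> Ck k U (fun x => a x *: f x).
Proof.
move=> oU ca cf; apply/(Ck_rowP _ _ oU) => j.
apply: Ck_eq (CkM oU ca (Ck_coord j oU cf)); first exact oU.
by move=> x _; rewrite mxE.
Qed.

Lemma open_rtail (U : set 'rV[R]_n) : open U -> open (@rtail R n @^-1` U).
Proof.
by move=> oU; apply: open_comp oU => x _; exact: continuous_linear_row.
Qed.

Lemma cone_smooth (U : set 'rV[R]_n) f : open U -> smooth U f ->
  smooth (@rtail R n @^-1` U) (cone f).
Proof.
move=> oU sf k; have oU' := open_rtail oU.
apply: (Ck_scale oU'); last first.
  exact (Ck_comp oU' oU (fun x Ux => Ux) (sf k) (Ck_linear k _ (@rtail R n))).
apply: CkD => //; first exact: Ck_cst.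
exact: (Ck_coord 0 oU' (Ck_linear k _ idfun)).
Qed.

Lemma cone_derive (f : 'rV[R]_n -> 'rV[R]_n.+1) x v : differentiable f x ->
  is_derive (rcons0 0 x) v (cone f) (v 0 0 *: f x + 'D_(rtail v) f x).
Proof.
move=> df; apply/is_derive_rowP => j.
have D1 := is_derive_comp v
  (linear_differentiable (rcons0 0 x) (@continuous_linear_row _ _ _ (@rtail R n)))
  (eq_ind_r (fun y => differentiable f y) df (rcons0K 0 x)).
have /is_derive_rowP/(_ j) D2 := D1.
have D3 := is_deriveD (is_derive_cst (1 : R) (rcons0 0 x) v)
   (is_derive_coord (rcons0 0 x) v 0).
have D4 := is_deriveM D3 D2.
have -> : (fun z : 'rV[R]_n.+1 => cone f z 0 j) =
   (cst 1 + (fun z : 'rV[R]_n.+1 => z 0 0)) *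
   (fun z : 'rV[R]_n.+1 => (f \o @rtail R n) z 0 j).
  by apply/funext => z; rewrite !mxE.
apply: (@is_derive_eq _ _ _ _ _ _ _ _ D4).
rewrite !fctE /= rcons0K rcons0_0 addr0 scale1r.
rewrite (@derive_val _ _ _ _ _ _ _ (is_derive_linear (@rtail R n) _ _)).
by rewrite !mxE add0r addrC [_ *: _]mulrC.
Qed.

(** At [rcons0 0 x0] the derivative sends (s, v) to s f(x0) + D_v f(x0). The two summands are
    orthogonal and f(x0) is nonzero, so the kernel is trivial. The bound on [z 0 0] keeps the radial
    factor 1 + s positive. *)
Lemma cone_inverse (U : set 'rV[R]_n) f x0 : open U -> smooth U f -> U x0 ->
  f x0 != 0 -> (forall v, dot (f x0) ('D_v f x0) = 0) ->
  (forall v, 'D_v f x0 = 0 -> v = 0) ->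
  exists V W : set 'rV[R]_n.+1, exists g : 'rV[R]_n.+1 -> 'rV[R]_n.+1,
    [/\ open V, V (rcons0 0 x0) & forall z, V z -> `|z 0 0| < 1 /\ U (rtail z)] /\
    [/\ open W, forall z, V z -> W (cone f z) /\ g (cone f z) = z,
        forall y, W y -> V (g y) /\ cone f (g y) = y & smooth W g].
Proof.
move=> oU sf Ux0 fx0 forth finj.
have oU' : open ((@rtail R n @^-1` U) `&` [set z : 'rV[R]_n.+1 | `|z 0 0| < 1]).
  apply: openI; first exact: open_rtail.
  have H : continuous (fun z : 'rV[R]_n.+1 => `|z 0 0|).
    move=> z; have cz : {for z, continuous (fun z : 'rV[R]_n.+1 => z 0 0)}.
      exact: coord_continuous.
    exact: (cont_norm cz).
  exact (@open_lt_cont R 'rV[R]_n.+1 _ 1 H).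
have sf' : smooth ((@rtail R n @^-1` U) `&` [set z : 'rV[R]_n.+1 | `|z 0 0| < 1]) (cone f).
  by move=> k; apply: Ck_sub (cone_smooth oU sf k) => z [].
have df := Ck_diff oU (sf 1%N) Ux0.
have [||V [W [g [[oV Vz VU] H]]]] := inverse_function oU' sf' (x0 := rcons0 0 x0).
- by split; rewrite /preimage /= ?rcons0K// rcons0_0 normr0.
- move=> v; rewrite (@derive_val _ _ _ _ _ _ _ (cone_derive v df)) => E.
  have v0 : v 0 0 = 0.
    have := congr1 (dot (f x0)) E; rewrite dotDr dotZr forth addr0 dot0r => /eqP.
    by rewrite mulf_eq0 dot_eq0 (negbTE fx0) orbF => /eqP.
  move: E; rewrite v0 scale0r add0r => /finj tv.
  by rewrite -[v]rconsE v0 tv; apply/rowP => i; rewrite !mxE; case: unlift => // j; rewrite mxE.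
by exists V, W, g; split=> //; split=> // z /VU[].
Qed.

End Cone.

(** * Local inverses of an immersion orthogonal to its position vector *)

Section Immersion.
Variables (R : realType) (n : nat) (M : manifold R n).
Implicit Types (c : chart R n M) (p : M).

Lemma open_cod c : open (chart_cod c).
Proof. exact: chart_cod_open. Qed.

Lemma chart_codP c p : chart_dom c p -> chart_cod c (chart_map c p).
Proof. by exists p. Qed.

Lemma chart_invP c x : chart_cod c x ->
  chart_dom c (chart_inv c x) /\ chart_map c (chart_inv c x) = x.
Proof. by move=> [p cp <-]; rewrite chart_mapK. Qed.

Lemma chart_map_cont_at c p : chart_dom c p -> {for p, continuous (chart_map c)}.
Proof.
move=> cp; have := chart_map_cont (c := c).
by rewrite continuous_open_subspace; [apply; rewrite inE|exact: chart_dom_open].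
Qed.

Lemma chart_inv_cont_at c x : chart_cod c x -> {for x, continuous (chart_inv c)}.
Proof.
move=> cx; have := chart_inv_cont (c := c).
by rewrite continuous_open_subspace; [apply; rewrite inE|exact: chart_cod_open].
Qed.

Lemma smooth_mapP m (f : M -> 'rV[R]_m) c :
  smooth_map f -> atlas c -> smooth (chart_cod c) (f \o chart_inv c).
Proof. by move=> sf /sf /smooth_onE. Qed.

Lemma smooth_map_continuous m (f : M -> 'rV[R]_m) : smooth_map f -> continuous f.
Proof.
move=> sf p; have [c ac cp] := atlas_cover p.
have : {for p, continuous (f \o chart_inv c \o chart_map c)}.
  apply: continuous_comp; first exact: chart_map_cont_at.
  exact: Ck_cont (smooth_mapP sf ac 0%N) (chart_codP cp).
apply: continuous_eq_near.
have : nbhs p (chart_dom c) by apply: open_nbhs_nbhs; split=> //; exact: chart_dom_open.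
by apply: filterS => q cq /=; rewrite chart_mapK.
Qed.

(** [X a] and [(1 + s) *: X b] are the values of the cone at (0, a) and (s, b), and the cone is
    injective near p. Case s = 0 is local injectivity of X; general s separates points of M lying
    over one ray. *)
Lemma radial_injective (X : M -> 'rV[R]_n.+1) c p : immersion X -> atlas c ->
  chart_dom c p -> X p != 0 -> (forall v, dot (X p) (diff_at c X p v) = 0) ->
  exists O : set M, exists2 d, 0 < d &
    [/\ open O, O p & forall a b s, O a -> O b -> `|s| < d ->
      X a = (1 + s) *: X b -> a = b].
Proof.
move=> [sX iX] ac cp Xp0 orth; have sXc := smooth_mapP sX ac.
have Ux := chart_codP cp.
have Xcp : (X \o chart_inv c) (chart_map c p) = X p by rewrite /= chart_mapK.
have [|v|v|V [W [g [[oV Vz VU] [oW VW _ _]]]]] := cone_inverse (open_cod (c := c)) sXc Ux.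
- by rewrite Xcp.
- by rewrite Xcp; exact: orth.
- exact: iX.
have /nbhs_ballP[e /= e0 He] : nbhs (rcons0 0 (chart_map c p)) V by exact: open_nbhs_nbhs.
have HV q s : chart_dom c q -> `|chart_map c p - chart_map c q| < e -> `|s| < e ->
    V (rcons0 s (chart_map c q)).
  move=> cq qe se; apply: He; rewrite -ball_normE /=.
  by apply: (le_lt_trans (rcons0_dist _ _ _ _)); rewrite gt_max sub0r normrN se.
exists (chart_dom c `&` [set q | `|chart_map c p - chart_map c q| < e]), e => //; split.
- rewrite openE => q [cq qe]; apply: filterI.
    by apply: open_nbhs_nbhs; split=> //; exact: chart_dom_open.
  have H : {for q, continuous (fun q => chart_map c p - chart_map c q)}.
    by apply: contB; [exact: contC|exact: chart_map_cont_at].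
  exact (near_lt (cont_rnorm H) qe).
- by split=> //=; rewrite subrr normr0.
move=> a b s [ca /= ae] [cb /= be] se Xab.
have E0 : `|0 : R| < e by rewrite normr0.
have [_ Ka] := VW _ (HV a 0 ca ae E0).
have [_ Kb] := VW _ (HV b s cb be se).
have E : cone (X \o chart_inv c) (rcons0 0 (chart_map c a)) =
         cone (X \o chart_inv c) (rcons0 s (chart_map c b)).
  by rewrite /cone !rcons0K !rcons0_0 /= !chart_mapK// addr0 scale1r.
move: Ka; rewrite E Kb => /(congr1 (@rtail R n)); rewrite !rcons0K => Eab.
by rewrite -[a](chart_mapK (c := c))// -Eab chart_mapK.
Qed.

Lemma const_norm_orth (X : M -> 'rV[R]_n.+1) r c p : smooth_map X ->
  (forall q, dot (X q) (X q) = r) -> atlas c -> chart_dom c p ->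
  forall v, dot (X p) (diff_at c X p v) = 0.
Proof.
move=> sX Xr ac cp v; have Ux := chart_codP cp.
have df := Ck_diff (open_cod (c := c)) (smooth_mapP sX ac 1%N) Ux.
have D : is_derive (chart_map c p) v _ _ := derivableP (@diff_derivable _ _ _ _ _ v df).
have D2 := is_derive_dot D D.
have E : (fun y => dot ((X \o chart_inv c) y) ((X \o chart_inv c) y)) = cst r.
  by apply/funext => y; rewrite /= Xr.
have := @derive_val _ _ _ _ _ _ _ D2; rewrite E derive_cst /= chart_mapK// => /esym/eqP.
by rewrite [dot _ (X p)]dotC -mulr2n mulrn_eq0 /= => /eqP.
Qed.

(** g is the local inverse of the cone with its radial coordinate s dropped. A value on the sphere
    forces (1 + s)^2 = 1, and |s| < 1 leaves s = 0, so over the sphere g inverts X itself. That g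
    lives on an open set of the ambient space is what [smooth_on_subset] asks for. *)
Lemma local_section (X : M -> 'rV[R]_n.+1) r c p : immersion X -> 0 < r ->
  (forall q, sphere r (X q)) -> atlas c -> chart_dom c p ->
  exists O : set M, exists B : set 'rV[R]_n.+1, exists g : 'rV[R]_n.+1 -> 'rV[R]_n,
   [/\ open O, O p & O `<=` chart_dom c] /\
   [/\ open B, smooth B g, forall m, O m -> B (X m) /\ g (X m) = chart_map c m &
       forall y, B y -> chart_cod c (g y) /\
         (sphere r y -> O (chart_inv c (g y)) /\ X (chart_inv c (g y)) = y)].
Proof.
move=> [sX iX] r0 Xr ac cp; have sXc := smooth_mapP sX ac.
have Ux := chart_codP cp.
have orth := const_norm_orth sX Xr ac cp.
have Xcp : (X \o chart_inv c) (chart_map c p) = X p by rewrite /= chart_mapK.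
have Xp0 : X p != 0 by rewrite -dot_gt0 (Xr p) exprn_gt0.
have [|v|v|V [W [g [[oV Vz VU] [oW VW Wg sg]]]]] := cone_inverse (open_cod (c := c)) sXc Ux.
- by rewrite Xcp.
- by rewrite Xcp; exact: orth.
- exact: iX.
pose O := chart_dom c `&` [set m | V (rcons0 0 (chart_map c m))].
exists O, W, (@rtail R n \o g); split; split=> //.
- rewrite openE => q [cq Vq]; apply: filterI.
    by apply: open_nbhs_nbhs; split=> //; exact: chart_dom_open.
  have H : {for q, continuous (fun q => rcons0 0 (chart_map c q))}.
    apply/cont_coordP => j; case: (unliftP ord0 j) => [i|] ->.
      have -> : (fun y => rcons0 0 (chart_map c y) 0 (lift ord0 i)) =
                (fun y => chart_map c y 0 i).
        by apply/funext => y; rewrite mxE liftK.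
      by have /cont_coordP := chart_map_cont_at cq; exact.
    have -> : (fun y => rcons0 0 (chart_map c y) 0 ord0) = (fun=> 0 : R).
      by apply/funext => y; rewrite rcons0_0.
    exact: contC.
  by apply: H; exact: open_nbhs_nbhs.
- by move=> q [].
- by move=> k; exact (Ck_comp oW openT (fun _ _ => I) (Ck_linear k _ (@rtail R n)) (sg k)).
- move=> m [cm Vm]; have := VW _ Vm.
  by rewrite /cone rcons0_0 rcons0K /= chart_mapK// addr0 scale1r => -[Wm ->]; rewrite rcons0K.
move=> y Wy; have [Vg fg] := Wg y Wy; have [g1 Ug] := VU _ Vg; split=> // Sy.
have [dg mg] := chart_invP Ug.
have g0 : g y 0 0 = 0.
  have E : dot (cone (X \o chart_inv c) (g y)) (cone (X \o chart_inv c) (g y)) = r ^+ 2.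
    by rewrite fg.
  rewrite /cone dotZl dotZr [dot _ _](Xr _) in E.
  have : (1 + g y 0 0) ^+ 2 = 1.
    apply: (mulIf (lt0r_neq0 (exprn_gt0 2 r0))); rewrite mul1r -[RHS]E; ring.
  move=> /eqP; rewrite sqrf_eq1 => /orP[/eqP|/eqP]; first by lra.
  by move: g1; rewrite ltr_norml => /andP[]; lra.
split; first by split=> //=; rewrite mg -g0 rconsE.
by rewrite -[RHS]fg /cone g0 addr0 scale1r.
Qed.

End Immersion.

(** * Second derivatives at a maximum *)

Section Orthonormal.
Variable R : realType.

(** The E i and N are the rows of a square matrix A with A A^T = 1; then A^T A = 1 too, so
    multiplication by A^T preserves the inner product. *)
Lemma orthonormal_expand n (E : 'I_n -> 'rV[R]_n.+1) (N : 'rV[R]_n.+1) :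
  (forall i j, dot (E i) (E j) = (i == j)%:R) -> (forall i, dot N (E i) = 0) ->
  dot N N = 1 ->
  forall Z Y, dot Z Y = \sum_i dot Z (E i) * dot Y (E i) + dot Z N * dot Y N.
Proof.
move=> EE NE NN Z Y.
pose r (i : 'I_n.+1) := if unlift ord0 i is Some j then E j else N.
pose A := \matrix_(i, j) r i 0 j : 'M[R]_n.+1.
have AA : A *m A^T = 1%:M.
  apply/matrixP => i j; rewrite !mxE.
  have -> : \sum_k A i k * A^T k j = dot (r i) (r j).
    by rewrite dotE; apply: eq_bigr => k _; rewrite !mxE.
  rewrite /r; case: unliftP => [i'|] ->; case: unliftP => [j'|] ->.
  - by rewrite EE (inj_eq lift_inj).
  - by rewrite dotC NE eq_sym (negbTE (neq_lift _ _)).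
  - by rewrite NE (negbTE (neq_lift _ _)).
  - by rewrite NN eqxx.
have ZA W i : (W *m A^T) 0 i = dot W (r i).
  by rewrite dotE mxE; apply: eq_bigr => k _; rewrite !mxE.
have -> : dot Z Y = dot (Z *m A^T) (Y *m A^T).
  by rewrite /dot trmx_mul trmxK mulmxA -(mulmxA Z) (mulmx1C AA) mulmx1.
rewrite dotE big_ord_recl addrC; congr (_ + _); last first.
  by rewrite !ZA /r unlift_none.
by apply: eq_bigr => i _; rewrite !ZA /r liftK.
Qed.

(** Gram-Schmidt without projections: since k < n, some nonzero v has an image under J orthogonal to
    the k images already found; it only has to be normalized. *)
Lemma orthonormal_ex n m (J : 'M[R]_(n, m)) k : (forall v : 'rV_n, v *m J = 0 -> v = 0) ->
  (k <= n)%N -> exists e : 'I_k -> 'rV[R]_n,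
    forall i j, dot (e i *m J) (e j *m J) = (i == j)%:R.
Proof.
move=> Jinj; elim: k => [|k IH] kn; first by exists (fun=> 0); case.
have [e He] := IH (ltnW kn).
pose A := \matrix_(j, i) (e i *m J) 0 j : 'M[R]_(m, k).
have [v v0 vA] : exists2 v : 'rV[R]_n, v != 0 & v *m (J *m A) = 0.
  have : kermx (J *m A) != 0.
    rewrite -mxrank_eq0 mxrank_ker -lt0n subn_gt0.
    by apply: leq_ltn_trans kn; exact: rank_leq_col.
  by move=> /rowV0Pn[v /sub_kermxP vA v0]; exists v.
have vJ0 : v *m J != 0 by apply: contra v0 => /eqP/Jinj ->.
pose l := (Num.sqrt (dot (v *m J) (v *m J)))^-1.
have ve i : dot (v *m J) (e i *m J) = 0.
  have := congr1 (fun B : 'rV[R]_k => B 0 i) vA; rewrite mulmxA !mxE => <-.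
  by rewrite dotE; apply: eq_bigr => j _; rewrite !mxE.
have ll : l * (l * dot (v *m J) (v *m J)) = 1.
  have d0 : 0 < dot (v *m J) (v *m J) by rewrite dot_gt0.
  rewrite /l mulrA -invfM -expr2 sqr_sqrtr ?(ltW d0)// mulVf//.
  exact: lt0r_neq0.
exists (fun i => if unlift ord_max i is Some j then e j else l *: v) => i j.
case: unliftP => [i'|] ->; case: unliftP => [j'|] ->.
- by rewrite He (inj_eq lift_inj).
- by rewrite -scalemxAl dotZr dotC ve mulr0 eq_sym (negbTE (neq_lift _ _)).
- by rewrite -scalemxAl dotZl ve mulr0 (negbTE (neq_lift _ _)).
- by rewrite -!scalemxAl dotZl dotZr ll eqxx.
Qed.

End Orthonormal.

(** If w2 were positive, w1 would be positive just after x in the direction e, and by the mean value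
    theorem w would exceed w x there. Differentiability of w1 at the single point x suffices. *)
Lemma second_derivative_test (R : realType) n (w w1 : 'rV[R]_n -> R) x e w2 :
  (\forall y \near x, is_derive y e w (w1 y)) -> is_derive x e w1 w2 ->
  (\forall y \near x, w y <= w x) -> w1 x = 0 /\ w2 <= 0.
Proof.
move=> dw dw1 wmax.
pose l (t : R) := x + t *: e.
have cl t : {for t, continuous l}.
  by apply: contD; [exact: contC|apply: contZ; [exact: cvg_id|exact: contC]].
have l0 : l 0 = x by rewrite /l scale0r addr0.
have [d d0 Hd] : exists2 d, 0 < d & forall t, `|t| < d ->
    is_derive (l t) e w (w1 (l t)) /\ w (l t) <= w x.
  have : \forall t \near (0 : R), is_derive (l t) e w (w1 (l t)) /\ w (l t) <= w x.
    apply: (cl 0 [set y | is_derive y e w (w1 y) /\ w y <= w x]).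
    by rewrite l0; exact: filterI.
  move=> /nbhs_ballP[d /= d0 Hd]; exists d => // t td; apply: Hd.
  by rewrite -ball_normE /= sub0r normrN.
have Dl (f : 'rV[R]_n -> R) t df : is_derive (l t) e f df ->
    is_derive t (1 : R) (f \o l) df.
  by move=> [H <-]; exact: derive_line.
have dpsi t : `|t| < d -> is_derive t (1 : R) (w \o l) (w1 (l t)).
  by move=> /Hd[? _]; exact: Dl.
have w10 : w1 x = 0.
  have [||||_] := @derive1_at_max R (w \o l) (- d) d 0.
  - by lra.
  - move=> t /itvP td; apply: ex_derive; apply: dpsi.
    by rewrite ltr_norml !td.
  - by rewrite in_itv /= oppr_lt0 d0.
  - move=> t /itvP td; rewrite /= l0; apply: (Hd t _).2.
    by rewrite ltr_norml !td.
  by have := dpsi 0; rewrite normr0 l0 => /(_ d0)[_ ->].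
split=> //; rewrite leNgt; apply/negP => w2p.
have [H1 H2] : is_derive (0 : R) (1 : R) (w1 \o l) w2 by apply: Dl; rewrite l0.
have : \forall h \near (0 : R), h != 0 -> 0 < h^-1 * (w1 (l h)).
  have /cvgrPdist_lt/(_ w2 w2p) : h^-1 *: ((w1 \o l) (h *: 1 + 0) - (w1 \o l) 0) @[h --> 0^'] --> w2.
    by rewrite -H2.
  rewrite near_withinE; apply: filterS => h Hh /Hh.
  rewrite [(_ \o _) 0]/= l0 w10 subr0 addr0 [h *: _]mulr1 /GRing.scale /=.
  by rewrite ltr_norml => /andP[_]; lra.
move=> /nbhs_ballP[d' /= d'0 Hd'].
pose t := Num.min d d' / 2.
have md0 : 0 < Num.min d d' by rewrite lt_min d0.
have t0 : 0 < t by rewrite divr_gt0.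
have tm : t < Num.min d d' by rewrite /t; lra.
have [td td'] : t < d /\ t < d' by move: tm; rewrite lt_min => /andP.
have small s : 0 <= s <= t -> `|s| < d.
  by move=> /andP[s0 st]; rewrite ger0_norm// (le_lt_trans st).
have [||s st E] := @MVT R (w \o l) (fun t => w1 (l t)) 0 t t0.
- by move=> s /itvP sI; apply: dpsi; apply: small; rewrite !sI.
- apply: derivable_within_continuous => s /itvP sI.
  by apply: ex_derive; apply: dpsi; apply: small; rewrite !sI.
have s0 : 0 < s by rewrite (itvP st).
have := Hd' s; rewrite -ball_normE /= sub0r normrN gtr0_norm// => /(_ _)H3.
have {H3} : 0 < s^-1 * w1 (l s).
  by apply: H3; [rewrite (lt_trans _ td')// (itvP st)|exact: lt0r_neq0].
rewrite pmulr_rgt0 ?invr_gt0// => w1s.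
have := (Hd t _).2; rewrite gtr0_norm// => /(_ td).
rewrite leNgt => /negP; apply.
by rewrite -subr_gt0; move: E; rewrite /= l0 subr0 => ->; exact: mulr_gt0.
Qed.

Lemma Ck_derive_dir (R : realType) n m k (U : set 'rV[R]_n) (f : 'rV[R]_n -> 'rV[R]_m) e :
  open U -> Ck k.+1 U f -> Ck k U (fun x => 'D_e f x).
Proof.
move=> oU cf.
have cs : Ck k U (fun x => \sum_i e 0 i *: 'D_(delta_mx 0 i) f x).
  apply: (Ck_sum _ oU) => i _; apply: (Ck_scale oU); first exact: Ck_cst.
  by case: cf => _ /(_ i)[].
apply: (Ck_eq oU _ cs) => x Ux.
by rewrite -derive_sum_delta//; exact: (Ck_diff oU cf Ux).
Qed.

(** * The differential inequality at a maximum of the barrier *)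

Section HopfInequality.
Variables (R : realType) (n : nat) (M : manifold R n) (X N : M -> 'rV[R]_n.+1).
Hypotheses (imX : immersion X) (unN : unit_normal X N).

Lemma diff_at_linear c p : atlas c -> chart_dom c p ->
  exists J : 'M[R]_(n, n.+1), forall v, diff_at c X p v = v *m J.
Proof.
move=> ac cp; have [sX _] := imX.
have df := Ck_diff (open_cod (c := c)) (smooth_mapP sX ac 1%N) (chart_codP cp).
exists (\matrix_(i, j) ('D_(delta_mx 0 i) (X \o chart_inv c) (chart_map c p)) 0 j) => v.
rewrite /diff_at derive_sum_delta// mulmx_sum_row; apply: eq_bigr => i _.
by congr (_ *: _); apply/rowP => j; rewrite !mxE.
Qed.

(** The set in [mean_curvature] is nonempty, so the chosen value is the trace in some frame; the
    later computations are done in that frame. *)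
Lemma frame_ex p : exists c (e : 'I_n -> 'rV[R]_n),
  [/\ atlas c, chart_dom c p, orthonormal_frame X c p e &
      mean_curvature X N p = \sum_i second_fundamental_form X N c p (e i) (e i)].
Proof.
have : [set H : R | exists c (e : 'I_n -> 'rV[R]_n),
    [/\ atlas c, chart_dom c p, orthonormal_frame X c p e &
        H = \sum_i second_fundamental_form X N c p (e i) (e i)]] (mean_curvature X N p).
  apply: xgetPex; have [c ac cp] := atlas_cover p.
  have [J HJ] := diff_at_linear ac cp.
  have [v|e He] := orthonormal_ex (J := J) _ (leqnn n).
    by rewrite -HJ; apply: imX.2.
  exists (\sum_i second_fundamental_form X N c p (e i) (e i)), c, e; split => //.
  by move=> i j; rewrite /induced_metric !HJ.
by move=> [c [e H]]; exists c, e.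
Qed.

Lemma near_chart (c : chart R n M) p (P : set M) : chart_dom c p -> (\forall m \near p, P m) ->
  \forall y \near chart_map c p, P (chart_inv c y).
Proof.
move=> cp nP; apply: (chart_inv_cont_at (chart_codP cp)).
by rewrite chart_mapK.
Qed.

Variables (Q : 'rV[R]_n.+1) (rho a b : R).

(* Hopf's barrier: a perturbation of |X|^2/2 by a function of the squared distance
   to Q. *)
Definition barrier_arg (m : M) := dot (X m - Q) (X m - Q) - rho.

Definition barrier (m : M) :=
  dot (X m) (X m) / 2 + a * (- barrier_arg m + b * barrier_arg m ^+ 2).

(** [beta] is the derivative of - q + b q^2 in q, so the derivative of the barrier along e is <Z,
    E>. The last term comes from the second derivative 2 b of that quadratic, times a and the square
    of the derivative 2 <X - Q, E> of q. *)
Lemma barrier_derive c p e : atlas c -> chart_dom c p ->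
  (\forall m \near p, barrier m <= barrier p) ->
  let beta := -1 + 2 * b * barrier_arg p in
  let Z := X p + (2 * a * beta) *: (X p - Q) in
  let E := diff_at c X p e in
  let X2 := 'D_e (fun y => 'D_e (X \o chart_inv c) y) (chart_map c p) in
  dot Z E = 0 /\
  dot E E + dot Z X2 + 2 * a * beta * dot E E + 8 * a * b * dot (X p - Q) E ^+ 2 <= 0.
Proof.
move=> ac cp bmax beta Z E X2; have [sX iX] := imX.
have oU := open_cod (c := c); have sXc := smooth_mapP sX ac.
pose f := X \o chart_inv c; pose x := chart_map c p.
have fx : f x = X p by rewrite /f /= chart_mapK.
have Ux := chart_codP cp : chart_cod c x.
have df y : chart_cod c y -> is_derive y e f ('D_e f y).
  move=> Uy; apply: derivableP; apply: diff_derivable.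
  exact: (Ck_diff oU (sXc 1%N) Uy).
have d2f : is_derive x e (fun y => 'D_e f y) X2.
  apply: derivableP; apply: diff_derivable.
  exact: (Ck_diff oU (Ck_derive_dir e oU (sXc 2%N)) Ux).
pose q y := dot (f y - Q) (f y - Q) - rho.
pose w y := dot (f y) (f y) / 2 + a * (- q y + b * q y ^+ 2).
pose q1 y := 2 * dot (f y - Q) ('D_e f y).
pose w1 y := dot (f y) ('D_e f y) + a * (- q1 y + 2 * b * (q y * q1 y)).
have dfQ y : chart_cod c y -> is_derive y e (fun y => f y - Q) ('D_e f y).
  move=> Uy; have D := @is_deriveB _ _ _ _ _ _ _ _ _ (df y Uy) (is_derive_cst Q y e).
  by apply: (@is_derive_eq _ _ _ _ _ _ _ _ D); rewrite subr0.
have dq y : chart_cod c y -> is_derive y e q (q1 y).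
  move=> Uy; have D := is_derive_dot (dfQ y Uy) (dfQ y Uy).
  have D2 := @is_deriveB _ _ _ _ _ _ _ _ _ D (is_derive_cst rho y e).
  apply: (@is_derive_eq _ _ _ _ _ _ _ _ D2).
  by rewrite /q1 subr0 [dot ('D_e f y) _]dotC; ring.
have dw y : chart_cod c y -> is_derive y e w (w1 y).
  move=> Uy; have D := is_derive_dot (df y Uy) (df y Uy).
  have Dq := dq y Uy.
  have D1 := is_deriveM D (is_derive_cst (2^-1 : R) y e).
  have D2 := is_deriveM (is_derive_cst b y e) (is_deriveM Dq Dq).
  have D3 := is_deriveM (is_derive_cst a y e) (is_deriveD (is_deriveN Dq) D2).
  have D4 := is_deriveD D1 D3.
  have -> : w = (fun y => dot (f y) (f y)) * cst 2^-1 + cst a * (- q + cst b * (q * q)).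
    by apply/funext => z; rewrite /w !fctE expr2.
  apply: (@is_derive_eq _ _ _ _ _ _ _ _ D4).
  by rewrite /w1 !fctE /GRing.scale /= [dot ('D_e f y) _]dotC; field.
have dw1 : is_derive x e w1
   (dot E E + dot (f x) X2 + a * (- (2 * (dot E E + dot (f x - Q) X2)) +
      2 * b * (q1 x * q1 x + q x * (2 * (dot E E + dot (f x - Q) X2))))).
  have D1 := is_derive_dot (df x Ux) d2f.
  have Dq := dq x Ux.
  have Dq1 : is_derive x e q1 (2 * (dot E E + dot (f x - Q) X2)).
    have D := is_deriveM (is_derive_cst (2 : R) x e) (is_derive_dot (dfQ x Ux) d2f).
    apply: (@is_derive_eq _ _ _ _ _ _ _ _ D).
    by rewrite !fctE /GRing.scale /= mulr0 addr0.
  have D2 := is_deriveM (is_derive_cst (2 * b) x e) (is_deriveM Dq Dq1).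
  have D3 := is_deriveM (is_derive_cst a x e) (is_deriveD (is_deriveN Dq1) D2).
  have D4 := is_deriveD D1 D3.
  apply: (@is_derive_eq _ _ _ _ _ _ _ _ D4).
  rewrite !fctE /GRing.scale /=; change ('D_e f x) with E.
  move: (dot E E) (dot (f x) X2) (q x) (q1 x) (dot (f x - Q) X2) => A B C q' F.
  by ring.
have dwn : \forall y \near x, is_derive y e w (w1 y).
  by apply: filterS dw _; exact: open_nbhs_nbhs.
have wmax : \forall y \near x, w y <= w x.
  have := near_chart cp bmax; apply: filterS => y.
  by rewrite /barrier /barrier_arg /w /q fx.
have [w10 w2] := second_derivative_test dwn dw1 wmax.
have qx : q x = barrier_arg p by rewrite /q fx.
have q1x : q1 x = 2 * dot (X p - Q) E by rewrite /q1 fx.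
split.
  by rewrite -w10 /w1 qx q1x fx /Z dotDl dotZl -/E /beta; ring.
have EZ : dot Z X2 = dot (X p) X2 + 2 * a * beta * dot (X p - Q) X2.
  by rewrite /Z dotDl dotZl.
move: w2; rewrite qx q1x fx EZ /beta; apply: le_trans.
move: (dot E E) (dot (X p) X2) (barrier_arg p) (dot (X p - Q) E) (dot (X p - Q) X2).
by move=> A B C q' F; rewrite le_eqVlt; apply/orP; left; apply/eqP; ring.
Qed.

(** Differentiate <N, D_e X> = 0 along e. *)
Lemma normal_second_derivative c p e : atlas c -> chart_dom c p ->
  dot (N p) ('D_e (fun y => 'D_e (X \o chart_inv c) y) (chart_map c p)) =
  second_fundamental_form X N c p e e.
Proof.
move=> ac cp; have [sX _] := imX; have [sN _ NX] := unN.
have oU := open_cod (c := c).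
have Ux := chart_codP cp.
have dN : is_derive (chart_map c p) e (N \o chart_inv c) _ :=
  derivableP (@diff_derivable _ _ _ _ _ e (Ck_diff oU (smooth_mapP sN ac 1%N) Ux)).
have dX : is_derive (chart_map c p) e (fun y => 'D_e (X \o chart_inv c) y) _ :=
  derivableP (@diff_derivable _ _ _ _ _ e
    (Ck_diff oU (Ck_derive_dir e oU (smooth_mapP sX ac 2%N)) Ux)).
have D := is_derive_dot dN dX.
have D0 : is_derive (chart_map c p) e (fun y => dot ((N \o chart_inv c) y)
    ('D_e (X \o chart_inv c) y)) 0.
  apply: (is_derive_near_eq _ (is_derive_cst (0 : R) (chart_map c p) e)).
  have : \forall y \near chart_map c p, chart_cod c y by exact: open_nbhs_nbhs.
  apply: filterS => y Uy; have [dy my] := chart_invP Uy.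
  by have := NX c (chart_inv c y) ac dy e; rewrite /diff_at my => ->.
have := @derive_val _ _ _ _ _ _ _ D; rewrite (@derive_val _ _ _ _ _ _ _ D0).
rewrite /= chart_mapK// => /esym/eqP; rewrite addr_eq0 => /eqP E.
by rewrite /second_fundamental_form /diff_at E opprK.
Qed.

(** By the first-order condition Z is orthogonal to every E i, so <Z, X2 i> = <Z, N> h(e i, e i).
    Summing the second-order conditions over the frame produces H, and the squares <X - Q, E i>^2
    add up to the squared length of the tangential part of X - Q. *)
Lemma hopf_inequality p (beta := -1 + 2 * b * barrier_arg p)
    (H := mean_curvature X N p) :
  (\forall m \near p, barrier m <= barrier p) ->
  n%:R + H * dot (X p) (N p) + a * (2 * n%:R * beta + 2 * beta * H * dot (X p - Q) (N p)
   + 8 * b * (dot (X p - Q) (X p - Q) - dot (X p - Q) (N p) ^+ 2)) <= 0.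
Proof.
move=> bmax; have [c [e [ac cp oe HE]]] := frame_ex p.
have [_ NN NX] := unN.
pose E i := diff_at c X p (e i).
pose X2 i := 'D_(e i) (fun y => 'D_(e i) (X \o chart_inv c) y) (chart_map c p).
pose Z := X p + (2 * a * beta) *: (X p - Q).
have EE i j : dot (E i) (E j) = (i == j)%:R by exact: oe.
have NE i : dot (N p) (E i) = 0 by exact: NX.
have expand := orthonormal_expand EE NE (NN p).
have first i : dot Z (E i) = 0 by have [] := barrier_derive (e i) ac cp bmax.
have second i : dot (E i) (E i) + dot Z (X2 i) + 2 * a * beta * dot (E i) (E i) +
    8 * a * b * dot (X p - Q) (E i) ^+ 2 <= 0.
  by have [] := barrier_derive (e i) ac cp bmax.
have ZX i : dot Z (X2 i) = dot Z (N p) * second_fundamental_form X N c p (e i) (e i).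
  rewrite expand big1 ?add0r; last by move=> j _; rewrite first mul0r.
  by rewrite -(normal_second_derivative (e i) ac cp) (dotC (N p)).
have sumQ : \sum_i dot (X p - Q) (E i) ^+ 2 =
    dot (X p - Q) (X p - Q) - dot (X p - Q) (N p) ^+ 2.
  by rewrite [X in _ = X - _]expand -expr2 addrK.
have : \sum_i (1 + dot Z (N p) * second_fundamental_form X N c p (e i) (e i)
    + 2 * a * beta + 8 * a * b * dot (X p - Q) (E i) ^+ 2) <= 0.
  apply: sumr_le0 => i _; have := second i.
  by rewrite EE eqxx mulr1 ZX.
rewrite !big_split /= -!mulr_sumr -HE -/H sumQ !sumr_const card_ord.
apply: le_trans; rewrite le_eqVlt; apply/orP; left; apply/eqP.
have -> : dot Z (N p) = dot (X p) (N p) + 2 * a * beta * dot (X p - Q) (N p).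
  by rewrite /Z dotDl dotZl.
rewrite -[_ *+ n]mulr_natr; move: {+}beta {+}H => B' H'.
move: (dot (X p) (N p)) (dot (X p - Q) (N p)) (dot (X p - Q) (X p - Q)) => A B C.
by ring.
Qed.

End HopfInequality.

(** * The strong maximum principle *)

Lemma regular_nbhd (T : topologicalType) (x : T) (V : set T) :
  hausdorff_space T -> compact [set: T] -> nbhs x V ->
  exists K, [/\ closed K, nbhs x K & K `<=` V].
Proof.
move=> hT cT xV.
have [A xA AV] := compact_regular hT cT (@filterT _ (nbhs x) (nbhs_filter x)) xV.
exists (closure A); split=> //; first exact: closed_closure.
by apply: filterS xA; exact: subset_closure.
Qed.

Lemma closed_compactT (T : topologicalType) (K : set T) :
  compact [set: T] -> closed K -> compact K.
Proof. by move=> cT cK; apply: subclosed_compact cK cT _. Qed.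

Lemma compact_lt_gap (T : topologicalType) (R : realType) (K : set T) (u : T -> R) c :
  compact K -> continuous u -> (forall m, K m -> u m < c) ->
  exists2 d, 0 < d & forall m, K m -> u m <= c - d.
Proof.
move=> cK cu uc; have [->|/set0P K0] := eqVneq K set0; first by exists 1.
have [m /[!inE] Km mmax] := compact_EVT_max K0 cK (continuous_subspaceT cu).
exists (c - u m) => [|m' Km']; first by rewrite subr_gt0; exact: uc.
by have := mmax m'; rewrite inE subKr; exact.
Qed.

Lemma dot_subsq (R : realType) n (x y : 'rV[R]_n) :
  dot (x - y) (x - y) = dot x x - 2 * dot x y + dot y y.
Proof. by rewrite !dotBl !dotBr (dotC y x); ring. Qed.

(** Parallelogram identity: the right side minus the left is the squared length of (x - q) + (p -
    q). *)
Lemma dot_sub_le (R : realType) n (x p q : 'rV[R]_n) :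
  dot (x - p) (x - p) <= 2 * dot (x - q) (x - q) + 2 * dot (p - q) (p - q).
Proof.
have := dot_ge0 ((x - q) + (p - q)).
rewrite !dot_subsq !dotDl !dotDr !dotNl !dotNr.
rewrite (dotC q x) (dotC p x) (dotC q p); lra.
Qed.

Section StrongMaximum.
Variables (R : realType) (n : nat) (M : manifold R n) (X N : M -> 'rV[R]_n.+1).
Hypotheses (imX : immersion X) (unN : unit_normal X N).
Hypothesis (compactM : compact [set: M]).
Variables (H0 mx : R).
Hypothesis Hbound : forall m, `|mean_curvature X N m| <= H0.
Hypothesis subharmonic : forall m,
  0 <= n%:R + mean_curvature X N m * dot (X m) (N m).
Hypothesis maxX : forall m, dot (X m) (X m) <= mx.

Let cX : continuous X.
Proof. by apply: smooth_map_continuous; case: imX. Qed.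

Let cN : continuous N.
Proof. by apply: smooth_map_continuous; case: unN. Qed.

(* The tangential part of X p1 - Q is nonzero, so for b large the barrier is strictly
   subharmonic near p1; for a small it has an interior maximum there. *)
Lemma no_strict_touching p1 Q (O : set M) : dot (X p1) (X p1) = mx -> nbhs p1 O ->
  (forall m, O m -> dot (X m) (X m) = mx ->
     dot (X m - Q) (X m - Q) <= dot (X p1 - Q) (X p1 - Q) -> m = p1) ->
  0 < dot (X p1 - Q) (X p1 - Q) - dot (X p1 - Q) (N p1) ^+ 2 -> False.
Proof.
move=> Xp1 p1O touch T0.
pose rho := dot (X p1 - Q) (X p1 - Q).
pose T m := dot (X m - Q) (X m - Q) - dot (X m - Q) (N m) ^+ 2.
pose A m := dot (X m - Q) (N m).
pose q := barrier_arg X Q rho.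
have cXQ m : {for m, continuous (fun m => X m - Q)}.
  by apply: contB; [exact: cX|exact: contC].
have cq : continuous q.
  by move=> m; exact (contB (cont_dot (cXQ m) (cXQ m)) (@contC _ _ _ rho m)).
have cA : continuous A by move=> m; exact (cont_dot (cXQ m) (@cN m)).
have cT : continuous T.
  move=> m.
  exact (contB (cont_dot (cXQ m) (cXQ m)) (contM (cA m) (cA m))).
pose c := T p1 / 2; have c0 : 0 < c by rewrite divr_gt0.
pose B1 := `|A p1| + 1; have B10 : 0 <= B1 by rewrite addr_ge0.
have H00 : 0 <= H0 by exact: le_trans (Hbound p1).
(* On the neighbourhood V below, |beta| < 3/2, |A| < B1 and T > c. Hence 2 n beta + 2 beta H A >= -
   3 n - 3 H0 B1, which 8 b T > 8 b c outweighs. *)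
pose b := (2 * n%:R + 2 * (H0 * B1) + 1) / c.
have num0 : 0 < 2 * n%:R + 2 * (H0 * B1) + 1.
  by rewrite ltr_wpDl// addr_ge0// mulr_ge0// mulr_ge0.
have b0 : 0 < b by rewrite divr_gt0.
have bc : b * c = 2 * n%:R + 2 * (H0 * B1) + 1 by rewrite divfK// lt0r_neq0.
have qp1 : q p1 = 0 by rewrite /q /barrier_arg subrr.
(* The last condition confines beta to ]-3/2, -1/2[ and b q to ]-1/4, 1/4[. *)
pose V := O `&` [set m | c < T m] `&` [set m | `|A m| < B1] `&` [set m | `|2 * b * q m| < 2^-1].
have p1V : nbhs p1 V.
  apply: filterI; [apply: filterI; [apply: filterI => //|]|].
  - by apply: (near_gt (cT p1)); rewrite /c; move: T0; rewrite -/(T p1); lra.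
  - by apply: (near_lt (cont_norm (cA p1))); rewrite /B1 ltrDl.
  - apply: (near_lt (cont_norm _)).
      by apply: contM; [exact: contC|exact: cq].
    by rewrite qp1 mulr0 normr0 invr_gt0.
have [K [clK p1K KV]] := regular_nbhd (@manifold_hausdorff _ _ M) compactM p1V.
pose bd := K `\` K°.
have clbd : closed bd by apply: closedI => //; apply: open_closedC; exact: open_interior.
have clq : closed [set m | q m <= 0] by exact: closed_le_cont.
have cu : continuous (fun m => dot (X m) (X m)) by move=> m; apply: cont_dot; exact: cX.
(* Where q <= 0, that is in the closed ball about Q through X p1, the touching hypothesis leaves
   only p1, an interior point of K. So on this part of the boundary |X|^2 is below mx, by a uniform
   amount. *)
have [th th0 gap] : exists2 d, 0 < d & forall m, (bd `&` [set m | q m <= 0]) m ->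
    dot (X m) (X m) <= mx - d.
  apply: compact_lt_gap => //; first by apply: closed_compactT => //; exact: closedI.
  move=> m [[Km nKm] /= qm]; rewrite lt_neqAle maxX andbT; apply/eqP => um.
  have [[[Om _] _] _] := KV m Km.
  have mp1 : m = p1.
    by apply: touch => //; move: qm; rewrite /q /barrier_arg subr_le0.
  by apply: nKm; rewrite mp1.
(* With y = b q the perturbation is th / 2 times - y + y^2 < 1, so where q <= 0 on the boundary it
   is less than the gap th / 2 of |X|^2 / 2; where q > 0 it is negative. The maximum over K is
   therefore interior. *)
pose a := th * b / 2; have a0 : 0 < a by rewrite divr_gt0// mulr_gt0.
pose w := barrier X Q rho a b.
have wp1 : w p1 = mx / 2 by rewrite /w /barrier -/(q _) qp1 Xp1; ring.
have cw : continuous w.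
  move=> m; exact (contD (contM (cu m) (@contC _ _ _ (2^-1 : R) m))
    (contM (@contC _ _ _ a m) (contD (contN (cq m))
      (contM (@contC _ _ _ b m) (contM (cq m) (cq m)))))).
have wbd m : bd m -> w m < mx / 2.
  move=> bm; have [Km _] := bm; have [_ /= qs] := KV m Km.
  rewrite /w /barrier -/(q m).
  have [qm|qm] := leP (q m) 0.
    have := gap m (conj bm qm).
    have : b * (- q m + b * q m ^+ 2) < 1.
      have -> : b * (- q m + b * q m ^+ 2) = - (b * q m) + (b * q m) ^+ 2 by ring.
      move: qs; rewrite -mulrA ltr_norml => /andP[]; move: (b * q m) => y; nra.
    have -> : a * (- q m + b * q m ^+ 2) = th / 2 * (b * (- q m + b * q m ^+ 2)).
      by rewrite /a; ring.
    move: (b * _) => y; nra.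
  have := maxX m.
  have : a * (- q m + b * q m ^+ 2) < 0.
    rewrite pmulr_rlt0//.
    have -> : - q m + b * q m ^+ 2 = q m * (b * q m - 1) by ring.
    rewrite pmulr_rlt0//; move: qs; rewrite -mulrA ltr_norml => /andP[_]; lra.
  lra.
have [m1 /[!inE] Km1 m1max] : exists2 m, m \in K & forall t, t \in K -> w t <= w m.
  apply: compact_EVT_max; first by exists p1; exact: nbhs_singleton.
    exact: closed_compactT.
  exact: continuous_subspaceT.
have m1K : K° m1.
  apply: contrapT => nK; have := wbd m1 (conj Km1 nK).
  by rewrite -wp1 ltNge m1max// inE; exact: nbhs_singleton.
have wmax : \forall m \near m1, barrier X Q rho a b m <= barrier X Q rho a b m1.
  by apply: filterS m1K => m Km; apply: m1max; rewrite inE.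
have := hopf_inequality imX unN wmax.
have [[[_ Tm] Am] qs] := KV m1 Km1; rewrite /= in Tm Am qs.
set beta := -1 + 2 * b * barrier_arg X Q rho m1.
set H := mean_curvature X N m1 => ineq.
have [be1 be2] : - (3 / 2) < beta /\ beta < - (1 / 2).
  by move: qs; rewrite ltr_norml /beta -/(q m1) => /andP[]; split; lra.
have bHA : `|beta * (H * A m1)| <= 3 / 2 * (H0 * B1).
  have b1 : `|beta| <= 3 / 2 by rewrite ler_norml; apply/andP; split; lra.
  have b2 : `|H * A m1| <= H0 * B1 by rewrite normrM; exact: (ler_pM (normr_ge0 _) (normr_ge0 _) (Hbound m1) (ltW Am)).
  by rewrite normrM; exact: (ler_pM (normr_ge0 _) (normr_ge0 _) b1 b2).
have := subharmonic m1; rewrite -/H => sub.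
have : 0 < a * (2 * n%:R * beta + 2 * beta * H * dot (X m1 - Q) (N m1)
   + 8 * b * (dot (X m1 - Q) (X m1 - Q) - dot (X m1 - Q) (N m1) ^+ 2)).
  rewrite pmulr_rgt0// -/(T m1) -/(A m1).
  have bT : b * c < b * T m1 by rewrite ltr_pM2l.
  have n0 : 0 <= n%:R :> R by [].
  have n1 : - (3 / 2) * n%:R <= beta * n%:R by rewrite ler_wpM2r// ltW.
  have HB0 : 0 <= H0 * B1 by rewrite mulr_ge0.
  move: bHA; rewrite ler_norml => /andP[bHA _].
  have -> : 2 * n%:R * beta + 2 * beta * H * A m1 + 8 * b * T m1 =
     2 * (beta * n%:R) + 2 * (beta * (H * A m1)) + 8 * (b * T m1) by ring.
  rewrite bc in bT; lra.
lra.
Qed.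

(** For a = 0 the barrier is |X|^2 / 2, and the vector Z of [barrier_derive] is X p. *)
Lemma max_orth c p v : dot (X p) (X p) = mx -> atlas c -> chart_dom c p ->
  dot (X p) (diff_at c X p v) = 0.
Proof.
move=> up ac cp.
have [|+ _] := @barrier_derive _ _ _ X imX 0 0 0 0 c p v ac cp.
  apply: nearW => m; rewrite /barrier !mul0r !addr0 up.
  by rewrite ler_pM2r ?invr_gt0.
by rewrite mulr0 mul0r scale0r addr0.
Qed.

Lemma max_normal p Y : dot (X p) (X p) = mx ->
  dot (X p) Y = dot (X p) (N p) * dot Y (N p).
Proof.
move=> up; have [c [e [ac cp oe _]]] := frame_ex N imX p.
have [_ NN NX] := unN.
have ex := orthonormal_expand (E := fun i => diff_at c X p (e i)) oe
  (fun i => NX c p ac cp (e i)) (NN p).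
by rewrite ex big1 ?add0r// => i _; rewrite max_orth// mul0r.
Qed.

(* If |X q0|^2 < mx for some q0 near p, let p1 be a point of the maximum set closest
   to the radial projection of X q0; the ball with centre midway between the two
   points and through X p1 touches the maximum set only at p1. *)
Lemma max_set_open p : 0 < mx -> dot (X p) (X p) = mx ->
  \forall m \near p, dot (X m) (X m) = mx.
Proof.
move=> mx0 up; apply: contrapT => nnear.
have cu m : {for m, continuous (fun m => dot (X m) (X m))}.
  exact (cont_dot (@cX m) (@cX m)).
have [c ac cp] := atlas_cover p.
have Xp0 : X p != 0 by rewrite -dot_gt0 up.
have [V [d d0 [oO Op Oinj]]] := radial_injective imX ac cp Xp0 (fun v => max_orth v up ac cp).
have pO : nbhs p V by exact: open_nbhs_nbhs.
have [K [clK pK KO]] := regular_nbhd (@manifold_hausdorff _ _ M) compactM pO.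
have Kinj a b : K a -> K b -> X a = X b -> a = b.
  move=> Ka Kb E; apply: (Oinj a b 0); rewrite ?normr0 ?addr0 ?scale1r//; exact: KO.
have Kp : K p by exact: nbhs_singleton.
pose bd := K `\` K°.
have clbd : closed bd by apply: closedI => //; apply: open_closedC; exact: open_interior.
have cf : continuous (fun m => - dot (X m - X p) (X m - X p)).
  move=> m; have cXp := contB (@cX m) (@contC _ _ _ (X p) m).
  exact (contN (cont_dot cXp cXp)).
have [eta eta0 gap] : exists2 d, 0 < d & forall m, bd m ->
    - dot (X m - X p) (X m - X p) <= 0 - d.
  apply: compact_lt_gap => //; first exact: closed_compactT.
  move=> m [Km nKm]; rewrite oppr_lt0 dot_gt0 subr_eq0; apply/eqP => E.
  by apply: nKm; rewrite (Kinj m p Km Kp E).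
(* Both h p1 and |Q0 q0 - X p|^2 will be below et / 4. Then |X p1 - X p|^2 < et by [dot_sub_le], and
   et <= eta keeps p1 off the boundary of K; et <= mx makes the tangential part at p1 positive. *)
pose et := Num.min eta mx; have et0 : 0 < et by rewrite lt_min eta0.
have [ete etm] : et <= eta /\ et <= mx by rewrite /et !ge_min !lexx orbT.
pose g m := Num.sqrt (dot (X m) (X m)).
have cg m : {for m, continuous g}.
  exact (cont_comp (cu m) (@sqrt_continuous R _)).
have gp0 : 0 < g p by rewrite sqrtr_gt0 up.
have gp : g p = Num.sqrt mx by rewrite /g up.
(* Polar decomposition: when g m is nonzero, X m = (1 + s m) Q0 m, with Q0 m on the sphere of
   squared radius mx. *)
pose s m := g m / g p - 1.
pose Q0 m := (g p / g m) *: X m.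
have cs : {for p, continuous s}.
  exact (contB (contM (cg p) (@contC _ _ _ (g p)^-1 p)) (@contC _ _ _ (1 : R) p)).
have cQ0 : {for p, continuous (fun m => dot (Q0 m - X p) (Q0 m - X p))}.
  have cQ : {for p, continuous (fun m => Q0 m - X p)}.
    exact (contB (contZ (contM (@contC _ _ _ (g p) p) (contV (lt0r_neq0 gp0) (cg p))) (@cX p))
      (@contC _ _ _ (X p) p)).
  exact (cont_dot cQ cQ).
have sp : s p = 0 by rewrite /s divff ?subrr// lt0r_neq0.
have Q0p : Q0 p = X p by rewrite /Q0 divff ?scale1r// lt0r_neq0.
have [q0 [Kq0 sq0 Qq0 gq0 uq0]] : exists q0, [/\ K q0, `|s q0| < d,
    dot (Q0 q0 - X p) (Q0 q0 - X p) < et / 4, 0 < g q0 & dot (X q0) (X q0) < mx].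
  apply: contrapT => nex; apply: nnear.
  have N1 : \forall m \near p, `|s m| < d.
    by apply: (near_lt (cont_norm cs)); rewrite sp normr0.
  have N2 : \forall m \near p, dot (Q0 m - X p) (Q0 m - X p) < et / 4.
    by apply: (near_lt cQ0); rewrite Q0p subrr dot0l divr_gt0.
  have N3 : \forall m \near p, 0 < g m by exact: (near_gt (cg p)).
  have N4 : \forall m \near p, K m by [].
  have N12 : \forall m \near p, `|s m| < d /\ dot (Q0 m - X p) (Q0 m - X p) < et / 4.
    exact: filterI N1 N2.
  move: N12 N3 N4; apply: filterS3 => m [m1 m2] m3 m4; apply/eqP.
  rewrite eq_le maxX leNgt /=; apply/negP => m5; apply: nex; by exists m.
set Qq := Q0 q0 in Qq0.
have Xq0 : X q0 = (1 + s q0) *: Qq.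
  rewrite /Qq /Q0 /s scalerA addrC subrK.
  by rewrite [g q0 / g p * _]mulrA divfK ?mulfV ?scale1r// lt0r_neq0.
have QQ : dot Qq Qq = mx.
  have gg : g q0 * g q0 = dot (X q0) (X q0) by rewrite -expr2 sqr_sqrtr// dot_ge0.
  have gpp : g p * g p = mx by rewrite -expr2 sqr_sqrtr up// ltW.
  by rewrite /Qq /Q0 dotZl dotZr -gg -gpp; field; exact: lt0r_neq0.
clearbody Qq.
pose S := [set m | dot (X m) (X m) = mx] `&` K.
have clS : closed S.
  apply: closedI => //.
  have -> : [set m | dot (X m) (X m) = mx] = [set m | - dot (X m) (X m) <= - mx].
    apply/seteqP; split=> m /=; first by move=> ->.
    by rewrite lerN2 => H; apply/eqP; rewrite eq_le maxX.
  by apply: closed_le_cont => m; exact (contN (cu m)).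
pose h m := dot (X m - Qq) (X m - Qq).
have ch : continuous h.
  move=> m; have cXp := contB (@cX m) (@contC _ _ _ Qq m).
  exact (cont_dot cXp cXp).
have [p1 /[!inE] -[up1 Kp1] p1min] : exists2 m, m \in S & forall t, t \in S -> h m <= h t.
  apply: compact_EVT_min; first by exists p.
    exact: closed_compactT.
  exact: continuous_subspaceT.
have hp1 : h p1 < et / 4.
  apply: le_lt_trans Qq0; have := p1min p; rewrite inE => /(_ (conj up Kp)).
  by rewrite /h [X in _ <= X]dot_subsq (dotC (X p)) [X in _ -> _ <= X]dot_subsq; lra.
(* Otherwise X q0 = (1 + s q0) X p1, and injectivity along rays gives q0 = p1, although |X q0|^2 <
   mx. *)
have h0 : 0 < h p1.
  rewrite /h dot_gt0 subr_eq0; apply/eqP => E.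
  have := Oinj q0 p1 (s q0) (KO _ Kq0) (KO _ Kp1) sq0.
  by rewrite E => /(_ Xq0) q0p1; move: uq0; rewrite q0p1 up1 ltxx.
have p1K : nbhs p1 K.
  apply: contrapT => nK.
  have := gap p1 (conj Kp1 nK); have := dot_sub_le (X p1) (X p) Qq.
  have -> : dot (X p - Qq) (X p - Qq) = dot (Qq - X p) (Qq - X p).
    by rewrite !dot_subsq (dotC (X p)); ring.
  rewrite -/(h p1); lra.
pose Q := 2^-1 *: (X p1 + Qq).
have dQ m : dot (X m - Q) (X m - Q) =
    dot (X m) (X m) - (dot (X m) (X p1) + dot (X m) Qq) + (2 * mx + 2 * dot (X p1) Qq) / 4.
  rewrite dot_subsq /Q !dotZl !dotZr !dotDl !dotDr up1 QQ (dotC Qq).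
  by field.
(* For |X m|^2 = mx, lying in the ball about Q means <X m, X p1> + <X m, Qq> >= mx + <X p1, Qq>.
   Minimality of h at p1 gives <X m, Qq> <= <X p1, Qq>. Hence <X m, X p1> >= mx, which forces X m =
   X p1. *)
apply: (@no_strict_touching p1 Q K up1 p1K).
  move=> m Km um; rewrite !dQ um up1 => le1.
  have := p1min m; rewrite inE => /(_ (conj um Km)).
  rewrite /h !dot_subsq um up1 QQ => le2.
  apply: Kinj => //; apply/eqP; rewrite -subr_eq0 -dot_eq0 eq_le dot_ge0 andbT.
  by rewrite dot_subsq um up1; lra.
have hE : h p1 = 2 * mx - 2 * dot (X p1) Qq by rewrite /h dot_subsq up1 QQ; ring.
have nQ : dot (X p1) (X p1 - Q) = h p1 / 4.
  by rewrite dotBr /Q dotZr dotDr up1 hE; field.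
have qQ : dot (X p1 - Q) (X p1 - Q) = h p1 / 4.
  by rewrite dQ up1 hE; field.
(* At the maximum p1 the vector X p1 is normal with square mx, so the normal part of X p1 - Q is
   read off from <X p1, X p1 - Q> = h p1 / 4. *)
have nrm : mx * dot (X p1 - Q) (N p1) ^+ 2 = (h p1 / 4) ^+ 2.
  have := max_normal (X p1) up1; rewrite up1 => E1.
  by rewrite -nQ (max_normal _ up1) {1}E1; ring.
rewrite -(pmulr_rgt0 _ mx0) mulrBr nrm qQ.
have hm : h p1 < mx by lra.
have -> : mx * (h p1 / 4) - (h p1 / 4) ^+ 2 = (h p1 / 4) * (mx - h p1 / 4) by ring.
by rewrite mulr_gt0//; lra.
Qed.

Lemma norm_const : connected [set: M] -> (exists p, dot (X p) (X p) = mx) ->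
  forall m, dot (X m) (X m) = mx.
Proof.
move=> cM [p up] m.
(* [max_set_open] projects radially and needs mx > 0; if mx <= 0, then |X|^2 is squeezed between 0
   and mx. *)
have [mx0|mx0] := ltP 0 mx; last first.
  by apply/eqP; rewrite eq_le maxX (le_trans mx0)// dot_ge0.
have ST : [set m | dot (X m) (X m) = mx] = [set: M].
  apply: cM; first by exists p.
    exists [set m | dot (X m) (X m) = mx]; last by rewrite setTI.
    by rewrite openE => q uq; exact: max_set_open.
  exists [set m | dot (X m) (X m) = mx]; last by rewrite setTI.
  have -> : [set m | dot (X m) (X m) = mx] = [set m | - dot (X m) (X m) <= - mx].
    apply/seteqP; split=> q /=; first by move=> ->.
    by rewrite lerN2 => H; apply/eqP; rewrite eq_le maxX.
  by apply: closed_le_cont => q; exact (contN (cont_dot (@cX q) (@cX q))).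
by have /seteqP[_ /(_ m)] := ST; exact.
Qed.

End StrongMaximum.

(** * Lifting through a local homeomorphism *)

Section Lifting.
Variables (R : realType) (Y : normedModType R) (M : topologicalType).
Variables (S : set Y) (X : M -> Y).
Hypotheses (hausM : hausdorff_space M) (compactM : compact [set: M]).
Hypothesis cX : continuous X.

(* X is a local homeomorphism onto S, with local inverses s. *)
Hypothesis local_sections : forall m, exists (U : set M) (B : set Y) (s : Y -> M),
  [/\ open U, U m, open B, forall y, B y -> {for y, continuous s} &
      (forall a, U a -> B (X a) /\ s (X a) = a) /\
      (forall y, B y -> S y -> U (s y) /\ X (s y) = y)].

(** The set of agreement is open in C because X is locally injective, and closed in C because M is
    Hausdorff. *)
Lemma unique_lift (T : topologicalType) (C : set T) (E E' : T -> M) t0 :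
  connected C -> (forall t, C t -> {for t, continuous E}) ->
  (forall t, C t -> {for t, continuous E'}) ->
  (forall t, C t -> X (E t) = X (E' t)) -> C t0 -> E t0 = E' t0 ->
  forall t, C t -> E t = E' t.
Proof.
move=> conC cE cE' EE' Ct0 E0 t Ct.
suff eqC : C `&` [set z | E z = E' z] = C by have := Ct; rewrite -{1}eqC => -[].
apply: conC; first by exists t0.
(* C is an arbitrary connected set, so the relatively open set is cut out by the interior of the
   implication [C z -> E z = E' z]. *)
- exists [set z | C z -> E z = E' z]°; first exact: open_interior.
  apply/seteqP; split=> z [Cz Ez]; last by split=> //; exact: (nbhs_singleton Ez Cz).
  split=> //; have [U [B [s [oU Um oB cs [sX Xs]]]]] := local_sections (E z).
  have N1 : \forall z' \near z, U (E z') by apply: (cE z Cz); exact: open_nbhs_nbhs.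
  have N2 : \forall z' \near z, U (E' z').
    by apply: (cE' z Cz); rewrite -Ez; exact: open_nbhs_nbhs.
  rewrite /interior; apply: filterS2 N1 N2 => z' U1 U2 Cz'.
  by have [_ <-] := sX _ U1; have [_ <-] := sX _ U2; rewrite EE'.
- exists (~` [set z | C z -> E z <> E' z]°); first exact/open_closedC/open_interior.
  apply/seteqP; split=> z [Cz Ez]; split=> //.
    by move=> /nbhs_singleton/(_ Cz).
  apply: hausM => P Q EP E'Q; apply: contrapT => /set0P/negP; rewrite negbK => /eqP PQ0.
  apply: Ez; have N1 : \forall z' \near z, P (E z') := cE z Cz _ EP.
  have N2 : \forall z' \near z, Q (E' z') := cE' z Cz _ E'Q.
  rewrite /interior; apply: filterS2 N1 N2 => z' P1 Q1 _ E1.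
  suff : set0 (E z') by [].
  by rewrite -PQ0; split=> //; rewrite E1.
Qed.

Lemma connected_line (T : normedModType R) (a b : T) :
  connected [set a + t *: b | t in `[0, 1 : R]].
Proof.
apply: connected_continuous_connected; first exact: segment_connected.
apply: continuous_subspaceT => t.
exact (contD (@contC _ _ _ a t) (contZ (@cvg_id _ (nbhs t)) (@contC _ _ _ b t))).
Qed.

Variables (T : normedModType R) (f : T -> Y) (p : M).
Hypotheses (cf : continuous f) (fS : forall w, S (f w)) (f0 : f 0 = X p).

(* Lifts over star-shaped open sets agree on intersections, hence their union is a
   largest one. *)
Definition partial_lift (U : set T) (E : T -> M) : Prop :=
  [/\ open U, U 0, forall w t, U w -> 0 <= t <= 1 -> U (t *: w),
      forall w, U w -> {for w, continuous E} &
      (forall w, U w -> X (E w) = f w) /\ E 0 = p].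

Lemma partial_lift_agree U E U' E' w : partial_lift U E -> partial_lift U' E' ->
  U w -> U' w -> E w = E' w.
Proof.
move=> [oO O0 sO cE [XE E0]] [oO' U'0 sO' cE' [XE' E'0]] Ow U'w.
pose C := [set 0 + t *: w | t in `[0, 1 : R]].
have CO z : C z -> U z /\ U' z.
  move=> [t /=]; rewrite in_itv /= => t01 <-; rewrite add0r.
  by split; [exact: sO|exact: sO'].
apply: (@unique_lift T C E E' 0).
- exact: connected_line.
- by move=> z /CO[? _]; exact: cE.
- by move=> z /CO[_ ?]; exact: cE'.
- by move=> z /CO[? ?]; rewrite XE// XE'.
- by exists 0 => /=; rewrite ?in_itv /= ?lexx ?ler01// ?scale0r ?addr0.
- by rewrite E0 E'0.
- by exists 1 => /=; rewrite ?in_itv /= ?lexx ?ler01// ?scale1r ?add0r.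
Qed.

Let A : set T := [set w | exists U E, partial_lift U E /\ U w].
Let Emax (w : T) : M := xget p [set m | exists U E, [/\ partial_lift U E, U w & E w = m]].

Lemma EmaxE U E w : partial_lift U E -> U w -> Emax w = E w.
Proof.
move=> lOE Ow.
have : [set m | exists U E, [/\ partial_lift U E, U w & E w = m]] (Emax w).
  by apply: xgetPex; exists (E w), U, E.
by move=> [U' [E' [lOE' U'w <-]]]; exact: partial_lift_agree lOE' lOE U'w Ow.
Qed.

Lemma exists_partial_lift : A 0.
Proof.
have [U [B [s [oO Op oB cs [sX Xs]]]]] := local_sections p.
have [Bp sp] := sX p Op.
have : nbhs (0 : T) (f @^-1` B).
  by apply: cf; rewrite f0; exact: open_nbhs_nbhs.
move=> /nbhs_ballP[e /= e0 He].
have He' w : `|w| < e -> B (f w).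
  by move=> we; apply: He; rewrite -ball_normE /= sub0r normrN.
exists [set w | `|w| < e], (s \o f); split; last by rewrite /= normr0.
split=> /=.
- have cn : continuous (fun w : T => `|w|) by exact: norm_continuous.
  exact (@open_lt_cont R T _ e cn).
- by rewrite normr0.
- move=> w t we /andP[t0 t1]; apply: le_lt_trans we.
  by rewrite normrZ ger0_norm// ler_piMl.
- by move=> w we; exact: (cont_comp (@cf w) (cs _ (He' w we))).
- split; last by rewrite /= f0.
  by move=> w we; have [] := Xs _ (He' w we) (fS w).
Qed.

Lemma Emax_lift : partial_lift A Emax.
Proof.
split.
- rewrite openE => w [U [E [lOE Ow]]]; have [oO _ _ _ _] := lOE.
  have : nbhs w U by exact: open_nbhs_nbhs.
  by apply: filterS => z Oz; exists U, E.
- exact: exists_partial_lift.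
- move=> w t [U [E [lOE Ow]]] t01; exists U, E; split=> //.
  by case: lOE => _ _ sO _ _; exact: sO.
- move=> w [U [E [lOE Ow]]]; have [oO _ _ cE _] := lOE.
  apply: continuous_eq_near (cE w Ow).
  have : nbhs w U by exact: open_nbhs_nbhs.
  by apply: filterS => z Oz; rewrite (EmaxE lOE Oz).
- split.
    by move=> w [U [E [lOE Ow]]]; rewrite (EmaxE lOE Ow); case: lOE => _ _ _ _ [XE _]; exact: XE.
  have [U [E [lOE O0]]] := exists_partial_lift.
  by rewrite (EmaxE lOE O0); case: lOE => _ _ _ _ [].
Qed.

(* A cluster point of the lift at t1 provides the local section used to extend it. *)
Lemma lift_extends w0 t1 : 0 < t1 -> (forall t, 0 <= t < t1 -> A (t *: w0)) -> A (t1 *: w0).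
Proof.
move=> t10 At; have [oA A0 sA cE [XE E0]] := Emax_lift.
(* The lift is not known to converge at t1. Compactness gives a cluster point m of its values, and
   [pick] extracts parameters t < t1 whose lift lies near m. *)
pose F : set_system M := (fun t : R => Emax (t *: w0)) @ t1^'-.
have [m [_ clm]] : [set: M] `&` cluster F !=set0 by apply: compactM; exact: filterT.
have [U [B [s [oO Om oB cs [sX Xs]]]]] := local_sections m.
have cl (t : R) : {for t, continuous (fun t : R => t *: w0)}.
  exact (contZ (@cvg_id _ (nbhs t)) (@contC _ _ _ w0 t)).
have pick (P : set M) (Q : set T) : nbhs m P -> nbhs (t1 *: w0) Q ->
    exists t, [/\ 0 < t < t1, P (Emax (t *: w0)) & Q (t *: w0)].
  move=> mP Qt.
  have QF : \forall t \near t1, Q (t *: w0) by exact: (cl t1).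
  have F1 : \forall t \near t1^'-, 0 < t < t1 /\ Q (t *: w0).
    have N0 : \forall t \near t1, 0 < t by exact: (near_gt (@cvg_id _ (nbhs t1)) t10).
    rewrite near_withinE; apply: filterS2 N0 QF => t t0 Qt' tt1.
    by rewrite t0 tt1.
  have FG : F [set Emax (t *: w0) | t in [set t : R | 0 < t < t1 /\ Q (t *: w0)]].
    by apply: filterS F1 => t tP /=; exists t.
  by have [_ [[t [t01 Qt'] <-] Pt]] := clm _ _ FG mP; exists t.
have Xm : X m = f (t1 *: w0).
  apply: norm_hausdorff => P Q mP Qt.
  have [t [/andP[t0 tt1] Pt Qt']] := pick _ _ (cX mP) (cf Qt).
  exists (f (t *: w0)); split => //.
  by move: Pt; rewrite /preimage /= XE//; apply: At; rewrite ltW.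
have [Bm _] := sX m Om.
have : nbhs (t1 *: w0) (f @^-1` B) by apply: cf; rewrite -Xm; exact: open_nbhs_nbhs.
move=> /nbhs_ballP[e /= e0 He].
pose C := ball (t1 *: w0) e.
have CB w : C w -> B (f w) by exact: He.
have Cconv u v (t : R) : C u -> C v -> 0 <= t <= 1 -> C (u + t *: (v - u)).
  rewrite /C -ball_normE /= => uC vC /andP[t0 t1'].
  have -> : t1 *: w0 - (u + t *: (v - u)) =
      (1 - t) *: (t1 *: w0 - u) + t *: (t1 *: w0 - v).
    rewrite scalerBl scale1r !scalerBr opprD opprB addrA opprB -[RHS]addrA.
    by congr (_ + _); rewrite addrA subrK.
  apply: le_lt_trans (ler_normD _ _) _; rewrite !normrZ !ger0_norm ?subr_ge0//.
  have [->|t0'] := eqVneq t 0; first by rewrite subr0 mul1r mul0r addr0.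
  apply: (@lt_le_trans _ _ ((1 - t) * e + t * e)); last by rewrite -mulrDl subrK mul1r.
  apply: ler_ltD; first by rewrite ler_wpM2l ?subr_ge0// ltW.
  by rewrite ltr_pM2l// lt_def t0'.
have [t [/andP[t0 tt1] Ot Ct]] := pick U C (open_nbhs_nbhs (conj oO Om)) (nbhsx_ballx _ _ e0).
have Atw : A (t *: w0) by apply: At; rewrite ltW.
pose D := [set d | [/\ A d, C d & Emax d = s (f d)]]°.
have DP d : D d -> [/\ A d, C d & Emax d = s (f d)] by move=> /nbhs_singleton.
have Dt : D (t *: w0).
  have N1 : \forall d \near t *: w0, A d by exact: open_nbhs_nbhs.
  have N2 : \forall d \near t *: w0, C d.
    by apply: open_nbhs_nbhs; split=> //; exact: ball_open.
  have N3 : \forall d \near t *: w0, U (Emax d).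
    by apply: (cE _ Atw); exact: open_nbhs_nbhs.
  rewrite /D /interior; move: N1 N2 N3; apply: filterS3 => d Ad Cd Od; split=> //.
  by have [_] := sX _ Od; rewrite XE.
(* The intersection of the ball C with A may be disconnected, so s o f is used only at points w
   whose radial segment meets D, where it already agrees with the lift. The piece of the segment
   from mu w to w then forces agreement at w if w is in A, and the union of A and K stays
   star-shaped. *)
pose K := [set w | C w /\ exists2 mu : R, 0 < mu < 1 & D (mu *: w)].
have sfc w : C w -> {for w, continuous (s \o f)}.
  by move=> Cw; exact: (cont_comp (@cf w) (cs _ (CB _ Cw))).
have Xsf w : C w -> X (s (f w)) = f w by move=> Cw; have [] := Xs _ (CB _ Cw) (fS w).
have seg w (mu tau : R) : C w -> C (mu *: w) -> 0 < mu < 1 -> mu <= tau <= 1 -> C (tau *: w).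
  move=> Cw Cmw /andP[mu0 mu1] /andP[mt tau1].
  have -> : tau *: w = mu *: w + ((tau - mu) / (1 - mu)) *: (w - mu *: w).
    have -> : w - mu *: w = (1 - mu) *: w by rewrite scalerBl scale1r.
    by rewrite scalerA divfK ?subr_eq0 ?gt_eqF// -scalerDl addrC subrK.
  apply: Cconv => //; rewrite divr_ge0 ?subr_ge0//=; last exact: ltW.
  by rewrite ler_pdivrMr ?subr_gt0// mul1r lerB.
have KE w : K w -> A w -> Emax w = s (f w).
  move=> [Cw [mu mu01 Dmw]] Aw; have [Amw Cmw Emw] := DP _ Dmw.
  have /andP[mu0 mu1] := mu01.
  pose G := [set mu *: w + t *: ((1 - mu) *: w) | t in `[0, 1 : R]].
  have GP z : G z -> A z /\ C z.
    move=> [r /=]; rewrite in_itv /= => /andP[r0 r1] <-.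
    rewrite scalerA -scalerDl.
    have H1 : mu <= mu + r * (1 - mu) by rewrite lerDl mulr_ge0// subr_ge0 ltW.
    have H2 : mu + r * (1 - mu) <= 1.
      have : r * (1 - mu) <= 1 * (1 - mu) by rewrite ler_wpM2r// subr_ge0 ltW.
      lra.
    split; last by apply: (seg w mu) => //; rewrite H1.
    by apply: sA => //; rewrite H2 andbT (le_trans (ltW mu0)).
  apply: (@unique_lift T G Emax (s \o f) (mu *: w)).
  - exact: connected_line.
  - by move=> z /GP[? _]; exact: cE.
  - by move=> z /GP[_ ?]; exact: sfc.
  - by move=> z /GP[? ?]; rewrite XE// /= Xsf.
  - by exists 0 => /=; rewrite ?in_itv /= ?lexx ?ler01// ?scale0r ?addr0.
  - by [].
  - by exists 1 => /=; rewrite ?in_itv /= ?lexx ?ler01// scale1r -scalerDl addrC subrK scale1r.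
pose E2 w := if pselect (A w) then Emax w else s (f w).
have E2A w : A w -> E2 w = Emax w by rewrite /E2; case: pselect.
have E2K w : K w -> E2 w = s (f w).
  by move=> Kw; rewrite /E2; case: pselect => // Aw; exact: KE.
have nearK w : K w -> \forall z \near w, K z.
  move=> [Cw [mu mu01 Dmw]].
  have N1 : \forall z \near w, C z.
    by apply: open_nbhs_nbhs; split=> //; exact: ball_open.
  have N2 : \forall z \near w, D (mu *: z).
    have cm : {for w, continuous (fun z : T => mu *: z)}.
      exact (contZ (@contC _ _ _ mu w) (@cvg_id _ (nbhs w))).
    by apply: cm; apply: open_nbhs_nbhs; split=> //; exact: open_interior.
  by apply: filterS2 N1 N2 => z Cz Dz; split=> //; exists mu.
exists (A `|` K), E2; split; last first.
  right; split; first exact: ballxx.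
  exists (t / t1); first by rewrite divr_gt0//= ltr_pdivrMr// mul1r.
  by rewrite scalerA divfK// gt_eqF.
split.
- apply: openU; first exact oA.
  by rewrite openE => w; exact: nearK.
- by left.
- move=> w tau [Aw|[Cw [mu mu01 Dmw]]] tau01; first by left; exact: sA.
  have [Amw Cmw _] := DP _ Dmw; have /andP[mu0 mu1] := mu01; have /andP[ta0 ta1] := tau01.
  have [tm|mt] := leP tau mu.
    left; have -> : tau *: w = (tau / mu) *: (mu *: w) by rewrite scalerA divfK// gt_eqF.
    apply: sA => //; rewrite (divr_ge0 ta0 (ltW mu0)) /=.
    by rewrite ler_pdivrMr// mul1r.
  right; split; first by apply: (seg w mu) => //; rewrite ltW.
  have tau0 : 0 < tau by exact: lt_trans mt.
  exists (mu / tau); first by rewrite divr_gt0//= ltr_pdivrMr// mul1r.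
  by rewrite scalerA divfK// gt_eqF.
- move=> w [Aw|Kw].
    apply: continuous_eq_near (cE w Aw).
    have : \forall z \near w, A z by exact: open_nbhs_nbhs.
    by apply: filterS => z Az; rewrite E2A.
  apply: continuous_eq_near (sfc w Kw.1).
  by apply: filterS (nearK w Kw) => z Kz; rewrite E2K.
- split; last by rewrite E2A.
  move=> w [Aw|Kw]; first by rewrite E2A// XE.
  by rewrite E2K// Xsf//; case: Kw.
Qed.

Theorem lift_exists : exists E : T -> M,
  [/\ continuous E, forall w, X (E w) = f w & E 0 = p].
Proof.
have [oA A0 sA cE [XE E0]] := Emax_lift.
have AT w0 : A w0.
  apply: contrapT => nA.
  (* Along the ray through w0: A contains the supremum of I by [lift_extends], and openness of A
     then pushes past it unless the supremum is 1. *)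
  pose I := [set t : R | 0 <= t <= 1 /\ A (t *: w0)].
  have I0 : I 0 by split; rewrite ?lexx ?ler01// scale0r.
  have hI : has_sup I by split; [exists 0|exists 1 => t [/andP[]]].
  have below t : 0 <= t < sup I -> A (t *: w0).
    move=> /andP[t0 tI]; have [y [/andP[y0 y1] Ay] ty] := sup_gt (ex_intro _ 0 I0) tI.
    have y0' : 0 < y by exact: le_lt_trans ty.
    have -> : t *: w0 = (t / y) *: (y *: w0) by rewrite scalerA divfK// gt_eqF.
    by apply: sA => //; rewrite divr_ge0//= ler_pdivrMr// mul1r ltW.
  have sup1 : sup I <= 1 by apply: ge_sup; [exists 0|move=> t [/andP[]]].
  have sup0 : 0 <= sup I by exact: (sup_upper_bound hI).
  have step : 0 <= sup I -> A (sup I *: w0) -> False.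
    move=> s0 As.
    have ct : {for sup I, continuous (fun t : R => t *: w0)}.
      exact (contZ (@cvg_id _ (nbhs (sup I))) (@contC _ _ _ w0 (sup I))).
    have : \forall t \near sup I, A (t *: w0) by apply: ct; exact: open_nbhs_nbhs.
    move=> /nbhs_ballP[e /= e0 He].
    pose t := Num.min (sup I + e / 2) 1.
    have It : I t.
      have t1 : t <= 1 by rewrite ge_min lexx orbT.
      have st : sup I <= t by rewrite le_min sup1 andbT lerDl divr_ge0// ltW.
      split; first by rewrite t1 (le_trans s0).
      apply: He; rewrite -ball_normE /= distrC ger0_norm ?subr_ge0//.
      rewrite ltrBlDl (@le_lt_trans _ _ (sup I + e / 2))//; first by rewrite ge_min lexx.
      by rewrite ltrD2l; lra.
    have := sup_upper_bound hI It; rewrite ge_min => /orP[]; first by lra.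
    move=> s1; have E1 : sup I = 1 by apply/eqP; rewrite eq_le sup1.
    by apply: nA; move: As; rewrite E1 scale1r.
  have [s0|s0] := ltP 0 (sup I).
    by apply: step => //; exact: lift_extends.
  have E0' : sup I = 0 by apply/eqP; rewrite eq_le s0 sup0.
  by apply: step => //; rewrite E0' scale0r.
exists Emax; split=> //.
- by move=> w; exact: cE.
- by move=> w; exact: XE.
Qed.

End Lifting.

(** * Coverings of spheres of dimension at least two *)

Section Stereographic.
Variables (R : realType) (n : nat).

Lemma dot_norm_ge (v : 'rV[R]_n.+1) : `|v| ^+ 2 <= dot v v.
Proof.
have H : `|v| <= Num.sqrt (dot v v).
  apply: norm_row_le => [|i]; first exact: sqrtr_ge0.
  rewrite -sqrtr_sqr ler_wsqrtr// dotE (bigD1 i)//= expr2 lerDl.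
  by apply: sumr_ge0 => j _; rewrite -expr2 sqr_ge0.
rewrite -[leRHS]sqr_sqrtr ?dot_ge0// ler_sqr// nnegrE; [exact: normr_ge0|exact: sqrtr_ge0].
Qed.

Lemma nbhs_dot (y : 'rV[R]_n.+1) (B : set 'rV[R]_n.+1) : nbhs y B ->
  exists2 e, 0 < e & forall z, dot (z - y) (z - y) < e -> B z.
Proof.
move=> /nbhs_ballP[e /= e0 He]; exists (e ^+ 2); first exact: exprn_gt0.
move=> z ze; apply: He; rewrite -ball_normE /= distrC.
rewrite -(ltr_pXn2r (n := 2)) ?nnegrE ?(ltW e0) ?normr_ge0//.
exact: le_lt_trans (dot_norm_ge _) ze.
Qed.

Variables (r : R) (x0 : 'rV[R]_n.+1).
Hypotheses (r0 : 0 < r) (dx0 : dot x0 x0 = r ^+ 2).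

Let r2 : 0 < r ^+ 2. Proof. exact: exprn_gt0. Qed.

Let r2n : r ^+ 2 != 0. Proof. exact: lt0r_neq0. Qed.

Definition orth_proj (w : 'rV[R]_n.+1) := w - (dot w x0 / r ^+ 2) *: x0.

(* Inversion in the sphere of radius sqrt 2 r about - x0 exchanges S(r) and the
   hyperplane orthogonal to x0; restricted to them it is stereographic projection. *)
Definition inversion (w : 'rV[R]_n.+1) :=
  - x0 + (2 * r ^+ 2 / dot (w + x0) (w + x0)) *: (w + x0).

(** The projection makes the inverse stereographic projection from the pole - x0 total on R^(n+1), a
    normed space to which [lift_exists] applies. *)
Definition stereo_inv w := inversion (orth_proj w).

Lemma orth_proj_orth w : dot (orth_proj w) x0 = 0.
Proof. by rewrite /orth_proj dotBl dotZl dx0 divfK// subrr. Qed.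

Lemma orth_projK w : dot w x0 = 0 -> orth_proj w = w.
Proof. by move=> w0; rewrite /orth_proj w0 mul0r scale0r subr0. Qed.

Lemma dot_add_orth w : dot w x0 = 0 -> dot (w + x0) (w + x0) = dot w w + r ^+ 2.
Proof. by move=> w0; rewrite !dotDl !dotDr (dotC x0 w) w0 dx0; ring. Qed.

Lemma dot_add_gt0 w : dot w x0 = 0 -> 0 < dot (w + x0) (w + x0).
Proof. by move=> w0; rewrite dot_add_orth// ltr_wpDl// dot_ge0. Qed.

Lemma inversion_add w : inversion w + x0 =
  (2 * r ^+ 2 / dot (w + x0) (w + x0)) *: (w + x0).
Proof. by rewrite /inversion addrAC addNr add0r. Qed.

Lemma dot_inversion_add w : w + x0 != 0 ->
  dot (inversion w + x0) (inversion w + x0) = 4 * (r ^+ 2) ^+ 2 / dot (w + x0) (w + x0).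
Proof.
move=> w0; rewrite inversion_add dotZl dotZr.
by field; rewrite dot_eq0.
Qed.

Lemma inversionK w : w + x0 != 0 -> inversion (inversion w) = w.
Proof.
move=> w0; rewrite {1}/inversion dot_inversion_add// inversion_add scalerA.
have -> : 2 * r ^+ 2 / (4 * (r ^+ 2) ^+ 2 / dot (w + x0) (w + x0)) *
  (2 * r ^+ 2 / dot (w + x0) (w + x0)) = 1.
  by field; rewrite dot_eq0 w0 lt0r_neq0.
by rewrite scale1r addrCA addNr addr0.
Qed.

Lemma sphere_inversion w : dot w x0 = 0 -> sphere r (inversion w).
Proof.
move=> w0; have D0 := dot_add_gt0 w0.
rewrite /sphere /= /inversion; set s := _ / _.
have sD : s * dot (w + x0) (w + x0) = 2 * r ^+ 2 by rewrite divfK// lt0r_neq0.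
rewrite addrC dot_subsq !dotZl !dotZr dx0 sD dotDl w0 dx0; ring.
Qed.

Lemma inversion_orth y : sphere r y -> y + x0 != 0 -> dot (inversion y) x0 = 0.
Proof.
move=> Sy yx; have D0 : dot (y + x0) (y + x0) != 0 by rewrite dot_eq0.
have DE : dot (y + x0) (y + x0) = 2 * (dot y x0 + r ^+ 2).
  by rewrite !dotDl !dotDr (dotC x0 y) dx0 [dot y y]Sy; ring.
rewrite /inversion; set s := _ / _.
rewrite dotDl dotNl dotZl dotDl dx0 /s DE; field.
by move: D0; rewrite DE mulf_eq0 negb_or => /andP[].
Qed.

Lemma stereo_inv0 : stereo_inv 0 = x0.
Proof.
rewrite /stereo_inv orth_projK ?dot0l// /inversion add0r dx0 mulfK//.
by rewrite (_ : 2 = 1 + 1 :> R)// scalerDl !scale1r addKr.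
Qed.

Lemma stereo_inv_sphere w : sphere r (stereo_inv w).
Proof. by apply: sphere_inversion; exact: orth_proj_orth. Qed.

Lemma stereo_invK y : sphere r y -> y + x0 != 0 -> stereo_inv (inversion y) = y.
Proof. by move=> Sy yx; rewrite /stereo_inv orth_projK ?inversionK// inversion_orth. Qed.

Lemma orth_add_neq0 w : dot w x0 = 0 -> w + x0 != 0.
Proof. by move=> /dot_add_gt0; rewrite dot_gt0. Qed.

Lemma inversion_stereo_inv w : inversion (stereo_inv w) = orth_proj w.
Proof. by rewrite inversionK// orth_add_neq0// orth_proj_orth. Qed.

Lemma stereo_inv_neq w : stereo_inv w + x0 != 0.
Proof.
have o := orth_proj_orth w; have nz := orth_add_neq0 o.
rewrite -dot_gt0 dot_inversion_add// divr_gt0 ?dot_gt0//.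
by rewrite mulr_gt0// exprn_gt0.
Qed.

Lemma cont_orth_proj : continuous orth_proj.
Proof.
move=> w; have cid := @cvg_id _ (nbhs w).
exact (contB cid (contZ (contM (cont_dot cid (@contC _ _ _ x0 w)) (@contC _ _ _ (r ^+ 2)^-1 w))
  (@contC _ _ _ x0 w))).
Qed.

Lemma cont_inversion w : w + x0 != 0 -> {for w, continuous inversion}.
Proof.
move=> w0; have cid := @cvg_id _ (nbhs w).
have D0 : dot (w + x0) (w + x0) != 0 by rewrite dot_eq0.
have cD := contD cid (@contC _ _ _ x0 w).
exact (contD (@contC _ _ _ (- x0) w) (contZ (contM (@contC _ _ _ (2 * r ^+ 2) w)
  (@contV _ _ (fun y : 'rV[R]_n.+1 => dot (y + x0) (y + x0)) w D0 (cont_dot cD cD))) cD)).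
Qed.

Lemma cont_stereo_inv : continuous stereo_inv.
Proof.
move=> w; exact (cont_comp (@cont_orth_proj w)
  (cont_inversion (orth_add_neq0 (orth_proj_orth w)))).
Qed.

(** Inversion multiplies distances to - x0 to a constant: |y + x0|^2 |w + x0|^2 = 4 r^4. So far
    points of the hyperplane go near the pole. *)
Lemma stereo_inv_near_pole (B : set 'rV[R]_n.+1) : nbhs (- x0) B ->
  exists2 rho, 0 < rho & forall w, dot w x0 = 0 -> rho < dot w w -> B (stereo_inv w).
Proof.
move=> /nbhs_dot[e e0 He]; exists (4 * (r ^+ 2) ^+ 2 / e).
  by rewrite divr_gt0// mulr_gt0// exprn_gt0.
move=> w w0 we; apply: He; rewrite opprK /stereo_inv orth_projK//.
rewrite dot_inversion_add ?orth_add_neq0// ltr_pdivrMr ?dot_add_gt0//.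
rewrite dot_add_orth// [e * _]mulrC -ltr_pdivrMr//; apply: lt_le_trans we _.
by rewrite lerDl ltW.
Qed.

Lemma inversion_near_pole rho : 0 < rho -> \forall y \near - x0, sphere r y ->
  y + x0 != 0 -> rho < dot (inversion y) (inversion y).
Proof.
move=> rho0; have c0 : 0 < 4 * (r ^+ 2) ^+ 2 / (rho + r ^+ 2).
  by rewrite divr_gt0 ?addr_gt0// mulr_gt0// exprn_gt0.
have cy : {for - x0, continuous (fun y : 'rV[R]_n.+1 => dot (y + x0) (y + x0))}.
  have cD := contD (@cvg_id _ (nbhs (- x0))) (@contC _ _ _ x0 (- x0)).
  exact (cont_dot cD cD).
have : dot (- x0 + x0) (- x0 + x0) < 4 * (r ^+ 2) ^+ 2 / (rho + r ^+ 2).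
  by rewrite addNr dot0l.
move=> /(near_lt cy); apply: filterS => y yc Sy yx.
have iy := inversion_orth Sy yx.
have := dot_inversion_add yx; rewrite (dot_add_orth iy) => E.
rewrite -(ltrD2r (r ^+ 2)) E ltr_pdivlMr ?dot_gt0// mulrC -ltr_pdivlMr//.
by rewrite addr_gt0.
Qed.

Hypothesis n2 : (2 <= n)%N.

(** Two linear conditions on R^(n+1) leave a nonzero solution since n + 1 > 2; it is then
    stretched. *)
Lemma exists_orth (u : 'rV[R]_n.+1) rho : 0 < rho ->
  exists c, [/\ dot c x0 = 0, dot c u = 0 & rho < dot c c].
Proof.
move=> rho0; pose A := \matrix_(i < n.+1, j < 2) (if j == 0 then x0 0 i else u 0 i) : 'M[R]_(n.+1, 2).
have : kermx A != 0.
  rewrite -mxrank_eq0 mxrank_ker -lt0n subn_gt0.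
  by apply: leq_ltn_trans (rank_leq_col _) _; rewrite ltnS.
move=> /rowV0Pn[v /sub_kermxP vA v0].
have vx : dot v x0 = 0.
  have := congr1 (fun B : 'rV[R]_2 => B 0 0) vA; rewrite !mxE dotE => E; rewrite -[RHS]E.
  by apply: eq_bigr => i _; rewrite !mxE.
have vu : dot v u = 0.
  have := congr1 (fun B : 'rV[R]_2 => B 0 1) vA; rewrite !mxE dotE => E; rewrite -[RHS]E.
  by apply: eq_bigr => i _; rewrite !mxE.
pose l := 1 + rho / dot v v; have vv : 0 < dot v v by rewrite dot_gt0.
have l0 : 0 < rho / dot v v by rewrite divr_gt0.
exists (l *: v); rewrite !dotZl !dotZr vx vu !mulr0; split=> //.
have E : l * dot v v = dot v v + rho by rewrite mulrDl mul1r divfK// lt0r_neq0.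
rewrite E; have : 1 * rho < l * (dot v v + rho); last by rewrite mul1r.
by apply: ltr_pM; rewrite ?ltW// ?ltrDl// ltrDr.
Qed.

Definition exterior rho := [set w : 'rV[R]_n.+1 | dot w x0 = 0 /\ rho < dot w w].

(** The segment is rescaled so that its length function interpolates linearly between |u| and |v|;
    it then stays outside the ball. Rescaling requires it to avoid 0. *)
Lemma exterior_segment rho u v : 0 < rho -> exterior rho u -> exterior rho v ->
  (forall t, 0 <= t <= 1 -> (1 - t) *: u + t *: v != 0) ->
  exists G, [/\ connected G, G `<=` exterior rho, G u & G v].
Proof.
move=> rho0 [ux uu] [vx vv] h0.
pose h t := (1 - t) *: u + t *: v.
pose nu (w : 'rV[R]_n.+1) := Num.sqrt (dot w w).
pose L t := (1 - t) * nu u + t * nu v.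
pose g t := (L t / nu (h t)) *: h t.
have nu0 w : w != 0 -> 0 < nu w by rewrite sqrtr_gt0 dot_gt0.
have nusq w : nu w * nu w = dot w w by rewrite -expr2 sqr_sqrtr// dot_ge0.
have ch (t : R) : {for t, continuous h}.
  have cid := @cvg_id _ (nbhs t).
  exact (contD (contZ (contB (@contC _ _ _ (1 : R) t) cid) (@contC _ _ _ u t))
    (contZ cid (@contC _ _ _ v t))).
have cL (t : R) : {for t, continuous L}.
  have cid := @cvg_id _ (nbhs t).
  exact (contD (contM (contB (@contC _ _ _ (1 : R) t) cid) (@contC _ _ _ (nu u) t))
    (contM cid (@contC _ _ _ (nu v) t))).
have cnh (t : R) : {for t, continuous (fun t => nu (h t))}.
  exact (cont_comp (cont_dot (ch t) (ch t)) (@sqrt_continuous R _)).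
have cg t : 0 <= t <= 1 -> {for t, continuous g}.
  move=> /h0/nu0 ht0.
  exact (contZ (contM (cL t) (@contV _ _ (fun t => nu (h t)) t (lt0r_neq0 ht0) (cnh t))) (ch t)).
have snu w : rho < dot w w -> Num.sqrt rho < nu w.
  by move=> H; rewrite ltr_sqrt// (lt_trans rho0).
exists (g @` `[0, 1]%classic); split.
- apply: connected_continuous_connected; first exact: segment_connected.
  apply: continuous_in_subspaceT => t; rewrite inE /= in_itv /=; exact: cg.
- move=> y [t]; rewrite /= in_itv /= => t01 <-; split.
    by rewrite /g /h dotZl dotDl !dotZl ux vx !mulr0 addr0 mulr0.
  have ht0 := nu0 _ (h0 t t01); have /andP[t0 t1] := t01.
  have -> : dot (g t) (g t) = L t ^+ 2.
    by rewrite /g dotZl dotZr -nusq -/(h t); field; exact: lt0r_neq0.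
  have Lt : Num.sqrt rho < L t.
    have sr : 0 <= Num.sqrt rho by exact: sqrtr_ge0.
    have := snu _ uu; have := snu _ vv; rewrite /L; move: (Num.sqrt rho) (nu u) (nu v) => a b c.
    move=> ac ab; have am : a < Num.min b c by rewrite lt_min ab ac.
    apply: (lt_le_trans am); set m := Num.min b c.
    have mb : (1 - t) * m <= (1 - t) * b by rewrite ler_wpM2l ?subr_ge0// ge_min lexx.
    have mc : t * m <= t * c by rewrite ler_wpM2l// ge_min lexx orbT.
    by lra.
  rewrite -[rho]sqr_sqrtr ?ltW// ltr_pXn2r// ?nnegrE ?sqrtr_ge0//.
  exact: le_trans (sqrtr_ge0 _) (ltW Lt).
- exists 0; rewrite /= ?in_itv /= ?lexx ?ler01//.
  have hu : h 0 = u by rewrite /h subr0 scale1r scale0r addr0.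
  rewrite /g hu /L subr0 mul1r mul0r addr0 divff ?scale1r// lt0r_neq0// nu0//.
  by rewrite -hu; apply: h0; rewrite lexx ler01.
- exists 1; rewrite /= ?in_itv /= ?lexx ?ler01//.
  have hv : h 1 = v by rewrite /h subrr scale0r add0r scale1r.
  rewrite /g hv /L subrr mul0r add0r mul1r divff ?scale1r// lt0r_neq0// nu0//.
  by rewrite -hv; apply: h0; rewrite lexx ler01.
Qed.

(** If the segment from u to v meets 0, then v is a multiple of u, and a detour through a far vector
    c orthogonal to both avoids 0. *)
Lemma exterior_connected rho u v : 0 < rho -> exterior rho u -> exterior rho v ->
  exists G, [/\ connected G, G `<=` exterior rho, G u & G v].
Proof.
move=> rho0 eu ev.
have [H|] := pselect (forall t, 0 <= t <= 1 -> (1 - t) *: u + t *: v != 0).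
  exact: exterior_segment.
move=> /existsNP[s /not_implyP[/andP[s0 s1] /negP]]; rewrite negbK => /eqP huv.
have [c [cx cu cc]] := exists_orth u rho0.
have [ux uu] := eu; have [vx vv] := ev.
have un0 : u != 0 by rewrite -dot_gt0 (lt_trans rho0).
have vn0 : v != 0 by rewrite -dot_gt0 (lt_trans rho0).
have cn0 : c != 0 by rewrite -dot_gt0 (lt_trans rho0).
have sn0 : s != 0.
  apply: contraNneq un0 => s00; move: huv; rewrite s00 subr0 scale1r scale0r addr0.
  by move->.
have cv : dot c v = 0.
  have := congr1 (dot c) huv; rewrite dotDr !dotZr cu mulr0 add0r dot0r => /eqP.
  by rewrite mulf_eq0 (negbTE sn0) => /eqP.
have noz a b t : dot c a = 0 -> a != 0 -> b = c -> (1 - t) *: a + t *: b != 0.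
  move=> ca an0 ->; apply: contra_neq an0 => E.
  have := congr1 (dot c) E; rewrite dotDr !dotZr ca mulr0 add0r dot0r => /eqP.
  rewrite mulf_eq0 dot_eq0 (negbTE cn0) orbF => /eqP t0.
  by move: E; rewrite t0 subr0 scale1r scale0r addr0.
have [G1 [G1c G1e G1u G1k]] := @exterior_segment rho u c rho0 eu (conj cx cc)
  (fun t _ => noz u c t cu un0 erefl).
have [G2 [G2c G2e G2v G2k]] := @exterior_segment rho v c rho0 ev (conj cx cc)
  (fun t _ => noz v c t cv vn0 erefl).
exists (G1 `|` G2); split; [|by move=> z []; [exact: G1e|exact: G2e]|by left|by right].
by apply: connectedU => //; exists c.
Qed.

End Stereographic.

Lemma ball_segment (R : realType) (T : normedModType R) (x u v : T) e (t : R) :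
  `|x - u| < e -> `|x - v| < e -> 0 <= t <= 1 -> `|x - (u + t *: (v - u))| < e.
Proof.
move=> uC vC /andP[t0 t1'].
have -> : x - (u + t *: (v - u)) = (1 - t) *: (x - u) + t *: (x - v).
  rewrite scalerBl scale1r !scalerBr opprD opprB addrA opprB -[RHS]addrA.
  by congr (_ + _); rewrite addrA subrK.
apply: le_lt_trans (ler_normD _ _) _; rewrite !normrZ !ger0_norm ?subr_ge0//.
have [->|t0'] := eqVneq t 0; first by rewrite subr0 mul1r mul0r addr0.
apply: (@lt_le_trans _ _ ((1 - t) * e + t * e)); last by rewrite -mulrDl subrK mul1r.
apply: ler_ltD; first by rewrite ler_wpM2l ?subr_ge0// ltW.
by rewrite ltr_pM2l// lt_def t0'.
Qed.

Section SphereCover.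
Variables (R : realType) (n : nat) (M : topologicalType).
Variables (X : M -> 'rV[R]_n.+1) (r : R).
Hypotheses (hausM : hausdorff_space M) (compactM : compact [set: M]).
Hypotheses (connectedM : connected [set: M]) (cX : continuous X).
Hypotheses (r0 : 0 < r) (Xr : forall m, sphere r (X m)).
Hypothesis local_sections : forall m, exists (U : set M) (B : set 'rV[R]_n.+1)
    (s : 'rV[R]_n.+1 -> M),
  [/\ open U, U m, open B, forall y, B y -> {for y, continuous s} &
      (forall a, U a -> B (X a) /\ s (X a) = a) /\
      (forall y, B y -> sphere r y -> U (s y) /\ X (s y) = y)].

Hypothesis n2 : (2 <= n)%N.

Lemma connectedT_rV : connected [set: 'rV[R]_n.+1].
Proof.
have -> : [set: 'rV[R]_n.+1] =
    \bigcup_(b in [set: 'rV[R]_n.+1]) [set 0 + t *: b | t in `[0, 1 : R]].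
  apply/seteqP; split=> // b _; exists b => //; exists 1 => /=.
    by rewrite in_itv /= ler01 lexx.
  by rewrite scale1r add0r.
apply: bigcup_connected; last by move=> b _; exact: connected_line.
exists 0 => b _; exists 0 => /=; first by rewrite in_itv /= ler01 lexx.
by rewrite scale0r addr0.
Qed.

(** E lifts the inverse stereographic projection centred at X p. The closure of its range A is shown
    to be open, hence all of M; away from the fibre over the pole, A is a neighbourhood of every
    point of its closure. *)
Lemma stereo_cover p : exists E : 'rV[R]_n.+1 -> M,
  [/\ forall w, X (E w) = stereo_inv r (X p) w, E 0 = p,
      forall w w', stereo_inv r (X p) w = stereo_inv r (X p) w' -> E w = E w' &
      forall m, X m + X p != 0 -> exists w, E w = m].
Proof.
pose x0 := X p; have dx0 : dot x0 x0 = r ^+ 2 by exact: Xr.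
pose f := stereo_inv r x0; pose inv := inversion r x0.
have cf : continuous f by exact: cont_stereo_inv.
have fS w : sphere r (f w) by exact: stereo_inv_sphere.
have f0 : f 0 = X p by exact: stereo_inv0.
have [E [cE XE E0]] := lift_exists hausM compactM cX local_sections cf fS f0.
(* Both sides lift the same map and agree at 0. So E depends only on the hyperplane component, on
   which [stereo_inv] is injective. *)
have Eproj w : E w = E (orth_proj r x0 w).
  have fproj z : f (orth_proj r x0 z) = f z.
    by rewrite /f /stereo_inv [in LHS]orth_projK// orth_proj_orth.
  apply: (@unique_lift _ _ _ _ _ hausM local_sections _ [set: 'rV[R]_n.+1] E
    (E \o orth_proj r x0) 0) => //.
  - exact: connectedT_rV.
  - by move=> z _; exact: cE.
  - by move=> z _; exact: (cont_comp (@cont_orth_proj _ _ r x0 z) (cE _)).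
  - by move=> z _ /=; rewrite !XE fproj.
  - by rewrite /= orth_projK// dot0l.
have Einv w w' : f w = f w' -> E w = E w'.
  move=> ff; rewrite Eproj [RHS]Eproj -(inversion_stereo_inv r0 dx0 w).
  by rewrite -(inversion_stereo_inv r0 dx0 w') -/(f w) -/(f w') ff.
exists E; split => //.
have Eeq a : (exists w, E w = a) -> E (inv (X a)) = a.
  move=> [w <-]; apply: Einv; rewrite XE /f /inv inversion_stereo_inv//.
  by rewrite /stereo_inv [in LHS]orth_projK// orth_proj_orth.
have fne a : (exists w, E w = a) -> X a + x0 != 0.
  by move=> [w <-]; rewrite XE; exact: stereo_inv_neq.
pose A := [set a | exists w, E w = a].
(* Take a in A near m. E and s o f agree at the inversion of X a, hence on the whole convex ball C;
   nearby points of M are values of s there. *)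
have regular m : closure A m -> X m + x0 != 0 -> nbhs m A.
  move=> clm mx; have [U [B [s [oU Um oB cs [sX Xs]]]]] := local_sections m.
  pose w0 := inv (X m).
  have fw0 : f w0 = X m by exact: stereo_invK.
  have : nbhs w0 (f @^-1` B).
    by apply: cf; rewrite fw0; apply: open_nbhs_nbhs; split=> //; have [] := sX m Um.
  move=> /nbhs_ballP[e /= e0 He]; pose C := ball w0 e.
  have N1 : \forall a \near m, U a by exact: open_nbhs_nbhs.
  have N2 : \forall a \near m, C (inv (X a)).
    have ci := cont_comp (@cX m) (@cont_inversion R n r x0 (X m) mx).
    by apply: ci; exact: nbhsx_ballx.
  have N3 : \forall a \near m, X a + x0 != 0.
    have cn := cont_dot (contD (@cX m) (@contC _ _ _ x0 m)) (contD (@cX m) (@contC _ _ _ x0 m)).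
    have : 0 < dot (X m + x0) (X m + x0) by rewrite dot_gt0.
    by move=> /(near_gt cn); apply: filterS => a; rewrite dot_gt0.
  have [a [Aa [Ua Ca]]] := clm _ (filterI N1 N2).
  have EC w : C w -> E w = s (f w).
    move=> Cw; pose w1 := inv (X a).
    pose G := [set w1 + t *: (w - w1) | t in `[0, 1 : R]].
    have GC z : G z -> C z.
      move=> [t /=]; rewrite in_itv /= => t01 <-.
      rewrite /C -ball_normE /=.
      move: Ca Cw; rewrite /C -!ball_normE /= => h1 h2.
      exact: ball_segment.
    apply: (@unique_lift _ _ _ _ _ hausM local_sections _ G E (s \o f) w1).
    - exact: connected_line.
    - by move=> z _; exact: cE.
    - by move=> z /GC/He Bz; exact: (cont_comp (cf z) (cs _ Bz)).
    - by move=> z /GC/He Bz; rewrite XE /=; have [_ ->] := Xs _ Bz (fS z).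
    - by exists 0 => /=; rewrite ?in_itv /= ?lexx ?ler01// scale0r addr0.
    - rewrite /w1 Eeq// /= /f /inv stereo_invK//; last exact: fne.
      by have [_ ->] := sX _ Ua.
    - by exists 1 => /=; rewrite ?in_itv /= ?lexx ?ler01// scale1r addrC subrK.
  apply: filterS3 N1 N2 N3 => b Ub Cb xb; exists (inv (X b)).
  rewrite EC// /f stereo_invK//.
  by have [_ ->] := sX _ Ub.
(* Here the ball is replaced by an exterior region of the hyperplane, connected because n >= 2. *)
have pole m : closure A m -> X m + x0 = 0 -> \forall b \near m, X b + x0 != 0 -> A b.
  move=> clm mx; have Xm : X m = - x0 by apply/eqP; rewrite -addr_eq0 mx.
  have [U [B [s [oU Um oB cs [sX Xs]]]]] := local_sections m.
  have nB : nbhs (- x0) B.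
    by rewrite -Xm; apply: open_nbhs_nbhs; split=> //; have [] := sX m Um.
  have [rho rho0 Hrho] := stereo_inv_near_pole r0 dx0 nB.
  have N1 : \forall a \near m, U a by exact: open_nbhs_nbhs.
  have N2 : \forall a \near m, X a + x0 != 0 -> exterior x0 rho (inv (X a)).
    have : \forall a \near m, sphere r (X a) -> X a + x0 != 0 ->
        rho < dot (inv (X a)) (inv (X a)).
      have H : \forall y \near X m, sphere r y -> y + x0 != 0 ->
          rho < dot (inv y) (inv y) by rewrite Xm; exact: inversion_near_pole.
      exact (@cX m _ H).
    by apply: filterS => a H ax; split; [exact: inversion_orth|exact: H].
  have [a [Aa [Ua Ca]]] := clm _ (filterI N1 N2).
  have ea := Ca (fne a Aa).
  have EC w : exterior x0 rho w -> E w = s (f w).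
    move=> ew; have [G [cG Ge Ga Gw]] := exterior_connected n2 rho0 ea ew.
    have GB z : G z -> B (f z) by move=> /Ge[z0 zr]; exact: Hrho.
    apply: (@unique_lift _ _ _ _ _ hausM local_sections _ G E (s \o f) (inv (X a))) => //.
    - by move=> z _; exact: cE.
    - by move=> z /GB Bz; exact: (cont_comp (cf z) (cs _ Bz)).
    - by move=> z /GB Bz; rewrite XE /=; have [_ ->] := Xs _ Bz (fS z).
    - rewrite Eeq// /= /f /inv stereo_invK//; last exact: fne.
      by have [_ ->] := sX _ Ua.
  apply: filterS2 N1 N2 => b Ub Cb xb; exists (inv (X b)).
  rewrite EC; last exact: Cb.
  by rewrite /f stereo_invK//; have [_ ->] := sX _ Ub.
(* Over the pole X is injective near m, so m itself is the only nearby point that [pole] leaves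
   out. *)
have clT : closure A = [set: M].
  apply: connectedM.
  - by exists p; apply: subset_closure; exists 0.
  - exists (closure A); last by rewrite setTI.
    rewrite openE => m clm; rewrite /interior.
    have [mx|mx] := eqVneq (X m + x0) 0; last first.
      by apply: filterS (regular m clm mx); exact: subset_closure.
    have [U [B [s [oU Um oB cs [sX Xs]]]]] := local_sections m.
    have N1 : \forall a \near m, U a by exact: open_nbhs_nbhs.
    apply: filterS2 N1 (pole m clm mx) => b Ub Hb.
    have [bx|bx] := eqVneq (X b + x0) 0; last by apply: subset_closure; exact: Hb.
    have -> : b = m.
      have [_ <-] := sX _ Ub; have [_ <-] := sX _ Um.
      by congr s; apply: (addIr x0); rewrite bx mx.
    exact: clm.
  - by exists (closure A); [exact: closed_closure|rewrite setTI].
move=> m mx; have clm : closure A m by rewrite clT.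
exact: (nbhs_singleton (regular m clm mx)).
Qed.

(** Project from the antipode of X a: then b lies in the range of the lift based at a, over the same
    point of the hyperplane as a. *)
Lemma sphere_cover_injective a b : X a = X b -> a = b.
Proof.
move=> ab; have [E [XE E0 Einv cover]] := stereo_cover a.
have dx0 : dot (X a) (X a) = r ^+ 2 by exact: Xr.
have [|w Ew] := cover b.
  have r2 : 0 < r ^+ 2 by exact: exprn_gt0.
  by rewrite -ab -dot_gt0 dotDl !dotDr dx0; lra.
by rewrite -E0 -Ew; apply: Einv; rewrite -!XE E0 Ew.
Qed.

Lemma sphere_cover_surjective (p : M) y : sphere r y -> exists m, X m = y.
Proof.
move=> Sy; have [E [XE E0 _ _]] := stereo_cover p.
have dx m : dot (X m) (X m) = r ^+ 2 by exact: Xr.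
have [yp|yp] := eqVneq (y + X p) 0; last first.
  by exists (E (inversion r (X p) y)); rewrite XE stereo_invK.
(* The antipode of X p is missed by the lift based at p. Rebasing at E c with c nonzero moves the
   missed point. *)
have [c [cx _ cc]] := exists_orth (X p) n2 0 ltr01.
have c0 : c != 0 by rewrite -dot_gt0 (lt_trans ltr01).
have [E' [XE' _ _ _]] := stereo_cover (E c).
have yc : y + X (E c) != 0.
  apply: contra_neq c0 => yc.
  have E1 : X (E c) = X p by apply: (addrI y); rewrite yc yp.
  rewrite -(orth_projK r cx) -(inversion_stereo_inv r0 (dx p)) -XE E1.
  rewrite -[X in inversion _ _ X](stereo_inv0 r0 (dx p)) (inversion_stereo_inv r0 (dx p)).
  by rewrite orth_projK// dot0l.
by exists (E' (inversion r (X (E c)) y)); rewrite XE' stereo_invK.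
Qed.

End SphereCover.

(** * Isometries through a local isometry of spheres *)

(** A continuous injection of a compact space into a Hausdorff space is closed, so the complement of
    the image of the complement of U serves as W. *)
Lemma inverse_near (R : realType) (Y : normedModType R) (M : topologicalType)
    (F : M -> Y) (U : set M) m :
  compact [set: M] -> continuous F -> injective F -> open U -> U m ->
  exists W, [/\ open W, W (F m) & forall m', W (F m') -> U m'].
Proof.
move=> compactM cF injF oU Um; exists (~` (F @` (~` U))); split.
- apply: closed_openC; apply: compact_closed; first exact: norm_hausdorff.
  apply: continuous_compact; first exact: continuous_subspaceT.
  by apply: closed_compactT => //; exact: open_closedC.
- by move=> [m' /= Um' /injF mm']; apply: Um'; rewrite mm'.
- by move=> m' nW; apply: contrapT => Um'; apply: nW; exists m'.
Qed.

Lemma manifold_sections (R : realType) n (M : manifold R n) (X : M -> 'rV[R]_n.+1) r :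
  immersion X -> 0 < r -> (forall m, sphere r (X m)) ->
  forall m, exists (U : set M) (B : set 'rV[R]_n.+1) (s : 'rV[R]_n.+1 -> M),
  [/\ open U, U m, open B, forall y, B y -> {for y, continuous s} &
      (forall a, U a -> B (X a) /\ s (X a) = a) /\
      (forall y, B y -> sphere r y -> U (s y) /\ X (s y) = y)].
Proof.
move=> imX r0 Xr m; have [c ac cm] := atlas_cover m.
have [U [B [g [[oU Um Uc] [oB sg gX Xg]]]]] := local_section imX r0 Xr ac cm.
exists U, B, (chart_inv c \o g); split=> //.
- move=> y By; have [gy _] := Xg y By.
  exact (cont_comp (Ck_cont (sg 0%N) By) (chart_inv_cont_at gy)).
- split=> [a Ua|y By Sy]; last by have [_] := Xg y By; exact.
  by have [? E] := gX a Ua; split=> //=; rewrite E chart_mapK//; exact: Uc.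
Qed.

Section SphereFactor.
Variables (R : realType) (n : nat) (M : manifold R n).
Variables (X F : M -> 'rV[R]_n.+1) (Q : 'rV[R]_n.+1 -> 'rV[R]_n.+1) (r r' : R).
Variable p0 : M.
Hypotheses (imX : immersion X) (compactM : compact [set: M]).
Hypotheses (r0 : 0 < r) (Xr : forall m, sphere r (X m)).
Hypotheses (cF : continuous F) (injF : injective F).
Hypotheses (Fr' : forall m, sphere r' (F m)) (surjF : forall y, sphere r' y -> exists m, F m = y).
Hypotheses (smQ : smooth setT Q) (QF : forall m, Q (F m) = X m).
Hypothesis isoQ : forall z a b, sphere r' z -> dot ('D_a Q z) ('D_b Q z) = dot a b.

(** [isoQ] makes the derivative of Q injective, so Q has smooth local inverses g, and the continuous
    F is locally g o X. *)
Lemma smooth_factor : smooth_map F.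
Proof.
move=> c ac; apply/smooth_onE => k; apply: Ck_local => x cx.
have [cix _] := chart_invP cx.
have cFx : {for x, continuous (F \o chart_inv c)}.
  exact (cont_comp (chart_inv_cont_at cx) (@cF _)).
have injQ v : 'D_v Q (F (chart_inv c x)) = 0 -> v = 0.
  by move=> Qv; apply/eqP; rewrite -dot_eq0 -(isoQ v v (Fr' (chart_inv c x))) Qv dot0l.
have [V [W [g [[oV Vx _] [oW fV _ sg]]]]] :=
  inverse_function openT smQ I injQ.
have N1 : \forall y \near x, chart_cod c y by exact (open_nbhs_nbhs (conj (@open_cod _ _ _ c) cx)).
have N2 : \forall y \near x, V (F (chart_inv c y)).
  by apply: cFx; exact: open_nbhs_nbhs.
pose A := [set y | chart_cod c y /\ V (F (chart_inv c y))]°.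
have AP y : A y -> chart_cod c y /\ V (F (chart_inv c y)) by move=> /nbhs_singleton.
exists A; first by rewrite /A /interior; exact: filterI.
have oA : open A by exact: open_interior.
apply: (@Ck_eq _ _ _ _ _ (g \o (X \o chart_inv c))) => //.
  by move=> y /AP[_ Vy] /=; rewrite -QF; have [_ ->] := fV _ Vy.
have sX : smooth (chart_cod c) (X \o chart_inv c) by exact: smooth_mapP imX.1 ac.
apply: (@Ck_comp _ _ _ _ _ A W) => //.
  by move=> y /AP[_ Vy] /=; rewrite -QF; have [] := fV _ Vy.
by apply: Ck_sub (sX k) => y /AP[].
Qed.

Lemma induced_metric_factor c p : atlas c -> chart_dom c p -> forall u v,
  induced_metric F c p u v = induced_metric X c p u v.
Proof.
move=> ac cp u v.
have dX w : diff_at c X p w = 'D_(diff_at c F p w) Q (F p).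
  have cx : chart_cod c (chart_map c p) by exact: chart_codP.
  have df : differentiable (F \o chart_inv c) (chart_map c p).
    exact: (Ck_diff (@open_cod _ _ _ c) (smooth_mapP smooth_factor ac 1) cx).
  have dQ : differentiable Q (F p) by exact: (Ck_diff openT (smQ 1) I).
  have E : chart_inv c (chart_map c p) = p by exact: chart_mapK.
  have dQ' : differentiable Q ((F \o chart_inv c) (chart_map c p)) by rewrite /= E.
  have [_] := is_derive_comp w df dQ'; rewrite /= E => <-.
  by rewrite /diff_at; have -> : Q \o (F \o chart_inv c) = X \o chart_inv c by apply/funext => y; exact: QF.
by rewrite /induced_metric !dX isoQ.
Qed.

Lemma isometric_of_factor : isometric_to_sphere X r'.
Proof.
have [G FG] : exists G, forall y, sphere r' y -> F (G y) = y.
  have H y : exists m, sphere r' y -> F m = y.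
    have [Sy|nSy] := pselect (sphere r' y); last by exists p0.
    by have [m <-] := surjF Sy; exists m.
  by have [G GP] := choice H; exists G => y; exact: GP.
exists F, G; split.
- split; first exact: smooth_factor.
  move=> y c Sy ac cy.
  have [U [B [g [[oU Uy Uc] [oB sg gX Xg]]]]] := local_section imX r0 Xr ac cy.
  have [W [oW Wy WU]] := inverse_near compactM cF injF oU Uy.
  rewrite FG// in Wy.
  have cQ : continuous Q by move=> z; exact: (Ck_cont (smQ 0%N) I).
  have Ey : Q y = X (G y) by rewrite -QF FG.
  (* g o Q extends the chart expression of G to an open set of the ambient space, because X (G z) =
     Q z on the sphere; W keeps G z where g inverts X. *)
  pose A := W `&` Q @^-1` B.
  have oA : open A by apply: openI => //; apply: open_comp => // z _; exact: cQ.
  exists A, (g \o Q); split=> //.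
  + by split=> //; rewrite /preimage /= Ey; have [] := gX _ Uy.
  + apply/smooth_onE => k; apply: (@Ck_comp _ _ _ _ _ A B) => //.
      by move=> z [].
    exact: (Ck_sub (@subsetT _ _) (smQ k)).
  + move=> z [Wz _] Sz; have Uz : U (G z) by apply: WU; rewrite FG.
    split; first exact: Uc.
    by rewrite -(FG z Sz) /= QF (FG z Sz); have [_ ->] := gX _ Uz.
- exact: Fr'.
- by move=> p; apply: injF; rewrite FG.
- exact: FG.
- by move=> c p ac cp u v; exact: induced_metric_factor.
Qed.

End SphereFactor.

(** * Coverings of the circle *)

Section Complex.
Variable R : realType.
Implicit Types (u v w : 'rV[R]_2) (a b s t : R).

Definition cpx a b : 'rV[R]_2 := \row_(i < 2) if i == 0 then a else b.

Lemma cpx_re a b : cpx a b 0 0 = a. Proof. by rewrite mxE. Qed.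

Lemma cpx_im a b : cpx a b 0 1 = b. Proof. by rewrite mxE. Qed.

Lemma row2P u v : u 0 0 = v 0 0 -> u 0 1 = v 0 1 -> u = v.
Proof.
move=> h0 h1; apply/rowP => i; have [->//|i0] := eqVneq i 0.
by have -> : i = 1 by apply/val_inj; case: i i0 => [[|[|]]].
Qed.

Lemma dot2E u v : dot u v = u 0 0 * v 0 0 + u 0 1 * v 0 1.
Proof.
rewrite dotE big_ord_recl big_ord1; congr (_ + u _ _ * v _ _); exact/val_inj.
Qed.

Definition cmul u v := cpx (u 0 0 * v 0 0 - u 0 1 * v 0 1) (u 0 0 * v 0 1 + u 0 1 * v 0 0).

Definition cis t := cpx (cos t) (sin t).

Lemma cmulA u v w : cmul (cmul u v) w = cmul u (cmul v w).
Proof. by apply: row2P; rewrite !(cpx_re, cpx_im); ring. Qed.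

Lemma cmulAC u v w : cmul (cmul u v) w = cmul (cmul u w) v.
Proof. by apply: row2P; rewrite !(cpx_re, cpx_im); ring. Qed.

Lemma cmulBr u v w : cmul u (v - w) = cmul u v - cmul u w.
Proof. by apply: row2P; rewrite !mxE /=; ring. Qed.

Lemma cmulZl a u v : cmul (a *: u) v = a *: cmul u v.
Proof. by apply: row2P; rewrite !mxE /=; ring. Qed.

Lemma cmulZr a u v : cmul u (a *: v) = a *: cmul u v.
Proof. by apply: row2P; rewrite !mxE /=; ring. Qed.

Lemma dot_cmul u v w : dot (cmul u v) (cmul u w) = dot u u * dot v w.
Proof. by rewrite !dot2E !(cpx_re, cpx_im); ring. Qed.

Lemma cmulI u : 0 < dot u u -> injective (cmul u).
Proof.
move=> u0 v w vw; apply/eqP; rewrite -subr_eq0 -dot_eq0.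
have /eqP : dot (cmul u (v - w)) (cmul u (v - w)) = 0.
  by rewrite cmulBr vw subrr dot0l.
by rewrite dot_cmul mulf_eq0 (gt_eqF u0).
Qed.

Lemma cisD s t : cis (s + t) = cmul (cis s) (cis t).
Proof.
apply: row2P; rewrite !(cpx_re, cpx_im) ?cosD ?sinD//.
by rewrite addrC.
Qed.

Lemma cmul_cis0 u : cmul u (cis 0) = u.
Proof. by apply: row2P; rewrite !(cpx_re, cpx_im) cos0 sin0; ring. Qed.

Lemma dot_cis t : dot (cis t) (cis t) = 1.
Proof. by rewrite dot2E !(cpx_re, cpx_im) -!expr2 cos2Dsin2. Qed.

Lemma cis_periodic t (j : int) : cis (t + j%:~R * (pi *+ 2)) = cis t.
Proof.
have H (n : nat) s : cis (s + n%:R * (pi *+ 2)) = cis s.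
  rewrite mulr_natl /cis (periodicn (@cosD2pi R)) (periodicn (@sinD2pi R)).
  by [].
case: j => n; first exact: H.
by rewrite NegzE mulrNz mulNr -[in RHS](subrK (n.+1%:R * (pi *+ 2)) t) H.
Qed.

(** Reduce t to s in [0, 2 pi[. The half-angle formula gives sin (s / 2) = 0, which is impossible
    for 0 < s / 2 < pi. *)
Lemma cos_eq1 t : cos t = 1 -> exists j : int, t = j%:~R * (pi *+ 2).
Proof.
move=> ct; have p0 : 0 < pi :> R := pi_gt0 R.
have tau0 : 0 < pi *+ 2 :> R by rewrite mulrn_wgt0.
pose j := Num.floor (t / (pi *+ 2)); exists j.
have /andP[j0 j1] := floor_itv (t / (pi *+ 2)).
pose s := t - j%:~R * (pi *+ 2).
have s0 : 0 <= s by rewrite subr_ge0 -ler_pdivlMr.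
have s1 : s < pi *+ 2.
  by rewrite ltrBlDl -[X in _ + X]mul1r -mulrDl -ltr_pdivrMr// -(intrD _ j 1).
have cs : cos s = 1.
  have /(congr1 (fun u => u 0 0)) : cis s = cis t.
    by rewrite -(cis_periodic s j) /s subrK.
  by rewrite !cpx_re ct.
apply/eqP; rewrite -subr_eq0 -/s; move: s0; rewrite le_eqVlt eq_sym => /orP[//|s0].
have : 0 < sin (s / 2) by rewrite sin_gt0_pi// divr_gt0//= ltr_pdivrMr// -[2]/(2%:R) mulr_natr.
have := cos2Dsin2 (s / 2); have := cos_mulr2n (s / 2).
rewrite -(mulr_natr (s / 2)) divfK ?pnatr_eq0// cs => h1 h2 h3.
have : sin (s / 2) ^+ 2 = 0 by move: h1 h2; rewrite mulr2n; lra.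
by move/eqP; rewrite expf_eq0 /= (gt_eqF h3).
Qed.

Lemma cis_inj s t : cis s = cis t -> exists j : int, s = t + j%:~R * (pi *+ 2).
Proof.
move=> st; have [|j jE] := @cos_eq1 (s - t); last by exists j; rewrite -jE addrC subrK.
have := congr1 (fun u => u 0 0) st; have := congr1 (fun u => u 0 1) st.
by rewrite !(cpx_re, cpx_im) cosB => -> ->; rewrite -!expr2 cos2Dsin2.
Qed.

Lemma continuous_cis : continuous cis.
Proof.
move=> t; apply/cont_coordP => j; have [->|j0] := eqVneq j 0.
  have -> : (fun y => cis y 0 0) = cos by apply/funext => y; exact: cpx_re.
  exact: continuous_cos.
have -> : j = 1 by apply/val_inj; case: j j0 => [[|[|]]].
have -> : (fun y => cis y 0 1) = sin by apply/funext => y; exact: cpx_im.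
exact: continuous_sin.
Qed.

Lemma cont_cmul (T : topologicalType) (f g : T -> 'rV[R]_2) z :
  {for z, continuous f} -> {for z, continuous g} ->
  {for z, continuous (fun y => cmul (f y) (g y))}.
Proof.
move=> /cont_coordP cf /cont_coordP cg; apply/cont_coordP => j; have [->|j0] := eqVneq j 0.
  have -> : (fun y => cmul (f y) (g y) 0 0) =
      (fun y => f y 0 0 * g y 0 0 - f y 0 1 * g y 0 1).
    by apply/funext => y; exact: cpx_re.
  exact (contB (contM (cf 0) (cg 0)) (contM (cf 1) (cg 1))).
have -> : j = 1 by apply/val_inj; case: j j0 => [[|[|]]].
have -> : (fun y => cmul (f y) (g y) 0 1) =
    (fun y => f y 0 0 * g y 0 1 + f y 0 1 * g y 0 0).
  by apply/funext => y; exact: cpx_im.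
exact (contD (contM (cf 0) (cg 1)) (contM (cf 1) (cg 0))).
Qed.

(** [dot x y] and [wedge x y] are the real and imaginary parts of the conjugate of x times y. *)
Definition wedge (x y : 'rV[R]_2) := x 0 0 * y 0 1 - x 0 1 * y 0 0.

Section Rotation.
Variables (r : R) (x : 'rV[R]_2).
Hypotheses (r0 : 0 < r) (dx : dot x x = r ^+ 2).

Let r2 : r ^+ 2 != 0. Proof. exact/lt0r_neq0/exprn_gt0. Qed.

Lemma rotation_unique y t : cos t = dot x y / r ^+ 2 -> sin t = wedge x y / r ^+ 2 ->
  y = cmul x (cis t).
Proof.
move=> ct st; apply: (scalerI r2).
by apply: row2P; rewrite !mxE /= ct st -dx !dot2E /wedge; field; rewrite -dot2E dx.
Qed.

Lemma rotation_unit y : dot y y = r ^+ 2 ->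
  (dot x y / r ^+ 2) ^+ 2 + (wedge x y / r ^+ 2) ^+ 2 = 1.
Proof.
move=> dy; have : dot x y ^+ 2 + wedge x y ^+ 2 = r ^+ 2 * r ^+ 2.
  by rewrite -{1}dx -dy !dot2E /wedge; ring.
by move=> H; rewrite !exprMn -mulrDl H exprVn [r ^+ 2 ^+ 2]expr2 divff// mulf_neq0.
Qed.

Lemma rotation_exists y : dot y y = r ^+ 2 -> exists t, y = cmul x (cis t).
Proof.
move=> /rotation_unit; move: (rotation_unique (y := y)).
move: (dot x y / _) (wedge x y / _) => a b H ab1.
have a1 : -1 <= a <= 1.
  rewrite -ler_norml -(ler_pXn2r (n := 2)) ?nnegrE// expr1n -normrX ger0_norm ?sqr_ge0//.
  by rewrite -ab1 lerDl sqr_ge0.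
have ca : cos (acos a) = a by rewrite acosK// in_itv.
have sa : sin (acos a) = `|b| by rewrite sin_acos// -ab1 addrAC subrr add0r sqrtr_sqr.
have [b0|b0] := leP 0 b; first by exists (acos a); apply: H; rewrite ?sa ?ger0_norm.
by exists (- acos a); apply: H; rewrite ?cosN ?sinN// sa ltr0_norm// opprK.
Qed.

(** The angle from x to y is taken as an arcsine, which is continuous at 0; positivity of [dot x y]
    near x makes this the correct branch. *)
Lemma rotation_near (D : set R) : nbhs 0 D ->
  \forall y \near x, dot y y = r ^+ 2 -> exists2 t, D t & y = cmul x (cis t).
Proof.
move=> D0; have cid := @cvg_id _ (nbhs x).
have cc (j : 'I_2) : {for x, continuous (fun y : 'rV[R]_2 => y 0 j)} by move/cont_coordP: cid.
have N1 : \forall y \near x, 0 < dot x y.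
  apply: (near_gt (cont_dot (@contC _ _ _ x x) cid)).
  by rewrite dx exprn_gt0.
have cw : {for x, continuous (fun y => wedge x y / r ^+ 2)}.
  exact (contM (contB (contM (@contC _ _ _ (x 0 0) x) (cc 1)) (contM (@contC _ _ _ (x 0 1) x) (cc 0)))
    (@contC _ _ _ (r ^+ 2)^-1 x)).
have w0 : wedge x x / r ^+ 2 = 0 by rewrite /wedge mulrC [x 0 1 * _]mulrC subrr mulr0.
have as0 : asin 0 = 0 :> R.
  rewrite -[in LHS](sin0 R) sinK// in_itv /= oppr_le0 divr_ge0 ?pi_ge0//.
have ca : {for wedge x x / r ^+ 2, continuous (@asin R)}.
  by rewrite w0; apply: continuous_asin; rewrite ltrN10 ltr01.
have N2 : \forall y \near x, D (asin (wedge x y / r ^+ 2)).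
  by apply: (cont_comp cw ca); rewrite w0 as0.
apply: filterS2 N1 N2 => y xy Dy dy; exists (asin (wedge x y / r ^+ 2)) => //.
have := rotation_unit dy; have : 0 < dot x y / r ^+ 2 by rewrite divr_gt0// exprn_gt0.
move: (rotation_unique (y := y)).
move: (dot x y / _) (wedge x y / _) => a b H a0 ab1.
have b1 : -1 <= b <= 1.
  rewrite -ler_norml -(ler_pXn2r (n := 2)) ?nnegrE// expr1n -normrX ger0_norm ?sqr_ge0//.
  by rewrite -ab1 lerDr sqr_ge0.
apply: H; last by rewrite asinK// in_itv.
by rewrite cos_asin// -ab1 addrK sqrtr_sqr gtr0_norm.
Qed.

End Rotation.

Variables (x0 : 'rV[R]_2) (rho : R).

Fixpoint cpow j (z : 'rV[R]_2) : 'rV[R]_2 :=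
  if j is j'.+1 then cmul (cpow j' z) (rho^-1 *: z) else x0.

Lemma cpow_cis j t : rho != 0 -> cpow j (rho *: cis t) = cmul x0 (cis (j%:R * t)).
Proof.
move=> rn; elim: j => [|j IH] /=; first by rewrite mul0r cmul_cis0.
by rewrite IH scalerA mulVf// scale1r cmulA -cisD -natr1 mulrDl mul1r.
Qed.

Lemma dot_cpow j z : 0 < rho -> dot z z = rho ^+ 2 -> dot (cpow j z) (cpow j z) = dot x0 x0.
Proof.
move=> r0 dz; elim: j => //= j IH; rewrite dot_cmul IH dotZl dotZr dz.
by rewrite -[RHS]mulr1; congr (_ * _); field; rewrite gt_eqF.
Qed.

Lemma smooth_cmul (U : set 'rV[R]_2) (f g : 'rV[R]_2 -> 'rV[R]_2) : open U ->
  smooth U f -> smooth U g -> smooth U (fun z => cmul (f z) (g z)).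
Proof.
move=> oU sf sg k; apply/Ck_rowP => // j.
have cf i := Ck_coord i oU (sf k); have cg i := Ck_coord i oU (sg k).
have [->|j0] := eqVneq j 0.
  have -> : (fun y => cmul (f y) (g y) 0 0) =
      (fun y => f y 0 0 * g y 0 0 + - (f y 0 1 * g y 0 1)).
    by apply/funext => y; exact: cpx_re.
  exact (CkD oU (CkM oU (cf 0) (cg 0)) (CkN oU (CkM oU (cf 1) (cg 1)))).
have -> : j = 1 by apply/val_inj; case: j j0 => [[|[|]]].
have -> : (fun y => cmul (f y) (g y) 0 1) =
    (fun y => f y 0 0 * g y 0 1 + f y 0 1 * g y 0 0).
  by apply/funext => y; exact: cpx_im.
exact (CkD oU (CkM oU (cf 0) (cg 1)) (CkM oU (cf 1) (cg 0))).
Qed.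

Lemma smooth_cpow j : smooth setT (cpow j).
Proof.
elim: j => [|j IH] /=; first by move=> k; exact: Ck_cst.
apply: smooth_cmul => // [|k]; first exact: openT.
exact (Ck_linear k setT (GRing.scale rho^-1)).
Qed.

Lemma is_derive_cmul (f g : 'rV[R]_2 -> 'rV[R]_2) z v df dg :
  is_derive z v f df -> is_derive z v g dg ->
  is_derive z v (fun z => cmul (f z) (g z)) (cmul df (g z) + cmul (f z) dg).
Proof.
move=> /is_derive_rowP Df /is_derive_rowP Dg; apply/is_derive_rowP => j.
have [->|j0] := eqVneq j 0.
  have -> : (fun y => cmul (f y) (g y) 0 0) =
      (fun y => f y 0 0) * (fun y => g y 0 0) - (fun y => f y 0 1) * (fun y => g y 0 1).
    by apply/funext => y; exact: cpx_re.
  apply: is_derive_eq (is_deriveB (is_deriveM (Df 0) (Dg 0)) (is_deriveM (Df 1) (Dg 1))) _.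
  by rewrite !mxE /= /GRing.scale /=; ring.
have -> : j = 1 by apply/val_inj; case: j j0 => [[|[|]]].
have -> : (fun y => cmul (f y) (g y) 0 1) =
    (fun y => f y 0 0) * (fun y => g y 0 1) + (fun y => f y 0 1) * (fun y => g y 0 0).
  by apply/funext => y; exact: cpx_im.
apply: is_derive_eq (is_deriveD (is_deriveM (Df 0) (Dg 1)) (is_deriveM (Df 1) (Dg 0))) _.
by rewrite !mxE /= /GRing.scale /=; ring.
Qed.

Lemma is_derive_cpow j z v :
  is_derive z v (cpow j) ((j%:R / rho) *: cmul (cpow j.-1 z) v).
Proof.
elim: j => [|j IH] /=; first by rewrite mul0r scale0r; exact: is_derive_cst.
have DL : is_derive z v (fun z : 'rV[R]_2 => rho^-1 *: z) (rho^-1 *: v).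
  exact (is_derive_linear (GRing.scale rho^-1) z v).
apply: is_derive_eq (is_derive_cmul IH DL) _.
rewrite [cmul (cpow j z) _]cmulZr cmulZl; case: j IH => [|j] IH /=; first by rewrite !mul0r !scale0r add0r mul1r.
by rewrite (cmulAC _ v) -scalerDl -[in RHS]natr1 mulrDl mul1r.
Qed.

End Complex.

Section CircleCover.
Variables (R : realType) (M : topologicalType) (X : M -> 'rV[R]_2) (r : R).
Hypotheses (hausM : hausdorff_space M) (compactM : compact [set: M]).
Hypotheses (connectedM : connected [set: M]) (cX : continuous X).
Hypotheses (r0 : 0 < r) (Xr : forall m, sphere r (X m)).
Hypothesis local_sections : forall m, exists (U : set M) (B : set 'rV[R]_2)
    (s : 'rV[R]_2 -> M),
  [/\ open U, U m, open B, forall y, B y -> {for y, continuous s} &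
      (forall a, U a -> B (X a) /\ s (X a) = a) /\
      (forall y, B y -> sphere r y -> U (s y) /\ X (s y) = y)].

Let tau : R := pi *+ 2.

Let tau0 : 0 < tau. Proof. by rewrite /tau mulrn_wgt0// pi_gt0. Qed.

Variables (p : M) (E : R -> M).
Hypotheses (cE : continuous E) (XE : forall t, X (E t) = cmul (X p) (cis t)).

Let dX m : dot (X m) (X m) = r ^+ 2. Proof. exact: Xr. Qed.

Let X0 m : 0 < dot (X m) (X m). Proof. by rewrite dX exprn_gt0. Qed.

(** X o E has period 2 pi, so translating E by a - b gives another lift of the same map; the two
    agree at b, hence everywhere. *)
Lemma lift_translate a b : E a = E b ->
  (exists j : int, a - b = j%:~R * tau) /\ forall u, E (u + (a - b)) = E u.
Proof.
move=> ab; have [|j aE] := @cis_inj R a b.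
  by apply: (cmulI (X0 p)); rewrite -!XE ab.
have jE : a - b = j%:~R * tau by rewrite aE addrC addKr.
split; first by exists j.
move=> u; apply: (@unique_lift _ _ _ _ _ hausM local_sections _ [set: R]
  (fun u => E (u + (a - b))) E b) => //.
- by apply/connected_intervalP => x y _ _ z _.
- move=> z _; exact (cont_comp (contD (@cvg_id _ (nbhs z)) (@contC _ _ _ (a - b) z)) (@cE _)).
- by move=> z _; exact: cE.
- by move=> z _; rewrite !XE jE cis_periodic.
- by rewrite addrC subrK.
Qed.

(** Near E t the value X a is X (E t) rotated by a small angle h, and local injectivity of X
    identifies a with E (t + h). *)
Lemma lift_open t (D : set R) : nbhs t D -> nbhs (E t) (E @` D).
Proof.
move=> Dt; have [U [B [s [oU Um oB cs [sX Xs]]]]] := local_sections (E t).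
have ca : {for 0, continuous (fun h : R => t + h)}.
  exact (contD (@contC _ _ _ t 0) (@cvg_id _ (nbhs 0))).
have D0 : \forall h \near (0 : R), D (t + h) by apply: ca; rewrite addr0.
have U0 : \forall h \near (0 : R), U (E (t + h)).
  by apply: (cont_comp ca (@cE _)); rewrite addr0; exact: open_nbhs_nbhs.
have DU : nbhs (0 : R) [set h | D (t + h) /\ U (E (t + h))] by exact: filterI.
have N1 : \forall a \near E t, dot (X a) (X a) = r ^+ 2 ->
    exists2 h, D (t + h) /\ U (E (t + h)) & X a = cmul (X (E t)) (cis h).
  exact (@cX (E t) _ (rotation_near r0 (dX (E t)) DU)).
have N2 : \forall a \near E t, U a by exact: open_nbhs_nbhs.
apply: filterS2 N1 N2 => a H Ua.
have [h [Dh Uh] Xa] := H (dX a); exists (t + h) => //.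
have [_ <-] := sX _ Ua; have [_ <-] := sX _ Uh.
by rewrite Xa !XE cmulA cisD.
Qed.

(** All the points E (j tau) lie in one fibre of X. They cluster by compactness, and local
    injectivity makes two of them equal. *)
Lemma lift_return : exists k, (0 < k)%N /\ E (k%:R * tau) = E 0.
Proof.
pose G : set_system M := (fun j : nat => E (j%:R * tau)) @ \oo.
have [m [_ clm]] : [set: M] `&` cluster G !=set0 by apply: compactM; exact: filterT.
have [U [B [s [oU Um oB cs [sX Xs]]]]] := local_sections m.
have pick N : exists j, (N <= j)%N /\ U (E (j%:R * tau)).
  have GN : G [set E (j%:R * tau) | j in [set j | (N <= j)%N]].
    by apply: filterS (nbhs_infty_ge N) => j Nj; exists j.
  by have [_ [[j Nj <-] Uj]] := clm _ _ GN (open_nbhs_nbhs (conj oU Um)); exists j.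
have [i [_ Ui]] := pick 0%N; have [j [ij Uj]] := pick i.+1.
have Xj (l : nat) : X (E (l%:R * tau)) = X p.
  by rewrite XE -[l%:R * tau]add0r (cis_periodic 0 l) cmul_cis0.
have Eij : E (j%:R * tau) = E (i%:R * tau).
  by have [_ <-] := sX _ Ui; have [_ <-] := sX _ Uj; rewrite !Xj.
exists (j - i)%N; split; first by rewrite subn_gt0.
have [_ H] := lift_translate Eij.
by rewrite natrB ?(ltnW ij)// mulrBl -[X in E X]add0r H.
Qed.

Lemma lift_period : exists k : nat, (0 < k)%N /\
  forall a b, E a = E b <-> exists q : int, a = b + q%:~R * (k%:R * tau).
Proof.
have exP : exists k, (fun k => `[< (0 < k)%N /\ E (k%:R * tau) = E 0 >]) k.
  by have [k H] := lift_return; exists k; exact/asboolP.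
case: (ex_minnP exP) => k /asboolP[k0 Ek] mink; exists k; split=> //.
have Eper u (q : int) : E (u + q%:~R * (k%:R * tau)) = E u.
  have Hn (j : nat) v : E (v + j%:R * (k%:R * tau)) = E v.
    elim: j v => [|j IH] v; first by rewrite mul0r addr0.
    rewrite -natr1 mulrDl mul1r addrA; have [_ H] := lift_translate Ek.
    by have := H (v + j%:R * (k%:R * tau)); rewrite subr0 IH.
  case: q => j; first exact: Hn.
  by rewrite NegzE mulrNz mulNr -[in RHS](subrK (j.+1%:R * (k%:R * tau)) u) Hn.
move=> a b; split; last by move=> [q ->].
move=> ab; have [[j jE] H] := lift_translate ab.
have k0' : (k : int) != 0 by rewrite -lt0n in k0 *; case: k k0 {Ek mink Eper}.
exists (j %/ k)%Z; apply/eqP; rewrite addrC -subr_eq jE.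
(* Dividing j by the least return index k, the remainder also returns to E 0, so by minimality it is
   0. *)
have Emod : E ((j %% k)%Z%:~R * tau) = E 0.
  have := H 0; rewrite add0r jE {1}(divz_eq j k) intrD intrM mulrDl addrC -mulrA Eper.
  by move=> ->.
have : (0 <= j %% k)%Z by exact: modz_ge0.
have : (j %% k < k)%Z by exact: ltz_pmod.
case jk : (j %% k)%Z Emod => [l|//] El lk _.
have l0 : l = 0%N.
  apply/eqP; rewrite -leqn0 leqNgt; apply/negP => l0.
  have : (k <= l)%N by apply: mink; exact/asboolP.
  by rewrite leqNgt -ltz_nat lk.
by rewrite {1}(divz_eq j k) jk l0 addr0 intrM mulrA.
Qed.

(** The range is open, and it is closed as the image of one compact period. *)
Lemma lift_surjective m : exists t, E t = m.
Proof.
have [k [k0 Ek]] := lift_period.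
have kt : 0 < k%:R * tau by rewrite mulr_gt0// ltr0n.
have rangeE : range E = E @` `[0, k%:R * tau].
  apply/seteqP; split=> [_ [t _ <-]|_ [t _ <-]]; last by exists t.
  pose q := Num.floor (t / (k%:R * tau)).
  have /andP[q0 q1] := floor_itv (t / (k%:R * tau)).
  exists (t - q%:~R * (k%:R * tau)).
    rewrite /= in_itv /= subr_ge0 -ler_pdivlMr// q0 /=.
    rewrite lerBlDl -[X in _ + X]mul1r -mulrDl -ler_pdivrMr// -(intrD _ q 1).
    exact: ltW.
  by apply/esym/Ek; exists q; rewrite subrK.
suff ET : range E = [set: M] by have [t _ Et] : range E m by [rewrite ET]; exists t.
apply: connectedM.
- by exists (E 0), 0.
- exists (range E); last by rewrite setTI.
  rewrite openE => _ [t _ <-]; rewrite /interior.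
  by apply: lift_open; exact: filterT.
- exists (range E); last by rewrite setTI.
  rewrite rangeE; apply: compact_closed => //; apply: continuous_compact.
    exact: continuous_subspaceT.
  exact: segment_compact.
Qed.

Lemma circle_factor : exists (F : M -> 'rV[R]_2) (Q : 'rV[R]_2 -> 'rV[R]_2) (r' : R),
  [/\ 0 < r', continuous F, injective F, forall m, sphere r' (F m) &
      forall y, sphere r' y -> exists m, F m = y] /\
  [/\ smooth setT Q, forall m, Q (F m) = X m &
      forall z a b, sphere r' z -> dot ('D_a Q z) ('D_b Q z) = dot a b].
Proof.
have [k [k0 Ek]] := lift_period; have [t tE] := choice lift_surjective.
have kn : k%:R != 0 :> R by rewrite pnatr_eq0 -lt0n.
(* With this radius the derivative of x0 (z / rho)^k on the circle of radius rho has modulus k r /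
   rho = 1, and [g] has exactly the period 2 pi k of E. *)
pose rho := k%:R * r; have rho0 : 0 < rho by rewrite mulr_gt0// ltr0n.
pose g s := rho *: cis (s / k%:R).
pose F m := g (t m).
have gE a b : g a = g b <-> E a = E b.
  split=> [ab|/Ek[q ->]].
    have [|q qE] := @cis_inj R (a / k%:R) (b / k%:R).
      by apply: (scalerI (lt0r_neq0 rho0)); exact: ab.
    apply/Ek; exists q; apply: (mulIf (invr_neq0 kn)); rewrite qE mulrDl.
    by congr (_ + _); rewrite /tau; field.
  have -> : g (b + q%:~R * (k%:R * tau)) = rho *: cis (b / k%:R + q%:~R * tau).
    by rewrite /g; congr (_ *: cis _); field.
  by rewrite cis_periodic.
have FE s : F (E s) = g s by apply/gE; rewrite tE.
have cg : continuous g.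
  move=> s; have cs : {for s, continuous (fun s : R => s / k%:R)}.
    exact (contM (@cvg_id _ (nbhs s)) (@contC _ _ _ (k%:R^-1 : R) s)).
  exact (contZ (@contC _ _ _ rho s) (cont_comp cs (@continuous_cis R _))).
have sg s : sphere rho (g s).
  by rewrite /sphere /= /g dotZl dotZr dot_cis mulr1.
exists F, (cpow (X p) rho k), rho; split; split.
- exact: rho0.
(* E is open and onto, so F inherits continuity from g = F o E. *)
- move=> m V; rewrite -(tE m) FE => Vm.
  apply: filterS (lift_open (cg _ _ Vm)) => _ [s Vs <-].
  by rewrite /preimage /= FE.
- by move=> a b /gE; rewrite !tE.
- by move=> m; exact: sg.
- move=> y Sy; have du : dot (rho *: cis 0) (rho *: cis 0) = rho ^+ 2.
    by rewrite dotZl dotZr dot_cis mulr1.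
  have [s ->] := rotation_exists rho0 du Sy; exists (E (s * k%:R)).
  by rewrite FE /g mulfK// cmulZl -cisD add0r.
- exact: smooth_cpow.
- by move=> m; rewrite cpow_cis ?gt_eqF// -[in RHS](tE m) XE mulrC divfK.
- move=> z a b Sz; have D v : 'D_v (cpow (X p) rho k) z =
      r^-1 *: cmul (cpow (X p) rho k.-1 z) v.
    have [_ ->] := is_derive_cpow (X p) rho k z v; congr (_ *: _).
    by rewrite /rho; field; rewrite gt_eqF.
  rewrite !D dotZl dotZr dot_cmul dot_cpow// dX.
  by field; rewrite gt_eqF.
Qed.

End CircleCover.

(** * From constant norm to the round sphere, and the conclusion *)

Lemma isometric_of_const_norm (R : realType) n (M : manifold R n)
    (X : M -> 'rV[R]_n.+1) (r : R) (p : M) :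
  (1 <= n)%N -> connected [set: M] -> compact [set: M] -> immersion X ->
  0 < r -> (forall m, sphere r (X m)) -> exists2 r' : R, 0 < r' & isometric_to_sphere X r'.
Proof.
rewrite leq_eqVlt => /orP[/eqP n1|n2] connectedM compactM imX r0 Xr.
  subst n; have cX := smooth_map_continuous imX.1.
  have hausM := @manifold_hausdorff _ _ M; have ls := manifold_sections imX r0 Xr.
  have cf : continuous (fun t : R => cmul (X p) (cis t)).
    by move=> t; exact (cont_cmul (@contC _ _ _ (X p) t) (@continuous_cis R t)).
  have fS (t : R) : sphere r (cmul (X p) (cis t)).
    by rewrite /sphere /= dot_cmul dot_cis mulr1; exact: Xr.
  have [E [cE XE _]] := lift_exists hausM compactM cX ls cf fS (cmul_cis0 (X p)).
  have [F [Q [r' [[r'0 cF injF Fr' surjF] [sQ QF isoQ]]]]] :=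
    circle_factor hausM compactM connectedM cX r0 Xr ls cE XE.
  by exists r' => //; exact: (isometric_of_factor p imX compactM r0 Xr cF injF Fr' surjF sQ QF isoQ).
exists r => //; have cX := smooth_map_continuous imX.1.
have hausM := @manifold_hausdorff _ _ M; have ls := manifold_sections imX r0 Xr.
have injX : injective X.
  by move=> a b; exact: (sphere_cover_injective hausM compactM connectedM cX r0 Xr ls n2).
have surjX := sphere_cover_surjective hausM compactM connectedM cX r0 Xr ls n2 p.
apply: (@isometric_of_factor _ _ _ X X id r r p imX compactM r0 Xr cX injX Xr surjX) => //.
  by move=> k; exact: (Ck_linear k setT idfun).
by move=> z a b _; rewrite !derive_id.
Qed.

Theorem proposition1p1 (R : realType) (n : nat) (n_ge1 : (1 <= n)%N)
    (lambda : R) (M : manifold R n) (X N : M -> 'rV[R]_n.+1)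
    (M_nonempty : [set: M] !=set0)
    (M_connected : connected [set: M])
    (M_compact : compact [set: M])
    (X_lambda : lambda_hypersurface lambda X N)
    (H_le : forall p : M,
      (mean_curvature X N p - lambda / 2) ^+ 2 <= n%:R + lambda ^+ 2 / 4) :
  (forall p : M,
      (mean_curvature X N p - lambda / 2) ^+ 2 = n%:R + lambda ^+ 2 / 4) /\
  (exists2 r : R, 0 < r & isometric_to_sphere X r).
Proof.
have [imX unN XN] := X_lambda; have cX := smooth_map_continuous imX.1.
have cu : {within [set: M], continuous (fun m => dot (X m) (X m))}.
  by apply: continuous_subspaceT => m; exact (cont_dot (@cX m) (@cX m)).
have [p _ maxp] := compact_EVT_max M_nonempty M_compact cu.
have uE m : n%:R + mean_curvature X N m * dot (X m) (N m) =
    n%:R + lambda ^+ 2 / 4 - (mean_curvature X N m - lambda / 2) ^+ 2.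
  have -> : dot (X m) (N m) = lambda - mean_curvature X N m by rewrite -(XN m) addrK.
  by field.
have subharmonic m : 0 <= n%:R + mean_curvature X N m * dot (X m) (N m).
  by rewrite uE subr_ge0.
have Hbound m : `|mean_curvature X N m| <= `|lambda / 2| + Num.sqrt (n%:R + lambda ^+ 2 / 4).
  rewrite -[X in `|X|](subrK (lambda / 2)) addrC.
  apply: le_trans (ler_normD _ _) _; rewrite lerD2l -sqrtr_sqr.
  exact: ler_wsqrtr.
have maxX m : dot (X m) (X m) <= dot (X p) (X p) by apply: maxp; rewrite inE.
have constX := norm_const imX unN M_compact Hbound subharmonic maxX M_connected
  (ex_intro _ p erefl).
(* With |X| constant every point is a maximum of the barrier with a = 0, so the Hopf inequality
   gives the reverse of [subharmonic]. *)
have hopf m : n%:R + mean_curvature X N m * dot (X m) (N m) <= 0.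
  have /(hopf_inequality imX unN) : \forall q \near m,
      barrier X 0 0 0 0 q <= barrier X 0 0 0 0 m.
    by apply: nearW => q; rewrite /barrier !constX !mul0r.
  by rewrite mul0r addr0.
split=> [m|].
  apply/eqP; rewrite eq_le H_le /= -subr_le0 -uE.
  exact: hopf.
(* If X vanished at p, the inequality [hopf] would read n <= 0. *)
have r0 : 0 < dot (X p) (X p).
  rewrite lt_def dot_ge0 andbT dot_eq0; apply/eqP => Xp0.
  by have := hopf p; rewrite Xp0 dot0l mulr0 addr0 lern0 -leqn0 leqNgt n_ge1.
apply: (@isometric_of_const_norm _ _ _ _ (Num.sqrt (dot (X p) (X p))) p) => //.
  by rewrite sqrtr_gt0.
by move=> m; rewrite /sphere /= sqr_sqrtr ?dot_ge0.
Qed.
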